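(* Let $\Theta=\sum_{k=1}^\infty\theta_k\delta_{\psi_k}$ be an exponential CRM on $\Psi$ with no fixed-location atoms and with ordinary component having rate measure $\nu(d\theta)\cdot G(d\psi)$, where $G$ is a diffuse probability distribution on $\Psi$ and $$\nu(d\theta)=\gamma\exp\{\langle\xi,\eta(\theta)\rangle+\lambda[-A(\theta)]\}\,d\theta,\qquad \nu(\mathbb{R}_+)=\infty .$$ Conditional on $\Theta$, let $X_n=\sum_{k=1}^\infty x_{n,k}\delta_{\psi_k}$, $n=1,\dots,N$, be i.i.d. across $n$, generated according to an exponential CRM with fixed-location atoms at $\{\psi_k\}_{k=1}^\infty$ and no ordinary component, with the $x_{n,k}\in\{0,1,2,\dots\}$ independent and $x_{n,k}$ having probability mass function $$h(x\mid\theta_k)=\kappa(x)\exp\{\langle\eta(\theta_k),\phi(x)\rangle-A(\theta_k)\}$$ (so that the prior is the conjugate prior for this likelihood). Suppose $\sum_{x=1}^\infty\int\nu(d\theta)\,h(x\mid\theta)<\infty$. Then the marginal distribution of $X_{1:N}=(X_1,\dots,X_N)$ is the same as that provided by the following construction. For each $n=1,2,\dots,N$: 1. Let $\{\psi_k\}_{k=1}^{K_{n-1}}$ be the union of the atom locations in $X_1,\dots,X_{n-1}$ (with $K_0=0$), and let $x_{m,k}:=X_m(\{\psi_k\})$ for $m\le n-1$. Independently across $k$, the weight $x_{n,k}$ of $X_n\mid X_1,\dots,X_{n-1}$ at $\psi_k$ has probability mass function $$h_{cond}(x_{n,k}=x\mid x_{1:(n-1),k})=\kappa(x)\exp\left\{-B\left(\xi+\sum_{m=1}^{n-1}\phi(x_{m,k}),\lambda+n-1\right)+B\left(\xi+\sum_{m=1}^{n-1}\phi(x_{m,k})+\phi(x),\lambda+n\right)\right\}.$$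 2. For each $x=1,2,\dots$, $X_n$ has $\rho_{n,x}$ new atoms of weight $x$, at locations $\{\psi_{n,x,j}\}_{j=1}^{\rho_{n,x}}$ with $\{\psi_{n,x,j}\}_{j=1}^{\rho_{n,x}}\cap\{\psi_k\}_{k=1}^{K_{n-1}}=\emptyset$ a.s., where $$M_{n,x}:=\gamma\cdot\kappa(0)^{n-1}\kappa(x)\cdot\exp\{B(\xi+(n-1)\phi(0)+\phi(x),\lambda+n)\},$$ $\rho_{n,x}\sim\mathrm{Poisson}(M_{n,x})$ independently across $n,x$, and $\psi_{n,x,j}\sim G$ i.i.d. across $n,x,j$, these being independent of each other and of the draws in step 1.
   Context: $\Psi$ is a measurable space whose $\sigma$-algebra contains all singletons; $\mathbb{R}_+$ denotes the non-negative reals (if the parameter $\theta$ of $h$ ranges only over a measurable subset of $\mathbb{R}_+$, all weights, densities and rate measures in $\theta$ are supported on, and all integrals are over, that subset); $d\theta$ is Lebesgue measure. A completely random measure (CRM) on $\Psi$ is a random measure taking independent values on disjoint measurable sets; its ordinary component with rate measure $\nu(d\theta)G(d\psi)$ is $\sum_k\theta_k\delta_{\psi_k}$ where $\{(\theta_k,\psi_k)\}$ are the points of a Poisson point process on $\mathbb{R}_+\times\Psi$ with that rate (mean) measure; a fixed-location component is a sum of independent random weights at deterministic distinct locations. CRMs here have no deterministic component. Exponential CRM: a CRM whose fixed-location atoms have weights with densities (with respect to Lebesgue or counting measure) of the form $\kappa(\theta)\exp\{\langle\eta(\zeta_k),\phi(\theta)\rangle-A(\zeta_k)\}$, with base density $\kappa$,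 natural parameter function $\eta$, sufficient statistic $\phi$, log partition function $A$ shared across atoms, and whose ordinary component has weight rate measure of the form $\nu(d\theta)=\gamma\exp\{\langle\eta(\zeta),\phi(\theta)\rangle\}d\theta$ with the same $\eta,\phi$. The prior above is an exponential CRM with sufficient statistic $(\eta',-A)'$ and natural parameter $(\xi',\lambda)'$. Here $B(\xi,\lambda)=\log\int\exp\{\langle\xi,\eta(\theta)\rangle-\lambda A(\theta)\}\,d\theta$. When $\kappa(x)=0$, the quantities $M_{n,x}$ and $h_{cond}(x_{n,k}=x\mid\cdot)$ are $0$. A weight $x_{n,k}=0$ means that $X_n$ has no atom at $\psi_k$; $x_{1:(n-1),k}$ means $(x_{1,k},\dots,x_{n-1,k})$. *)

(* Defs.v *)
From mathcomp Require Import all_boot all_order all_algebra finmap.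
From mathcomp Require Import all_classical all_reals all_analysis measurable_realfun.

Set Implicit Arguments.
Unset Strict Implicit.
Unset Printing Implicit Defensive.

Import Order.TTheory GRing.Theory Num.Theory.
Import numFieldNormedType.Exports.

Local Open Scope classical_set_scope.
Local Open Scope ring_scope.

Definition sigma_of {I : Type} {T : Type} {d'} {T' : measurableType d'}
    (D : set I) (X : I -> T -> T') : set (set T) :=
  <<s \bigcup_(i in D) preimage_set_system setT (X i) measurable >>.

(* Mutual independence of a family of classes of events: the product rule on
   every finite subfamily. *)
Definition mutual_independence {d} {T : measurableType d} {R : realType}
    (P : probability T R) {I : choiceType} (F : I -> set (set T)) : Prop :=
  forall (J : {fset I}) (E : I -> set T), (forall i, i \in J -> F i (E i)) ->
    P (\bigcap_(i in [set` J]) E i) = (\prod_(i <- J) P (E i))%E.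

(* Given the sigma-algebra F, the counts x i, each of interest only on an event
   D i of F, are conditionally independent and x i has the (F-measurable) random
   probability mass function p i w : nat -> \bar R. *)
Definition cond_indep_pmf {d} {T : measurableType d} {R : realType}
    (P : probability T R) (F : set (set T)) {I : choiceType} (D : I -> set T)
    (x : I -> T -> nat) (p : I -> T -> nat -> \bar R) : Prop :=
  forall (J : {fset I}) (v : I -> nat) (A : set T),
    F A -> A `<=` \bigcap_(i in [set` J]) D i ->
    P (A `&` \bigcap_(i in [set` J]) (x i @^-1` [set v i])) =
      (\int[P]_(w in A) \prod_(i <- J) p i w (v i))%E.

Definition point_count {R : realType} {T : Type} {d'} {T' : measurableType d'}
    (Z : nat -> T -> T') (A : set T') (w : T) : \bar R :=
  (\sum_(k <oo) \d_(Z k w) A)%E.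

(* The points Z 0, Z 1, ... form a Poisson point process with mean measure mu.
   The second argument of [poisson_prob] is a dummy. *)
Record poisson_point_process {d} {T : measurableType d} {R : realType}
    (P : probability T R) {d'} {T' : measurableType d'}
    (Z : nat -> T -> T') (mu : set T' -> \bar R) : Prop :=
  PoissonPointProcess {
  ppp_poisson : forall A, measurable A -> (mu A < +oo)%E -> forall n : nat,
    P (point_count Z A @^-1` [set n%:R%:E : \bar R]) =
      poisson_prob (fine (mu A)) 0 [set n] ;
  ppp_infinite : forall A, measurable A -> mu A = +oo%E ->
    P (point_count Z A @^-1` [set +oo%E : \bar R]) = 1%E ;
  ppp_independent : forall A : nat -> set T', (forall i, measurable (A i)) ->
    trivIset setT A ->
    mutual_independence P
      (fun i => g_sigma_algebra_preimage (point_count (R := R) Z (A i)))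
}.

(* Theta = \sum_k theta_k \delta_{psi_k} is a CRM on Psi with neither a
   deterministic nor a fixed-location component, whose ordinary component has
   rate measure nu(dtheta) G(dpsi); the weights take their values in S. *)
Record ordinary_CRM {d} {T : measurableType d} {R : realType}
    (P : probability T R) {dp} {Psi : measurableType dp} (S : set R)
    (nu : {measure set R -> \bar R}) (G : probability Psi R)
    (theta : nat -> {RV P >-> R}) (psi : nat -> {RV P >-> Psi})
    (Theta : T -> {measure set Psi -> \bar R}) : Prop := OrdinaryCRM {
  ordinary_weights : forall k w, S (theta k w) ;
  ordinary_points :
    poisson_point_process P (fun k w => (theta k w, psi k w)) (nu \x G)%E ;
  ordinary_atoms : forall w A, measurable A ->
    Theta w A = (\sum_(k <oo) (theta k w)%:E * \d_(psi k w) A)%E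
}.

(* Conditionally on the sigma-algebra F, the X_n = \sum_k x_{n,k} \delta_{psi_k}
   are i.i.d. CRMs with fixed-location atoms at the psi_k and no other component,
   x_{n,k} having probability mass function p_k. *)
Record fixed_CRMs {d} {T : measurableType d} {R : realType}
    (P : probability T R) {dp} {Psi : measurableType dp} (N : nat)
    (F : set (set T)) (psi : nat -> {RV P >-> Psi})
    (p : nat -> T -> nat -> \bar R)
    (x : 'I_N -> nat -> {RV P >-> nat})
    (X : 'I_N -> T -> {measure set Psi -> \bar R}) : Prop := FixedCRMs {
  fixed_weights : cond_indep_pmf P F (fun=> setT)
    (fun nk : 'I_N * nat => x nk.1 nk.2) (fun nk => p nk.2) ;
  fixed_atoms : forall n w A, measurable A ->
    X n w A = (\sum_(k <oo) (x n k w)%:R%:E * \d_(psi k w) A)%E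
}.

Definition dotv {R : realType} {D : nat} (u v : 'rV[R]_D) : R :=
  \sum_(i < D) u 0 i * v 0 i.

Record expFamily (R : realType) (D : nat) := ExpFamily {
  base_density : nat -> R ;            (* kappa *)
  natural_param : R -> 'rV[R]_D ;      (* eta *)
  sufficient_stat : nat -> 'rV[R]_D ;  (* phi *)
  log_partition : R -> R               (* A *)
}.

Section exponential_family.
Context {R : realType} {D : nat}.
Variables (S : set R) (f : expFamily R D).
Local Notation kappa := (base_density f).
Local Notation eta := (natural_param f).
Local Notation phi := (sufficient_stat f).
Local Notation A := (log_partition f).
Local Notation mu := (@lebesgue_measure R).

Definition likelihood (t : R) (x : nat) : R :=
  kappa x * expR (dotv (eta t) (phi x) - A t).

Record is_expFamily : Prop := IsExpFamily {
  base_density_ge0 : forall x, 0 <= kappa x ;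
  measurable_natural_param :
    forall i, measurable_fun S (fun t => eta t 0 i) ;
  measurable_log_partition : measurable_fun S A ;
  likelihood_sum1 :
    forall t, S t -> (\sum_(x <oo) (likelihood t x)%:E = 1)%E
}.

(* an exponential-CRM weight rate with sufficient statistic (eta, -A) and natural
   parameter (xi, lambda) *)
Definition conjugate_rate (gamma : R) (xi : 'rV[R]_D) (lambda : R) (t : R) : R :=
  gamma * expR (dotv xi (eta t) + lambda * (- A t)).

(* The integral, and hence B, may be infinite. *)
Definition B (xi : 'rV[R]_D) (lambda : R) : \bar R :=
  lne (\int[mu]_(t in S) (expR (dotv xi (eta t) - lambda * A t))%:E)%E.

(* h_cond(x | u) for the past weights u = (x_1, ..., x_{n-1}); in \bar R, both
   this and [new_rate] vanish when kappa x = 0, as 0 * +oo = 0. *)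
Definition hcond (xi : 'rV[R]_D) (lambda : R) (u : seq nat) (x : nat) : \bar R :=
  ((kappa x)%:E *
   expeR (- B (xi + \sum_(a <- u) phi a) (lambda + (size u)%:R)
          + B (xi + \sum_(a <- u) phi a + phi x)
              (lambda + (size u).+1%:R)))%E.

(* M_{n,x}, for n >= 1 *)
Definition new_rate (gamma : R) (xi : 'rV[R]_D) (lambda : R) (n x : nat) : \bar R :=
  ((gamma * kappa 0 ^+ n.-1 * kappa x)%:E *
   expeR (B (xi + phi 0%N *+ n.-1 + phi x) (lambda + n%:R)))%E.

End exponential_family.

(* The atoms of the construction are labelled (m, i, j): the j-th atom that first
   appears in the m-th measure with weight i.+1. Stages are numbered from 0, so
   m : 'I_N stands for stage m.+1 of the mathematical text, and j from 0. *)
Definition label (N : nat) : choiceType := ('I_N * nat * nat)%type.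
Definition birth {N} (e : label N) : 'I_N := e.1.1.
Definition first_weight {N} (e : label N) : nat := e.1.2.+1.

Section construction.
Context {d} {T : measurableType d} {R : realType} (P : probability T R)
  {dp} {Psi : measurableType dp} {N : nat}.
(* rho n i is the number of new atoms of weight i.+1 at stage n *)
Variables (rho : 'I_N -> nat -> {RV P >-> nat}) (psi : label N -> {RV P >-> Psi}).
(* y n e is the weight of the atom e in the n-th measure *)
Variable y : 'I_N -> label N -> {RV P >-> nat}.

(* the label e is used, i.e. it is an atom of the measures from stage [birth e] *)
Definition present (e : label N) : set T :=
  [set w | (e.2 < rho (birth e) e.1.2 w)%N].

(* x_{1:(n-1),k}: the weights of e in the measures before stage n *)
Definition history (n : 'I_N) (e : label N) (w : T) : seq nat :=
  [seq y m e w | m : 'I_N <- enum 'I_N & (m < n)%N].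

(* the sigma-algebra generated by all that is drawn before stage n *)
Definition past (n : 'I_N) : set (set T) :=
  <<s sigma_of [set me : 'I_N * label N | (me.1 < n)%N]
        (fun me => y me.1 me.2 : T -> nat) `|`
      sigma_of [set mi : 'I_N * nat | (mi.1 < n)%N]
        (fun mi => rho mi.1 mi.2 : T -> nat) `|`
      sigma_of [set e : label N | (birth e < n)%N] (fun e => psi e : T -> Psi) >>.

(* the past together with the weights drawn in step 1 of stage n *)
Definition past_and_step1 (n : 'I_N) : set (set T) :=
  <<s past n `|`
      sigma_of [set e : label N | (birth e < n)%N] (fun e => y n e : T -> nat) >>.

(* the draws of stage n: None stands for step 1 (and the past), inl i for the
   number of new atoms of weight i.+1, inr (i, j) for the location of the j-th
   new atom of weight i.+1 *)
Definition stage_events (n : 'I_N) (k : option (nat + nat * nat)) : set (set T) :=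
  match k with
  | None => past_and_step1 n
  | Some (inl i) => g_sigma_algebra_preimage (rho n i)
  | Some (inr ij) => g_sigma_algebra_preimage (psi (n, ij.1, ij.2))
  end.

Record construction (G : probability Psi R) (hc : seq nat -> nat -> \bar R)
    (M : nat -> nat -> \bar R) (Y : 'I_N -> T -> {measure set Psi -> \bar R}) :
    Prop := Construction {
  weight_absent : forall (n : 'I_N) e w, ~ present e w \/ (n < birth e)%N -> y n e w = 0%N ;
  weight_birth : forall e w, present e w -> y (birth e) e w = first_weight e ;
  weight_draw : forall n : 'I_N,
    cond_indep_pmf P (past n)
      (fun e : label N => [set w | (birth e < n)%N /\ present e w])
      (fun e => y n e) (fun e w => hc (history n e w)) ;
  number_law : forall (n : 'I_N) i U,
    distribution P (rho n i) U = poisson_prob (fine (M n.+1 i.+1)) 0 U ;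
  location_law : forall e C, measurable C -> distribution P (psi e) C = G C ;
  stage_independent : forall n, mutual_independence P (stage_events n) ;
  (* new locations differ from the old ones and from each other, so that
     [y n e w] is the mass of Y n w at psi e w, for a.e. w *)
  location_distinct : {ae P, forall w, forall e e' : label N,
    present e w -> present e' w -> psi e w = psi e' w -> e = e'} ;
  construction_atoms : forall n w A, measurable A ->
    Y n w A = (\esum_(e in [set: label N]) ((y n e w)%:R%:E * \d_(psi e w) A))%E
}.

End construction.

Definition measure_tuple_events {R : realType} {dp} (Psi : measurableType dp)
    (N : nat) : set (set ('I_N -> {measure set Psi -> \bar R})) :=
  sigma_of [set nA : 'I_N * set Psi | measurable nA.2]
    (fun nA (mu : 'I_N -> {measure set Psi -> \bar R}) =>
       mu nA.1 nA.2 : \bar R).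

Definition same_law {R : realType} {dp} {Psi : measurableType dp} {N : nat}
    {d} {T : measurableType d} (P : probability T R)
    (X : 'I_N -> T -> {measure set Psi -> \bar R})
    {d'} {T' : measurableType d'} (Q : probability T' R)
    (Y : 'I_N -> T' -> {measure set Psi -> \bar R}) : Prop :=
  forall E : set ('I_N -> {measure set Psi -> \bar R}), measure_tuple_events E ->
    P [set w | E (X ^~ w)] = Q [set w | E (Y ^~ w)].

(* Main.v *)
From HB Require Import structures.
Require Import Defs.
From mathcomp Require Import all_boot all_order all_algebra finmap.
From mathcomp Require Import all_classical all_reals all_analysis measurable_realfun.
From mathcomp Require Import ring.

Set Implicit Arguments.
Unset Strict Implicit.
Unset Printing Implicit Defensive.

Import Order.TTheory GRing.Theory Num.Theory.
Import numFieldNormedType.Exports.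

Local Open Scope classical_set_scope.
Local Open Scope ring_scope.

(** A tuple of integer-valued random measures is determined in law by the Laplace
functionals E exp(- sum_l t_l X_{n_l}(A_l)), that is, for a purely atomic tuple,
by the means of exp(- sum over the atoms of sum_n x_n tau_n(psi)), where x_n are
the weights of the atom at psi and the costs tau_n are nonnegative functions on
Psi. Indeed Laplace transforms determine the laws of integer variables
([laplace_unique]); applied to one count at a time this gives the probabilities
of all cylinders, which form a pi-system ([same_law_laplace]). So it suffices to
compute the Laplace functional on both sides.

For the data, write h^(theta, s) for the sum over v of h(v | theta) exp(- s v).
Averaging out the weights given the points ([laplace_data]) turns the discount
exp(- cost) of an atom (theta, psi) into the product over n of
h^(theta, tau_n(psi)), and the Laplace functional of the Poisson process of the
points ([ppp_laplace]) then gives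
  exp(- int (1 - prod_n h^(theta, tau_n(psi))) nu(dtheta) G(dpsi)).

For the construction, let I(u), for a finite sequence u of weights, be the
integral of prod_m h(u_m | theta) with respect to nu ([path_mass]). The conjugacy
of the prior means that I(u) is gamma prod_m kappa(u_m) exp B, with B taken at the
updated parameters ([path_mass_rate]). Hence h_cond(v | u) is the ratio
I(u v) / I(u), and M_{n,x} is I(0, ..., 0, x) with n - 1 zeros ([hcond_mass],
[new_rate_mass]). For an atom with past weights u, the posterior mean of its
discount at the end of the construction is therefore a martingale under step 1
([predictive_rec]). In step 2 the atoms of weight x that are born at stage n are
Poisson in number and independently located, so that they multiply the mean of
the total discount by exp(- M_{n,x} (1 - q_{n,x})), where q_{n,x} is the mean of
their discounts ([box_discount], [poisson_pgf]). By splitting according to the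
stage and the weight at which a point of the prior is first seen, the sum of the
M_{n,x} (1 - q_{n,x}) telescopes to the exponent found for the data
([total_rate]).

Two points need care. As the total mass of nu is infinite, only those I(u) are
used for which u has a nonzero weight; they are finite because the expected number
of atoms of each X_n is. And the ratio I(u v) / I(u) means nothing when I(u) is 0:
almost surely no atom has such a history ([mass_ae]). *)

(** * The extended exponential and monotone limits *)

Section exponential.
Context {R : realType}.
Local Open Scope ereal_scope.
Implicit Types (x y : \bar R) (a : (\bar R)^nat).

(** The extended exponential turns suprema into infima, because it is an
    increasing bijection onto [0, +oo]. *)
Lemma cvg_expeRN a : nondecreasing_seq a ->
  expeR (- a n) @[n --> \oo] --> expeR (- ereal_sup (range a)).
Proof.
move=> a_nd.
have ea_ni : nonincreasing_seq (fun n => expeR (- a n)).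
  by move=> m n mn; rewrite lee_expeR leeN2 a_nd.
rewrite [X in _ --> X](_ : _ = ereal_inf (range (fun n => expeR (- a n)))).
  exact: ereal_nonincreasing_cvgn.
apply/eqP; rewrite eq_le; apply/andP; split.
  apply: le_ereal_inf_tmp => _ [n _ <-].
  by rewrite lee_expeR leeN2; apply: ereal_sup_ubound; exists n.
have : 0 <= ereal_inf (range (fun n => expeR (- a n))).
  by apply: le_ereal_inf_tmp => _ [n _ <-]; exact: expeR_ge0.
move=> /expeR_total[z zE]; rewrite -zE lee_expeR leeNr.
apply: ge_ereal_sup => _ [n _ <-]; rewrite leeNr -lee_expeR zE.
by apply: ereal_inf_lbound; exists n.
Qed.

Lemma nneseries_sup (u : (\bar R)^nat) : (forall k, 0 <= u k) ->
  \sum_(k <oo) u k = ereal_sup (range (fun n => \sum_(0 <= k < n) u k)).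
Proof.
move=> u0; apply/cvg_lim => //; apply: ereal_nondecreasing_cvgn.
exact: (@ereal_nondecreasing_series _ u xpredT 0).
Qed.

Lemma cvg_expeRN_series (u : (\bar R)^nat) : (forall k, 0 <= u k) ->
  expeR (- (\sum_(0 <= k < n) u k)) @[n --> \oo] --> expeR (- \sum_(k <oo) u k).
Proof.
move=> u0; rewrite nneseries_sup//; apply: cvg_expeRN.
exact: (@ereal_nondecreasing_series _ u xpredT 0).
Qed.

Lemma expeRN_sum (I : Type) (r : seq I) (P : pred I) (u : I -> \bar R) :
  (forall i, P i -> 0 <= u i) ->
  expeR (- (\sum_(i <- r | P i) u i)) = \prod_(i <- r | P i) expeR (- u i).
Proof.
move=> u0; elim: r => [|i r IHr]; first by rewrite !big_nil oppe0 expeR0.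
rewrite !big_cons; case: ifPn => // Pi; rewrite -IHr -expeRD oppeD//.
by apply: ge0_adde_def; rewrite inE ?u0// sume_ge0.
Qed.

Lemma expeRN_le1 x : 0 <= x -> expeR (- x) <= 1.
Proof. by move=> x0; rewrite -expeR0 lee_expeR leeNl oppe0. Qed.

Lemma expeRN_lneN x : 0 <= x -> expeR (- - lne x) = x.
Proof. by move=> x0; rewrite oppeK lneK// in_itv/= x0 leey. Qed.

Lemma measurable_expeR : measurable_fun [set: \bar R] expeR.
Proof.
move=> _; apply: (measurability _ (ErealGenCInfty.measurableE R)) => //.
move=> _ [_ [r ->] <-]; rewrite setTI.
have [r0|r0] := leP r 0%R.
  rewrite [X in measurable X](_ : _ = setT)//; apply/seteqP; split => // x _ /=.
  by rewrite in_itv/= andbT (le_trans _ (expeR_ge0 x))// lee_fin.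
rewrite [X in measurable X](_ : _ = `[(ln r)%:E, +oo[%classic).
  exact: emeasurable_itv.
by apply/seteqP; split => x /=; rewrite !in_itv/= !andbT -(lee_expeR (ln r)%:E)/= lnK.
Qed.

Lemma measurable_lne : measurable_fun [set: \bar R] (@lne R).
Proof.
move=> _; apply: (measurability _ (ErealGenCInfty.measurableE R)) => //.
move=> _ [_ [r ->] <-]; rewrite setTI.
rewrite [X in measurable X](_ : _ = `[(expR r)%:E, +oo[%classic).
  exact: emeasurable_itv.
apply/seteqP; split => x /=; rewrite !in_itv/= !andbT.
  have [x0|x0] := leP x 0; first by rewrite le0_lneNy// leeNy_eq.
  by rewrite -lee_expeR lneK// in_itv/= leey ltW.
move=> rx; rewrite -lee_expeR lneK// in_itv/= leey andbT.
by rewrite (le_trans _ rx)// lee_fin expR_ge0.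
Qed.

Lemma measurable_expeRN d (T : measurableType d) (f : T -> \bar R) :
  measurable_fun [set: T] f -> measurable_fun [set: T] (fun t => expeR (- f t)).
Proof.
move=> mf; apply: (measurableT_comp measurable_expeR).
exact: measurableT_comp.
Qed.

End exponential.

Lemma measurable_nneseries d (T : measurableType d) (R : realType) (D : set T)
    (h : nat -> T -> \bar R) : (forall k w, 0 <= h k w)%E ->
  (forall k, measurable_fun D (h k)) ->
  measurable_fun D (fun w => \sum_(k <oo) h k w)%E.
Proof.
move=> h0 mh; have := @ge0_emeasurable_sum _ _ _ D h xpredT (fun k w _ _ => h0 k w).
by apply=> k _; exact: mh.
Qed.

Lemma nneseriesZle (R : realType) (c : \bar R) (u : (\bar R)^nat) :
  (forall k, 0 <= u k)%E -> (0 <= c)%E ->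
  (\sum_(k <oo) c * u k = c * \sum_(k <oo) u k)%E.
Proof.
move=> u0 c0; rewrite -!ge0_integral_count// => [|k]; last by rewrite mule_ge0.
by rewrite ge0_integralZl.
Qed.

Lemma nneseriesS (R : realType) (u : (\bar R)^nat) :
  (forall k, 0 <= u k)%E ->
  (\sum_(k <oo) u k = u 0%N + \sum_(k <oo) u k.+1)%E.
Proof.
move=> u0; rewrite nneseries_recl// -nneseries_addn//; congr (_ + _)%E.
by apply: eq_eseriesr => k _; rewrite addn1.
Qed.

Section transfer.
Context {R : realType}.
Import HBNNSimple.
Local Open Scope ereal_scope.

Lemma cvg_ge0_integral d (T : measurableType d)
    (mu : {measure set T -> \bar R}) (g : (T -> \bar R)^nat) (f : T -> \bar R) :
  (forall n, measurable_fun setT (g n)) -> (forall n x, 0 <= g n x) ->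
  (forall x, nondecreasing_seq (g ^~ x)) ->
  (forall x, g n x @[n --> \oo] --> f x) ->
  \int[mu]_x g n x @[n --> \oo] --> \int[mu]_x f x.
Proof.
move=> mg g0 ndg gf.
have -> : \int[mu]_x f x = \int[mu]_x (fun x => limn (g ^~ x)) x.
  by apply: eq_integral => x _; apply/esym/cvg_lim => //; exact: gf.
by apply: cvg_monotone_convergence => // x _; exact: ndg.
Qed.

Lemma nondecreasing_cvg_sup (a : (\bar R)^nat) (l : \bar R) :
  nondecreasing_seq a -> a n @[n --> \oo] --> l -> ereal_sup (range a) = l.
Proof.
by move=> a_nd al; apply: (cvg_unique _ (ereal_nondecreasing_cvgn a_nd)).
Qed.

Lemma cvg_expeRN_lim (a : (\bar R)^nat) (l : \bar R) :
  nondecreasing_seq a -> a n @[n --> \oo] --> l ->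
  expeR (- a n) @[n --> \oo] --> expeR (- l).
Proof.
by move=> a_nd al; rewrite -(nondecreasing_cvg_sup a_nd al); exact: cvg_expeRN.
Qed.

(** The integrands are bounded by 1, so that l may take the value +oo. *)
Lemma cvg_integral_expeRN d (T : measurableType d) (P : probability T R)
    (a : (T -> \bar R)^nat) (l : T -> \bar R) :
  (forall n, measurable_fun setT (a n)) -> measurable_fun setT l ->
  (forall n w, 0 <= a n w) ->
  (forall w, nondecreasing_seq (a ^~ w)) ->
  (forall w, a n w @[n --> \oo] --> l w) ->
  \int[P]_w expeR (- a n w) @[n --> \oo] --> \int[P]_w expeR (- l w).
Proof.
move=> ma ml a0 a_nd al; apply: (@dominated_cvg _ _ _ P setT measurableT _ _ (cst 1)) => //.
- by move=> n; exact: measurable_expeRN.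
- by move=> w _; exact: cvg_expeRN_lim.
- exact: finite_measure_integrable_cst.
- by move=> n w _; rewrite gee0_abs ?expeR_ge0// expeRN_le1.
Qed.

(** Equality of the weighted laws of V1 and V2, that is equality on
    indicators, extends to all nonnegative test functions by approximation
    from below with simple functions. *)
Lemma ge0_integral_transfer d1 (T1 : measurableType d1) d2
    (T2 : measurableType d2) d (U : measurableType d)
    (mu1 : {measure set T1 -> \bar R}) (mu2 : {measure set T2 -> \bar R})
    (W1 : T1 -> \bar R) (W2 : T2 -> \bar R) (V1 : T1 -> U) (V2 : T2 -> U)
    (phi : U -> \bar R) :
  measurable_fun setT W1 -> measurable_fun setT W2 ->
  measurable_fun setT V1 -> measurable_fun setT V2 ->
  (forall x, 0 <= W1 x) -> (forall x, 0 <= W2 x) ->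
  (forall C, measurable C ->
    \int[mu1]_x (W1 x * (\1_C (V1 x))%:E) =
    \int[mu2]_x (W2 x * (\1_C (V2 x))%:E)) ->
  measurable_fun setT phi -> (forall u, 0 <= phi u) ->
  \int[mu1]_x (W1 x * phi (V1 x)) = \int[mu2]_x (W2 x * phi (V2 x)).
Proof.
move=> mW1 mW2 mV1 mV2 W10 W20 eqI mphi phi0.
pose g := nnsfun_approx measurableT mphi.
have g0 n u : (0 <= g n u)%R by [].
have cv d' (T : measurableType d') (mu : {measure set T -> \bar R})
    (W : T -> \bar R) (V : T -> U) : measurable_fun setT W ->
    measurable_fun setT V -> (forall x, 0 <= W x) ->
    \int[mu]_x (W x * (g n (V x))%:E) @[n --> \oo] -->
    \int[mu]_x (W x * phi (V x)).
  move=> mW mV W0; apply: cvg_ge0_integral.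
  - move=> n; apply: emeasurable_funM => //; apply/measurable_EFinP.
    exact: measurableT_comp.
  - by move=> n x; rewrite mule_ge0// lee_fin.
  - move=> x m n mn; rewrite lee_wpmul2l// lee_fin.
    exact/lefP/nd_nnsfun_approx.
  - move=> x; have gphi : (g n (V x))%:E @[n --> \oo] --> phi (V x).
      exact: (cvg_nnsfun_approx measurableT mphi (fun u _ => phi0 u)).
    have [phi0x|phi_neq0] := eqVneq (phi (V x)) 0; last first.
      have [Wfin|] := boolP (W x \is a fin_num); first exact: cvgeZl.
      rewrite ge0_fin_numE// -leNgt leye_eq => /eqP ->.
      by apply: cvgeM => //; [by rewrite mule_def_infty_neq0 | exact: cvg_cst].
    rewrite phi0x mule0 (_ : (fun n => _) = cst 0); first exact: cvg_cst.
    apply/funext => n; suff -> : g n (V x) = 0%R by rewrite mule0.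
    have ndg : nondecreasing_seq (fun n => (g n (V x))%:E).
      by move=> m k mk; rewrite lee_fin; exact/lefP/nd_nnsfun_approx.
    suff : (g n (V x))%:E <= phi (V x).
      by rewrite phi0x lee_fin => gle0; apply/eqP; rewrite eq_le gle0 g0.
    rewrite (cvg_unique _ gphi (ereal_nondecreasing_cvgn ndg))//.
    by apply: ereal_sup_ubound; exists n.
have sum_indic n u : (g n u)%:E =
    \sum_(y \in range (g n)) (y * \1_(g n @^-1` [set y]) u)%:E.
  by rewrite [X in X%:E](fimfunE (g n)) fsumEFin.
suff eq_g n : \int[mu1]_x (W1 x * (g n (V1 x))%:E) =
    \int[mu2]_x (W2 x * (g n (V2 x))%:E).
  apply: (cvg_unique _ (cv _ _ mu1 _ _ mW1 mV1 W10)) => //.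
  by rewrite /= (funext eq_g); exact: cv.
have expand d' (T : measurableType d') (mu : {measure set T -> \bar R})
    (W : T -> \bar R) (V : T -> U) : measurable_fun setT W ->
    measurable_fun setT V -> (forall x, 0 <= W x) ->
    \int[mu]_x (W x * (g n (V x))%:E) =
    \sum_(y \in range (g n)) `|y|%:E *
       \int[mu]_x (W x * (\1_(g n @^-1` [set y]) (V x))%:E).
  move=> mW mV W0.
  have mI y : measurable_fun setT (fun x => (\1_(g n @^-1` [set y]) (V x))%:E : \bar R).
    by apply/measurable_EFinP; apply: measurableT_comp.
  under eq_integral => x _.
    rewrite sum_indic (eq_fsbigr (fun y => (`|y| * \1_(g n @^-1` [set y]) (V x))%:E)); last first.
      by move=> y /set_mem[u _ <-]; rewrite ger0_norm.
    rewrite ge0_mule_fsumr; last by move=> y; rewrite lee_fin mulr_ge0.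
    under eq_fsbigr do rewrite EFinM muleCA.
    over.
  rewrite ge0_integral_fsum//=; last 2 first.
  - by move=> y; apply: emeasurable_funM => //; exact: emeasurable_funM.
  - by move=> y x _; rewrite !mule_ge0// lee_fin.
  apply: eq_fsbigr => y _; rewrite ge0_integralZl_EFin//.
  - by move=> x _; rewrite mule_ge0// lee_fin.
  - exact: emeasurable_funM.
rewrite !expand//; apply: eq_fsbigr => y _; rewrite eqI//.
Qed.

Lemma ge0_integral_transfer_id d1 (T1 : measurableType d1) d2
    (T2 : measurableType d2)
    (mu1 : {measure set T1 -> \bar R}) (mu2 : {measure set T2 -> \bar R})
    (W1 V1 : T1 -> \bar R) (W2 V2 : T2 -> \bar R) :
  measurable_fun setT W1 -> measurable_fun setT W2 ->
  measurable_fun setT V1 -> measurable_fun setT V2 ->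
  (forall x, 0 <= W1 x) -> (forall x, 0 <= W2 x) ->
  (forall x, 0 <= V1 x) -> (forall x, 0 <= V2 x) ->
  (forall C, measurable C ->
    \int[mu1]_x (W1 x * (\1_C (V1 x))%:E) =
    \int[mu2]_x (W2 x * (\1_C (V2 x))%:E)) ->
  \int[mu1]_x (W1 x * V1 x) = \int[mu2]_x (W2 x * V2 x).
Proof.
move=> mW1 mW2 mV1 mV2 W10 W20 V10 V20 eqI.
(* the identity is nonnegative only where V1 and V2 take their values *)
under eq_integral do rewrite -(gee0_abs (V10 _)).
under [RHS]eq_integral do rewrite -(gee0_abs (V20 _)).
by apply: (ge0_integral_transfer (phi := abse)).
Qed.

End transfer.

(** * Independence and conditional independence of integrands *)

Section finite_families.
Context {I : choiceType}.

Lemma set_fset_seq (s : seq I) : [set` [fset j in s]%fset] = [set` s].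
Proof. by apply/seteqP; split => j /=; rewrite !inE. Qed.

Lemma perm_fset_seq (s : seq I) : uniq s -> perm_eq [fset j in s]%fset s.
Proof.
move=> us; apply: uniq_perm; rewrite ?fset_uniq//.
by move=> j; rewrite !inE.
Qed.

End finite_families.

Section independence.
Context {d} {T : measurableType d} {R : realType} (P : probability T R).
Local Open Scope ereal_scope.

Lemma measurable_prode (D : set T) (I : eqType) (s : seq I) (h : I -> T -> \bar R) :
  (forall i, i \in s -> measurable_fun D (h i)) ->
  measurable_fun D (fun w => \prod_(i <- s) h i w).
Proof.
elim: s => [|i s IHs] mh; first by under eq_fun do rewrite big_nil; exact: measurable_cst.
under eq_fun do rewrite big_cons.
apply: emeasurable_funM; first by apply: mh; rewrite mem_head.
by apply: IHs => j js; apply: mh; rewrite inE js orbT.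
Qed.

Lemma measurable_indice (E : set T) : measurable E ->
  measurable_fun setT (fun w => (\1_E w)%:E : \bar R).
Proof. by move=> mE; exact/measurable_EFinP. Qed.

Lemma prode_indic (I : eqType) (s : seq I) (E : I -> set T) (w : T) :
  \prod_(i <- s) (\1_(E i) w)%:E = (\1_(\bigcap_(i in [set` s]) E i) w)%:E :> \bar R.
Proof.
elim: s => [|i s IHs].
  by rewrite big_nil indicE (_ : \bigcap_(i in _) _ = setT) ?in_setT//; apply/seteqP; split.
rewrite big_cons IHs (_ : \bigcap_(j in [set` i :: s]) E j = E i `&` \bigcap_(j in [set` s]) E j).
  by rewrite indicI EFinM.
apply/seteqP; split => [v sv|v [Ev sv] j /=].
  split; first by apply: sv; rewrite /= mem_head.
  by move=> j js; apply: sv; rewrite /= inE js orbT.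
by rewrite inE => /predU1P[->//|]; exact: sv.
Qed.

(** Only one factor at a time is generalized from an indicator to a
    nonnegative function, the others acting as a weight. *)
Lemma mutual_independence_prod (I : choiceType) (F : I -> set (set T))
    (phi : I -> T -> \bar R) (s : seq I) :
  mutual_independence P F -> (forall i, F i `<=` measurable) ->
  (forall i, i \in s -> forall C, measurable C -> F i (phi i @^-1` C)) ->
  (forall i w, 0 <= phi i w) -> uniq s ->
  \int[P]_w \prod_(i <- s) phi i w = \prod_(i <- s) \int[P]_w phi i w.
Proof.
move=> indF Fmeas Fphi phi0 us.
suff gen s1 s2 (E : I -> set T) : {subset s1 <= s} -> uniq (s1 ++ s2) ->
    (forall i, i \in s2 -> F i (E i)) ->
    \int[P]_w (\prod_(i <- s1) phi i w * \prod_(i <- s2) (\1_(E i) w)%:E) =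
    \prod_(i <- s1) \int[P]_w phi i w * \prod_(i <- s2) P (E i).
  have := gen s [::] (fun=> set0); rewrite cats0 big_nil mule1 => /(_ _ us) <- //.
  by apply: eq_integral => w _; rewrite big_nil mule1.
elim: s1 s2 E => [|i s1 IHs] s2 E s1s us12 FE.
  rewrite big_nil mul1e.
  under eq_integral do rewrite big_nil mul1e prode_indic.
  rewrite integral_indic//; last first.
    apply: fin_bigcap_measurable => // j js; apply: Fmeas; exact: FE.
  have indFE := indF [fset j in s2]%fset E; rewrite set_fset_seq in indFE.
  rewrite setIT; etransitivity; first by apply: indFE => j; rewrite inE; exact: FE.
  exact/perm_big/perm_fset_seq.
rewrite [in RHS]big_cons -[RHS]muleA.
set c := \prod_(i <- s1) _ * \prod_(i <- s2) _.
have si : i \in s by apply: s1s; rewrite mem_head.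
have mphi j : j \in s -> measurable_fun setT (phi j).
  by move=> js _ C mC; rewrite setTI; apply: (Fmeas j); exact: Fphi.
have s1s' : {subset s1 <= s} by move=> j js; apply: s1s; rewrite inE js orbT.
have c0 : 0 <= c.
  by rewrite mule_ge0// prode_ge0// => j _; rewrite ?integral_ge0.
transitivity (\int[P]_w (c * phi i w)); last first.
  by rewrite [RHS]muleC ge0_integralZl//; exact: mphi.
transitivity (\int[P]_w (\prod_(i <- s1) phi i w * \prod_(i <- s2) (\1_(E i) w)%:E * phi i w)).
  by apply: eq_integral => w _; rewrite big_cons [RHS]muleC muleA.
apply: ge0_integral_transfer_id => //.
- apply: emeasurable_funM.
  + by apply: measurable_prode => j js; apply: mphi; exact: s1s'.
  + by apply: measurable_prode => j js; apply: measurable_indice; apply: (Fmeas j); exact: FE.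
- exact: mphi.
- exact: mphi.
- by move=> w; rewrite mule_ge0// prode_ge0// => j _; rewrite lee_fin.
move=> C mC.
have FC : F i (phi i @^-1` C) by exact: Fphi.
pose E' j := if j == i then phi i @^-1` C else E j.
have E'E j : j \in s2 -> E' j = E j.
  move: us12; rewrite /= mem_cat negb_or => /andP[/andP[_ is2] _] js2.
  by rewrite /E'; case: eqVneq => // ji; rewrite -ji js2 in is2.
have us12' : uniq (s1 ++ i :: s2).
  by rewrite -cat1s uniq_catCA.
have FE' j : j \in i :: s2 -> F j (E' j).
  rewrite inE => /predU1P[->|js2]; first by rewrite /E' eqxx.
  by rewrite E'E//; exact: FE.
have E'_prod (h : set T -> \bar R) :
    \prod_(j <- i :: s2) h (E' j) = h (phi i @^-1` C) * \prod_(j <- s2) h (E j).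
  rewrite big_cons {1}/E' eqxx; congr (_ * _).
  by apply: eq_big_seq => j js; rewrite E'E.
have := IHs (i :: s2) E' s1s' us12' FE'.
rewrite E'_prod muleCA -/c muleC => IH.
have mC' : measurable (phi i @^-1` C) by exact: (Fmeas i).
have mI : measurable_fun [set: T] (fun w => (\1_C (phi i w))%:E : \bar R).
  exact: (measurable_indice mC').
rewrite (ge0_integralZl _ _ mI)//.
rewrite [in RHS](_ : (fun w => _) = (fun w => (\1_(phi i @^-1` C) w)%:E))//.
rewrite integral_indic// setIT -IH; apply: eq_integral => w _.
rewrite (E'_prod (fun A => (\1_A w)%:E)).
by rewrite [X in _ = _ * X]muleC muleA.
Qed.

End independence.

Section conditional_independence.
Context {d} {T : measurableType d} {R : realType} (P : probability T R).
Local Open Scope ereal_scope.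

Lemma measurable_sub_sigma_algebra (C : set (set T)) d' (U : measurableType d')
    (f : T -> U) : C `<=` measurable ->
  measurable_fun [set: g_sigma_algebraType C] f -> measurable_fun [set: T] f.
Proof.
move=> Cmeas mf _ B mB; have := mf measurableT _ mB.
by apply: smallest_sub; [exact: sigma_algebra_measurable | exact: Cmeas].
Qed.

Lemma indic_fiber (K : eqType) (f : T -> K) (k : K) w :
  \1_(f @^-1` [set k]) w = (k == f w)%:R :> R.
Proof.
rewrite indicE; congr (_%:R); congr nat_of_bool.
by apply/idP/eqP => [/set_mem -> //|fw]; apply/mem_set.
Qed.

Lemma nneseries_indic_eq (u : nat -> \bar R) (n : nat) : (forall v, 0 <= u v) ->
  \sum_(v <oo) u v * (v == n)%:R%:E = u n.
Proof.
move=> u0; rewrite (@nneseriesD1 _ _ n)//; last by move=> k _; rewrite mule_ge0// lee_fin.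
rewrite eqxx mule1 eseries0 ?adde0// => k _ /andP[_ /negPf kn].
by rewrite kn mule0.
Qed.

(** The integrated form of conditional independence given <<s C>>: weights
    that are known given <<s C>> can be averaged separately over each of the
    variables. As in [mutual_independence_prod], one factor at a time is
    generalized from an indicator. *)
Lemma cond_indep_prod (C : set (set T)) (I : choiceType) (s : seq I)
    (x : I -> T -> nat) (p a : I -> T -> nat -> \bar R) :
  C `<=` measurable -> uniq s ->
  (forall (v : I -> nat) A, <<s C >> A ->
    P (A `&` \bigcap_(i in [set` s]) (x i @^-1` [set v i])) =
    \int[P]_(w in A) \prod_(i <- s) p i w (v i)) ->
  (forall i v, measurable (x i @^-1` [set v])) ->
  (forall i v, i \in s -> measurable_fun setT (fun w => p i w v)) ->
  (forall i w v, 0 <= p i w v) ->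
  (forall i v, i \in s ->
     measurable_fun [set: g_sigma_algebraType C] (fun w => a i w v)) ->
  (forall i w v, 0 <= a i w v) ->
  \int[P]_w \prod_(i <- s) a i w (x i w) =
  \int[P]_w \prod_(i <- s) \sum_(v <oo) a i w v * p i w v.
Proof.
move=> Cmeas us indep mx mp p0 ma a0.
have maT i v : i \in s -> measurable_fun setT (fun w => a i w v).
  by move=> si; apply: measurable_sub_sigma_algebra (ma i v si).
have mxI i v : measurable_fun setT (fun w => (v == x i w)%:R%:E : \bar R).
  rewrite (_ : (fun _ => _) = (fun w => (\1_(x i @^-1` [set v]) w)%:E)).
    exact/measurable_EFinP/measurable_indic.
  by apply/funext => w; rewrite indic_fiber.
have mxa i : i \in s -> measurable_fun setT (fun w => a i w (x i w)).
  move=> si; under eq_fun => w do rewrite -(nneseries_indic_eq _ (a0 i w)).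
  apply: measurable_nneseries => [v w|v].
    by rewrite mule_ge0// lee_fin.
  by apply: emeasurable_funM => //; exact: maT.
have msum i : i \in s -> measurable_fun setT (fun w => \sum_(v <oo) a i w v * p i w v).
  move=> si; apply: measurable_nneseries => [v w|v].
    by rewrite mule_ge0.
  by apply: emeasurable_funM => //; [exact: maT|exact: mp].
have sub12 s1 s2 : perm_eq (s1 ++ s2) s -> {subset s1 <= s} /\ {subset s2 <= s}.
  by move=> /perm_mem e; split => i si; rewrite -e mem_cat si ?orbT.
suff gen s1 s2 (v : I -> nat) (H : T -> \bar R) : perm_eq (s1 ++ s2) s ->
    measurable_fun [set: g_sigma_algebraType C] H -> (forall w, 0 <= H w) ->
    \int[P]_w (H w * \prod_(i <- s1) a i w (x i w) * \prod_(i <- s2) (v i == x i w)%:R%:E) =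
    \int[P]_w (H w * \prod_(i <- s1) (\sum_(v <oo) a i w v * p i w v) *
       \prod_(i <- s2) p i w (v i)).
  have := gen s [::] (fun=> 0%N) (cst 1); rewrite cats0 => /(_ (perm_refl _)).
  under eq_integral do rewrite big_nil mule1 mul1e.
  under [in RHS]eq_integral do rewrite big_nil mule1 mul1e.
  by apply => //; exact: measurable_cst.
elim: s1 => [|i s1 IHs] in s2 v H * => s12 mH H0.
  under eq_integral do rewrite big_nil mule1 muleC.
  under [RHS]eq_integral do rewrite big_nil mule1 muleC.
  have [_ s2s] := sub12 _ _ s12.
  have mHT := measurable_sub_sigma_algebra Cmeas mH.
  apply: ge0_integral_transfer_id => //.
  - by apply: measurable_prode => j _.
  - by apply: measurable_prode => j /s2s js; exact: mp.
  - by move=> w; rewrite prode_ge0// => j _; rewrite lee_fin.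
  - by move=> w; rewrite prode_ge0.
  move=> B mB.
  have CB : <<s C >> (H @^-1` B) by have := mH measurableT _ mB; rewrite setTI.
  have mHB : measurable (H @^-1` B) by rewrite -[X in measurable X]setTI; exact: mHT.
  transitivity (P (H @^-1` B `&` \bigcap_(i in [set` s]) (x i @^-1` [set v i]))).
    rewrite -[X in P X]setIT -integral_indic//; last first.
      apply: measurableI => //.
      by apply: fin_bigcap_measurable => // j js; exact: mx.
    apply: eq_integral => w _; rewrite indicI EFinM -prode_indic muleC.
    rewrite (perm_big s)/= ?(perm_trans _ s12)//; congr (_ * _).
    by apply: eq_bigr => j _; rewrite indic_fiber.
  rewrite [LHS]indep// [LHS]integral_mkcond; apply: eq_integral => w _.
  by rewrite epatch_indic; congr (_ * _); apply: perm_big; rewrite perm_sym.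
have [s1s s2s] := sub12 _ _ s12.
have si : i \in s by apply: s1s; rewrite mem_head.
have s1s' : {subset s1 <= s} by move=> j js; apply: s1s; rewrite inE js orbT.
have mHT := measurable_sub_sigma_algebra Cmeas mH.
have is2 : i \notin s2.
  have : uniq ((i :: s1) ++ s2) by rewrite (perm_uniq s12).
  by rewrite /= mem_cat negb_or => /andP[/andP[]].
pose v' n j := if j == i then n else v j.
have v'_prod n (h : I -> nat -> \bar R) :
    \prod_(j <- i :: s2) h j (v' n j) = h i n * \prod_(j <- s2) h j (v j).
  rewrite big_cons {1}/v' eqxx; congr (_ * _).
  apply: eq_big_seq => j js; rewrite /v'; case: eqVneq => // ji.
  by rewrite -ji js in is2.
have mprod n : measurable_fun setT (fun w =>
    \prod_(j <- i :: s2) (v' n j == x j w)%:R%:E : \bar R).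
  by apply: measurable_prode => j _.
have mpprod n : measurable_fun setT (fun w => \prod_(j <- i :: s2) p j w (v' n j)).
  apply: measurable_prode => j; rewrite inE => /predU1P[->|/s2s js]; exact: mp.
have mHa n : measurable_fun setT (fun w => H w * a i w n).
  by apply: emeasurable_funM => //; exact: maT.
have prodb0 n w : 0 <= \prod_(j <- i :: s2) (v' n j == x j w)%:R%:E :> \bar R.
  by apply: prode_ge0 => j _; rewrite lee_fin.
have prodS0 w : 0 <= \prod_(j <- s1) (\sum_(v <oo) a j w v * p j w v).
  by apply: prode_ge0 => j _; apply: nneseries_ge0 => n _ _; rewrite mule_ge0.
transitivity (\int[P]_w \sum_(n <oo) (H w * a i w n * \prod_(j <- s1) a j w (x j w) *
    \prod_(j <- i :: s2) (v' n j == x j w)%:R%:E)).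
  apply: eq_integral => w _.
  rewrite big_cons muleA -(nneseries_indic_eq (u := fun n => H w * a i w n *
    \prod_(j <- s1) a j w (x j w) * \prod_(j <- s2) (v j == x j w)%:R%:E) (x i w)).
    apply: eq_eseriesr => n _.
    by rewrite (v'_prod n (fun j k => (k == x j w)%:R%:E)) muleAC [in RHS]muleA.
  by move=> n; rewrite !mule_ge0// prode_ge0// => j _; rewrite lee_fin.
rewrite integral_nneseries//; last 2 first.
- move=> n; apply: emeasurable_funM => //; apply: emeasurable_funM => //.
  by apply: measurable_prode => j /s1s' js; exact: mxa.
- by move=> n w _; rewrite !mule_ge0// prode_ge0.
transitivity (\sum_(n <oo) \int[P]_w (H w * a i w n *
    \prod_(j <- s1) (\sum_(v <oo) a j w v * p j w v) * \prod_(j <- i :: s2) p j w (v' n j))).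
  apply: eq_eseriesr => n _; apply: IHs.
  - by rewrite (perm_trans _ s12)// -cat1s perm_catCA.
  - by apply: emeasurable_funM => //; exact: ma.
  - by move=> w; rewrite mule_ge0.
rewrite -integral_nneseries//; last 2 first.
- move=> n; apply: emeasurable_funM => //; apply: emeasurable_funM => //.
  by apply: measurable_prode => j /s1s' js; exact: msum.
- by move=> n w _; rewrite !mule_ge0// prode_ge0.
apply: eq_integral => w _.
set S1 := \prod_(j <- s1) _; set P2 := \prod_(j <- s2) p j w (v j).
have P20 : 0 <= P2 by rewrite prode_ge0.
rewrite big_cons -/S1.
transitivity (\sum_(n <oo) (H w * S1 * P2) * (a i w n * p i w n)).
  apply: eq_eseriesr => n _; rewrite (v'_prod n (fun j k => p j w k)) -/P2.
  by rewrite -!muleA; congr (_ * _); rewrite [LHS]muleCA [RHS]muleCA !muleA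
    (muleC _ P2) !muleA (muleC P2).
rewrite nneseriesZle//; last 2 first.
- by move=> n; rewrite mule_ge0.
- by apply: mule_ge0 => //; apply: mule_ge0 => //; exact: prodS0.
by rewrite [LHS]muleC !muleA (muleC _ (H w)).
Qed.

End conditional_independence.

(** * Laplace transforms of integer variables *)

Section probability_integrals.
Context {d} {T : measurableType d} {R : realType} (P : probability T R).
Local Open Scope ereal_scope.

Lemma integral_prob_cst (c : \bar R) : \int[P]_w c = c.
Proof. by rewrite integral_cst// [X in _ * X]probability_setT mule1. Qed.

Lemma integral_prob_le (f : T -> \bar R) (c : \bar R) :
  measurable_fun setT f -> (forall w, 0 <= f w) -> (forall w, f w <= c) ->
  \int[P]_w f w <= c.
Proof.
move=> mf f0 fc; rewrite -[leRHS]integral_prob_cst.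
by apply: ge0_le_integral => //; exact: measurable_cst.
Qed.

End probability_integrals.

Section laplace_uniqueness.
Context {R : realType}.
Local Open Scope ereal_scope.

Definition count_valued {T : Type} (V : T -> \bar R) :=
  forall w, V w = +oo \/ exists n : nat, V w = n%:R%:E.

Section one_measure.
Context {d} {T : measurableType d} (P : probability T R) (W V : T -> \bar R).
Hypotheses (mW : measurable_fun setT W) (mV : measurable_fun setT V).
Hypotheses (W0 : forall w, 0 <= W w) (W1 : forall w, W w <= 1).
Hypothesis V_count : count_valued V.

Definition point_mass (v : \bar R) : \bar R := \int[P]_w (W w * (v == V w)%:R%:E).

Let mVeq v : measurable_fun setT (fun w => (v == V w)%:R%:E : \bar R).
Proof.
rewrite (_ : (fun _ => _) = (fun w => (\1_(V @^-1` [set v]) w)%:E)).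
  apply: measurable_indice; rewrite -[X in measurable X]setTI.
  by apply: mV => //; exact: emeasurable_set1.
by apply/funext => w; rewrite indic_fiber.
Qed.

Let mWVeq v : measurable_fun setT (fun w => W w * (v == V w)%:R%:E).
Proof. by apply: emeasurable_funM => //; exact: mVeq. Qed.

Let WVeq0 v w : 0 <= W w * (v == V w)%:R%:E.
Proof. by rewrite mule_ge0// lee_fin. Qed.

Lemma point_mass_ge0 v : 0 <= point_mass v.
Proof. exact: integral_ge0. Qed.

Lemma point_mass_le1 v : point_mass v <= 1.
Proof.
apply: integral_prob_le => // w; case: (v == V w); rewrite ?mule1// mule0.
exact: lee01.
Qed.

(** The part of exp(-t V) that is carried by the events V = 0, ..., V = n. *)
Let eexp (t : R) (n : nat) (w : T) : \bar R :=
  \sum_(0 <= i < n.+1) (expR (- (t * i%:R)))%:E * (i%:R%:E == V w)%:R%:E.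

Let eexp_ge0 t n w : 0 <= eexp t n w.
Proof. by apply: sume_ge0 => i _; rewrite mule_ge0// lee_fin// expR_ge0. Qed.

Let measurable_eexp t n : measurable_fun setT (eexp t n).
Proof.
apply: emeasurable_sum => i; apply: emeasurable_funM; last exact: mVeq.
exact: measurable_cst.
Qed.

Let eexp_bounds (t : R) (n : nat) w : (0 < t)%R ->
  eexp t n w <= expeR (- (t%:E * V w)) /\
  expeR (- (t%:E * V w)) <= eexp t n w + (expR (- (t * n.+1%:R)))%:E.
Proof.
move=> t0; rewrite /eexp; case: (V_count w) => [->|[k ->]].
  rewrite big1 => [|i _]; last by rewrite mule0.
  have -> : expeR (- (t%:E * +oo)) = 0 by rewrite mulry gtr0_sg// mul1e.
  by rewrite add0e lexx; split => //; rewrite lee_fin expR_ge0.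
have [kn|nk] := ltnP k n.+1.
  have -> : \sum_(0 <= i < n.+1) (expR (- (t * i%:R)))%:E *
      (i%:R%:E == k%:R%:E :> \bar R)%:R%:E = (expR (- (t * k%:R)))%:E.
    rewrite big_mkord (bigD1 (Ordinal kn))//= eqxx mule1 big1 ?adde0// => i ik.
    rewrite eqe eqr_nat; have /negPf -> : nat_of_ord i != k by [].
    by rewrite mule0.
  by split; rewrite -EFinM -EFinN/= // -EFinD lee_fin lerDl expR_ge0.
rewrite big_nat big1 => [|i /andP[_ iN]]; last first.
  rewrite eqe eqr_nat; have /negPf -> : i != k by rewrite neq_ltn (leq_trans iN).
  by rewrite mule0.
rewrite add0e; split; rewrite -EFinM -EFinN/= lee_fin ?expR_ge0//.
by rewrite ler_expR lerN2 ler_pM2l// ler_nat.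
Qed.

Let integral_eexp t n : \int[P]_w (W w * eexp t n w) =
  \sum_(0 <= i < n.+1) (expR (- (t * i%:R)))%:E * point_mass i%:R%:E.
Proof.
under eq_integral => w _.
  rewrite ge0_sume_distrr; last by move=> i _; rewrite mule_ge0// lee_fin// expR_ge0.
  under eq_bigr do rewrite muleCA.
  over.
rewrite ge0_integral_sum//; last 2 first.
- by move=> i; apply: emeasurable_funM => //; exact: measurable_cst.
- by move=> i w _; rewrite mule_ge0// lee_fin expR_ge0.
apply: eq_bigr => i _; rewrite ge0_integralZl_EFin// ?expR_ge0//.
Qed.

(** Beyond n the integer V is at least n + 1, which bounds the rest of exp(-t V). *)
Lemma laplace_sandwich (t : R) (n : nat) : (0 < t)%R ->
  \sum_(0 <= i < n.+1) (expR (- (t * i%:R)))%:E * point_mass i%:R%:E <=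
    \int[P]_w (W w * expeR (- (t%:E * V w))) /\
  \int[P]_w (W w * expeR (- (t%:E * V w))) <=
    \sum_(0 <= i < n.+1) (expR (- (t * i%:R)))%:E * point_mass i%:R%:E +
    (expR (- (t * n.+1%:R)))%:E.
Proof.
move=> t0; have mexp : measurable_fun setT (fun w => W w * expeR (- (t%:E * V w))).
  apply: emeasurable_funM => //; apply: measurable_expeRN.
  by apply: emeasurable_funM => //; exact: measurable_cst.
have mWe := emeasurable_funM mW (measurable_eexp t n).
have We0 w : 0 <= W w * eexp t n w by rewrite mule_ge0.
rewrite -integral_eexp; split.
  apply: ge0_le_integral => // w _; rewrite lee_wpmul2l//.
  by have [] := eexp_bounds n w t0.
rewrite -[X in _ + X](integral_prob_cst P) -ge0_integralD//.
apply: ge0_le_integral => //.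
- by move=> w _; rewrite mule_ge0// expeR_ge0.
- by apply: emeasurable_funD => //; exact: measurable_cst.
move=> w _; have [_ le] := eexp_bounds n w t0.
apply: (le_trans (lee_wpmul2l (W0 w) le)).
rewrite ge0_muleDr ?eexp_ge0 ?lee_fin ?expR_ge0// leeD2l//.
by rewrite -[leRHS]mul1e lee_wpmul2r// lee_fin expR_ge0.
Qed.

Lemma integral_count_valued (phi : \bar R -> R) : (forall v, 0 <= phi v)%R ->
  \int[P]_w (W w * (phi (V w))%:E) =
  (\sum_(n <oo) (phi n%:R%:E)%:E * point_mass n%:R%:E) +
  (phi +oo%E)%:E * point_mass +oo%E.
Proof.
move=> phi0.
have I0 v : 0 <= (phi v)%:E :> \bar R by rewrite lee_fin.
have mC v : measurable_fun setT (fun w => (phi v)%:E * (W w * (v == V w)%:R%:E)).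
  by apply: emeasurable_funM => //; exact: measurable_cst.
have C0 v w : 0 <= (phi v)%:E * (W w * (v == V w)%:R%:E).
  by rewrite mule_ge0// mule_ge0// lee_fin.
transitivity (\int[P]_w (
    (\sum_(n <oo) (phi n%:R%:E)%:E * (W w * (n%:R%:E == V w)%:R%:E)) +
    (phi +oo%E)%:E * (W w * (+oo%E == V w)%:R%:E))).
  apply: eq_integral => w _; case: (V_count w) => [->|[k ->]].
    rewrite eseries0 => [|n _ _]; last by rewrite !mule0.
    by rewrite add0e eqxx mule1 muleC.
  have -> : (+oo%E == k%:R%:E :> \bar R) = false by [].
  rewrite !mule0 adde0 muleC -(nneseries_indic_eq (u := fun n =>
    (phi n%:R%:E)%:E * W w)) => [|n]; last by rewrite mule_ge0.
  by apply: eq_eseriesr => n _; rewrite eqe eqr_nat muleA.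
rewrite ge0_integralD//; last 2 first.
- by move=> w _; apply: nneseries_ge0.
- by apply: measurable_nneseries.
rewrite integral_nneseries// ge0_integralZl_EFin//; congr (_ + _).
by apply: eq_eseriesr => n _; rewrite ge0_integralZl_EFin.
Qed.

End one_measure.

(** When the masses below n agree, the two sandwiches at level n, multiplied by
    exp(t n), compare the masses of n up to exp(-t). *)
Lemma point_mass_le d1 (T1 : measurableType d1) (P1 : probability T1 R)
    (W1 V1 : T1 -> \bar R) d2 (T2 : measurableType d2) (P2 : probability T2 R)
    (W2 V2 : T2 -> \bar R) (n : nat) :
  measurable_fun setT W1 -> measurable_fun setT V1 ->
  measurable_fun setT W2 -> measurable_fun setT V2 ->
  (forall w, 0 <= W1 w) -> (forall w, W1 w <= 1) ->
  (forall w, 0 <= W2 w) -> (forall w, W2 w <= 1) ->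
  count_valued V1 -> count_valued V2 ->
  (forall t : R, (0 <= t)%R ->
    \int[P1]_w (W1 w * expeR (- (t%:E * V1 w))) =
    \int[P2]_w (W2 w * expeR (- (t%:E * V2 w)))) ->
  (forall i, (i < n)%N -> point_mass P1 W1 V1 i%:R%:E = point_mass P2 W2 V2 i%:R%:E) ->
  point_mass P1 W1 V1 n%:R%:E <= point_mass P2 W2 V2 n%:R%:E.
Proof.
move=> mW1 mV1 mW2 mV2 W10 W11 W20 W21 V1c V2c laplace_eq IHn.
set a := point_mass P1 W1 V1; set b := point_mass P2 W2 V2.
rewrite -/a -/b in IHn.
have afin v : a v \is a fin_num.
  by rewrite ge0_fin_numE ?point_mass_ge0// (le_lt_trans (point_mass_le1 _ _ _ _ _ _))// ltry.
have bfin v : b v \is a fin_num.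
  by rewrite ge0_fin_numE ?point_mass_ge0// (le_lt_trans (point_mass_le1 _ _ _ _ _ _))// ltry.
have key (t : R) : (0 < t)%R -> a n%:R%:E <= b n%:R%:E + (expR (- t))%:E.
  move=> t0.
  have [+ _] := laplace_sandwich P1 mW1 mV1 W10 W11 V1c n t0.
  have [_ +] := laplace_sandwich P2 mW2 mV2 W20 W21 V2c n t0.
  rewrite (laplace_eq t (ltW t0)) => h1 h2; have := le_trans h2 h1.
  rewrite !big_nat_recr//= -/a -/b.
  under eq_big_nat => i /andP[_ iltn] do rewrite IHn//.
  set s := \sum_(0 <= i < n) _.
  have sfin : s \is a fin_num by apply/sum_fin_numP => i _ _; rewrite fin_numM.
  rewrite -addeA leeD2lE// -natr1 mulrDr mulr1 opprD expRD EFinM -ge0_muleDr//.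
    by rewrite lee_pmul2l// lte_fin expR_gt0.
  exact: point_mass_ge0.
rewrite -(fineK (afin _)) -(fineK (bfin _)) lee_fin; apply/ler_addgt0Pr => e e0.
pose e' : R := Num.min e (2^-1)%R.
have e'0 : (0 < e')%R by rewrite lt_min e0 invr_gt0 ltr0n.
have e'1 : (e' < 1)%R by rewrite gt_min invf_lt1// ltr1n orbT.
(* t is chosen so that exp(-t) is at most e *)
have := key (- ln e')%R; rewrite oppr_gt0 ln_lt0 ?e'0// => /(_ isT).
rewrite opprK lnK// -(fineK (afin _)) -(fineK (bfin _)) -EFinD lee_fin => /le_trans; apply.
by rewrite lerD2l ge_min lexx.
Qed.

(** Laplace transforms determine the laws of (weighted) integer variables: the
    masses of 0, 1, 2, ... are the successive leading coefficients in exp(-t)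
    as t tends to infinity, and t = 0 gives the remaining mass of infinity. *)
Lemma laplace_unique d1 (T1 : measurableType d1) (P1 : probability T1 R)
    (W1 V1 : T1 -> \bar R) d2 (T2 : measurableType d2) (P2 : probability T2 R)
    (W2 V2 : T2 -> \bar R) (C : set \bar R) :
  measurable_fun setT W1 -> measurable_fun setT V1 ->
  measurable_fun setT W2 -> measurable_fun setT V2 ->
  (forall w, 0 <= W1 w) -> (forall w, W1 w <= 1) ->
  (forall w, 0 <= W2 w) -> (forall w, W2 w <= 1) ->
  count_valued V1 -> count_valued V2 ->
  (forall t : R, (0 <= t)%R ->
    \int[P1]_w (W1 w * expeR (- (t%:E * V1 w))) =
    \int[P2]_w (W2 w * expeR (- (t%:E * V2 w)))) ->
  \int[P1]_w (W1 w * (\1_C (V1 w))%:E) = \int[P2]_w (W2 w * (\1_C (V2 w))%:E).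
Proof.
move=> mW1 mV1 mW2 mV2 W10 W11 W20 W21 V1c V2c laplace_eq.
have mass_eq n : point_mass P1 W1 V1 n%:R%:E = point_mass P2 W2 V2 n%:R%:E.
  elim/ltn_ind: n => n IHn; apply/eqP; rewrite eq_le; apply/andP; split.
    exact: point_mass_le.
  apply: point_mass_le => // [t t0|i ?]; first by rewrite laplace_eq.
  by rewrite IHn.
have tot : \int[P1]_w W1 w = \int[P2]_w W2 w.
  have := laplace_eq 0%R (lexx _).
  under eq_integral do rewrite mul0e oppe0 expeR0 mule1.
  by under [in RHS]eq_integral do rewrite mul0e oppe0 expeR0 mule1.
rewrite !integral_count_valued//.
have -> : point_mass P1 W1 V1 +oo%E = point_mass P2 W2 V2 +oo%E.
  have total d (T : measurableType d) (P : probability T R) (W V : T -> \bar R) :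
      measurable_fun setT W -> measurable_fun setT V -> (forall w, 0 <= W w) ->
      count_valued V ->
      \int[P]_w W w = (\sum_(n <oo) point_mass P W V n%:R%:E) + point_mass P W V +oo%E.
    move=> mW mV W0 Vc; have := integral_count_valued P mW mV W0 Vc (phi := cst 1%R) (fun=> ler01).
    rewrite mul1e.
    under eq_integral do rewrite mule1.
    by move=> ->; congr (_ + _); apply: eq_eseriesr => n _; rewrite mul1e.
  have t1 := total _ _ P1 W1 V1 mW1 mV1 W10 V1c.
  have t2 := total _ _ P2 W2 V2 mW2 mV2 W20 V2c.
  have S2fin : \sum_(n <oo) point_mass P2 W2 V2 n%:R%:E \is a fin_num.
    rewrite ge0_fin_numE; last by apply: nneseries_ge0 => n _ _; exact: point_mass_ge0.
    apply: (@le_lt_trans _ _ 1); last exact: ltry.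
    apply: le_trans (integral_prob_le P2 mW2 W20 W21).
    by rewrite t2 leeDl// point_mass_ge0.
  move: tot; rewrite t1 t2 (eq_eseriesr (fun n _ => mass_eq n)).
  move/(congr1 (fun z => z - \sum_(n <oo) point_mass P2 W2 V2 n%:R%:E)).
  by rewrite !(addeAC _ (point_mass _ _ _ +oo%E)) subee// !add0e.
by congr (_ + _); apply: eq_eseriesr => n _; rewrite mass_eq.
Qed.

End laplace_uniqueness.

(** * The Laplace functional of a Poisson point process *)

Section counts.
Context {R : realType}.
Local Open Scope ereal_scope.

Lemma count_valued_series (T : Type) (u : nat -> T -> nat) :
  count_valued (fun w => \sum_(k <oo) (u k w)%:R%:E : \bar R).
Proof.
move=> w; pose s n := (\sum_(0 <= k < n) u k w)%N.
have sE n : \sum_(0 <= k < n) (u k w)%:R%:E = (s n)%:R%:E :> \bar R.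
  by rewrite sumEFin natr_sum.
rewrite nneseries_sup//; under eq_fun do rewrite sE.
have [[m sm]|nos] := pselect (exists m, forall n, (s n <= s m)%N).
  right; exists (s m); apply/eqP; rewrite eq_le; apply/andP; split.
    by apply: ge_ereal_sup => _ [n _ <-]; rewrite lee_fin ler_nat.
  by apply: ereal_sup_ubound; exists m.
left; have {}nos m : exists n, (s m < s n)%N.
  apply: contrapT => no; apply: nos; exists m => n; rewrite leqNgt.
  by apply/negP => smn; apply: no; exists n.
have big M : exists n, (M <= s n)%N.
  elim: M => [|M [n Mn]]; first by exists 0%N.
  by have [n' snn'] := nos n; exists n'; exact: leq_ltn_trans snn'.
apply/eqP; rewrite -leye_eq leNgt; apply/negP => lty.
have : ereal_sup (range (fun n => (s n)%:R%:E : \bar R)) \is a fin_num.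
  rewrite ge0_fin_numE//; apply: (@le_trans _ _ (s 0%N)%:R%:E); first by rewrite lee_fin.
  by apply: ereal_sup_ubound; exists 0%N.
move=> supfin; have [n] := big
  (Num.truncn (fine (ereal_sup (range (fun n => (s n)%:R%:E : \bar R))))).+1.
have : (s n)%:R%:E <= ereal_sup (range (fun n => (s n)%:R%:E : \bar R)).
  by apply: ereal_sup_ubound; exists n.
rewrite -[X in _ <= X -> _](fineK supfin) lee_fin => le1 le2.
set y := fine _ in le1 le2.
have : (y < (s n)%:R)%R.
  by apply: lt_le_trans (truncnS_gt y) _; rewrite ler_nat.
by rewrite ltNge le1.
Qed.

Lemma point_countE (T : Type) d' (U : measurableType d') (Z : nat -> T -> U)
    (A : set U) w :
  point_count (R := R) Z A w = \sum_(k <oo) ((Z k w \in A) : nat)%:R%:E.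
Proof. by apply: eq_eseriesr => k _; rewrite diracE. Qed.

Lemma count_valued_point_count (T : Type) d' (U : measurableType d')
    (Z : nat -> T -> U) (A : set U) : count_valued (point_count (R := R) Z A).
Proof.
move=> w; rewrite point_countE.
exact: (count_valued_series (fun k w => (Z k w \in A) : nat)).
Qed.

Lemma measurable_point_count d (T : measurableType d) d' (U : measurableType d')
    (Z : nat -> T -> U) (A : set U) : (forall k, measurable_fun setT (Z k)) ->
  measurable A -> measurable_fun setT (point_count (R := R) Z A).
Proof.
move=> mZ mA; apply: measurable_nneseries => k; first by [].
exact: (measurableT_comp (measurable_fun_dirac mA) (mZ k)).
Qed.

Lemma poisson_prob1 (a : R) (n : nat) : (0 < a)%R ->
  poisson_prob a 0 [set n] = (poisson_pmf a n)%:E.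
Proof.
move=> a0; rewrite /poisson_prob a0 esum_set1// lee_fin.
exact: poisson_pmf_ge0.
Qed.

Lemma poisson_pmf_sum1 (a : R) : (0 < a)%R ->
  \sum_(n <oo) (poisson_pmf a n)%:E = 1.
Proof.
move=> a0; have : poisson_prob a 0 [set: nat] = 1 := @probability_setT _ _ _ (poisson_prob a 0).
rewrite /poisson_prob a0 -nneseries_esumT// => n.
by rewrite lee_fin poisson_pmf_ge0.
Qed.

(** The generating function of a Poisson distribution of mean a is, up to a
    constant, the total mass of the Poisson distribution of mean a s. *)
Lemma poisson_pgf (a s : R) : (0 <= a)%R -> (0 <= s)%R ->
  \sum_(n <oo) (s ^+ n)%:E * poisson_prob a 0 [set n] = (expR (- (a * (1 - s))))%:E.
Proof.
rewrite le_eqVlt => /predU1P[<- s0|a0].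
  rewrite mul0r oppr0 expR0 -(nneseries_indic_eq (u := fun n => (s ^+ n)%:E) 0%N); last first.
    by move=> v; rewrite lee_fin exprn_ge0.
  apply: eq_eseriesr => n _; rewrite /poisson_prob ltxx diracE; congr (_ * _%:E).
  by congr (_%:R); congr nat_of_bool; apply/idP/eqP => [/set_mem//|->]; exact/mem_set.
rewrite le_eqVlt => /predU1P[<-|s0].
  have -> : (expR (- (a * (1 - 0))))%:E = (poisson_pmf a 0)%:E.
    by rewrite /poisson_pmf a0 subr0 mulr1 expr0 fact0 invr1 !mul1r.
  rewrite -(nneseries_indic_eq (u := fun n => (poisson_pmf a n)%:E) 0%N); last first.
    by move=> n; rewrite lee_fin poisson_pmf_ge0.
  by apply: eq_eseriesr => n _; rewrite poisson_prob1// expr0n muleC.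
rewrite mulrBr mulr1 opprB -[RHS]mule1 -(poisson_pmf_sum1 (mulr_gt0 a0 s0)).
rewrite -nneseriesZl => [|n _]; last by rewrite lee_fin poisson_pmf_ge0.
apply: eq_eseriesr => n _; rewrite poisson_prob1// -!EFinM; congr (_%:E).
rewrite /poisson_pmf a0 mulr_gt0// exprMn expRD !expRN (mulrC (expR (a * s))) -!mulrA.
rewrite (mulrCA (expR (a * s)) (a ^+ n)%R) (mulrCA (expR (a * s)) (s ^+ n)%R).
rewrite (mulrCA (expR (a * s)) (n`!%:R^-1)%R) divff ?gt_eqF ?expR_gt0// mulr1.
by rewrite mulrCA [RHS]mulrC -!mulrA.
Qed.

Section poisson_laplace.
Context {d} {T : measurableType d} (P : probability T R).
Import HBNNSimple.

Lemma integral_nat_rv (V : T -> \bar R) (phi : \bar R -> R) :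
  measurable_fun setT V -> count_valued V -> (forall v, 0 <= phi v)%R ->
  \int[P]_w (phi (V w))%:E =
  (\sum_(n <oo) (phi n%:R%:E)%:E * P (V @^-1` [set n%:R%:E])) +
  (phi +oo%E)%:E * P (V @^-1` [set +oo]).
Proof.
move=> mV Vc phi0.
have mass v : point_mass P (cst 1) V v = P (V @^-1` [set v]).
  rewrite /point_mass -[in RHS](setIT (V @^-1` _)) -integral_indic//.
    by apply: eq_integral => w _; rewrite mul1e indic_fiber.
  by rewrite -[X in measurable X]setTI; apply: mV => //; exact: emeasurable_set1.
have := integral_count_valued P (W := cst 1) (@measurable_cst _ _ _ _ _ _) mV (fun=> lee01) Vc phi0.
under eq_integral do rewrite mul1e.
by move=> ->; rewrite mass; congr (_ + _); apply: eq_eseriesr => n _; rewrite mass.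
Qed.

Context {d'} {U : measurableType d'} (Z : nat -> T -> U).
Hypothesis mZ : forall k, measurable_fun setT (Z k).
Variable mu : {measure set U -> \bar R}.
Hypothesis pppZ : poisson_point_process P Z mu.

Lemma ppp_count_laplace (A : set U) (y : R) : measurable A -> (0 <= y)%R ->
  \int[P]_w expeR (- (y%:E * point_count Z A w)) =
  expeR (- ((1 - expR (- y))%:E * mu A)).
Proof.
move=> mA y0.
have e01 : (0 <= 1 - expR (- y))%R by rewrite subr_ge0 -expR0 ler_expR oppr_le0.
pose phi v := fine (expeR (- (y%:E * v))).
have phi0 v : (0 <= phi v)%R by rewrite fine_ge0// expeR_ge0.
have Vc : count_valued (point_count (R := R) Z A) := @count_valued_point_count _ _ _ Z A.
have phin (n : nat) : (phi n%:R%:E = expR (- y) ^+ n)%R.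
  by rewrite /phi -EFinM -EFinN/= -expRM_natl mulrN mulrC.
have mcount := measurable_point_count mZ mA.
have cnt0 w : 0 <= point_count (R := R) Z A w.
  by apply: nneseries_ge0 => k _ _.
under eq_integral => w _.
  rewrite -(fineK (_ : expeR (- (y%:E * point_count Z A w)) \is a fin_num)); last first.
    rewrite ge0_fin_numE ?expeR_ge0//; apply: (@le_lt_trans _ _ 1); last exact: ltry.
    by apply: expeRN_le1; rewrite mule_ge0.
  over.
rewrite (integral_nat_rv mcount Vc phi0).
set N := point_count Z A.
have total : 1 = (\sum_(n <oo) P (N @^-1` [set n%:R%:E])) + P (N @^-1` [set +oo]).
  rewrite -[LHS](integral_prob_cst P).
  rewrite (integral_nat_rv mcount Vc (phi := cst 1%R) (fun=> ler01)) mul1e.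
  by congr (_ + _); apply: eq_eseriesr => n _; rewrite mul1e.
have sum0 : 0 <= \sum_(n <oo) P (N @^-1` [set n%:R%:E]) by exact: nneseries_ge0.
have [muA|muA] := ltP (mu A) +oo.
  have law n : P (N @^-1` [set n%:R%:E]) = poisson_prob (fine (mu A)) 0 [set n].
    exact: (ppp_poisson pppZ mA muA n).
  have fmu0 : (0 <= fine (mu A))%R by rewrite fine_ge0.
  (* the Poisson masses of the integers already add up to 1 *)
  have Poo : P (N @^-1` [set +oo]) = 0.
    move: total; under eq_eseriesr => n _.
      rewrite law -[poisson_prob _ _ _]mul1e -[X in X%:E * _](expr1n R n).
      over.
    rewrite (poisson_pgf fmu0 ler01) subrr mulr0 oppr0 expR0 => /(congr1 (fun z => z - 1)).
    by rewrite addeAC subee// add0e => <-.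
  rewrite Poo mule0 adde0; under eq_eseriesr do rewrite law phin.
  rewrite (poisson_pgf fmu0 (expR_ge0 _)) -(fineK (_ : mu A \is a fin_num)).
    by rewrite -EFinM/= mulrC.
  by rewrite ge0_fin_numE.
have {muA} muA : mu A = +oo by apply/eqP; rewrite eq_le leey.
have Poo : P (N @^-1` [set +oo]) = 1 by exact: (ppp_infinite pppZ mA muA).
have sumP0 : \sum_(n <oo) P (N @^-1` [set n%:R%:E]) = 0.
  move: total; rewrite Poo => /(congr1 (fun z => z - 1)).
  by rewrite subee// -addeA subee// adde0.
have -> : \sum_(n <oo) (phi n%:R%:E)%:E * P (N @^-1` [set n%:R%:E]) = 0.
  apply/eqP; rewrite eq_le; apply/andP; split; last first.
    by apply: nneseries_ge0 => n _ _; rewrite mule_ge0// lee_fin.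
  rewrite -[leRHS]sumP0; apply: lee_nneseries => [n _ _|n _].
    by rewrite mule_ge0// lee_fin.
  rewrite -[leRHS]mul1e lee_wpmul2r// lee_fin phin exprn_ile1// ?expR_ge0//.
  by rewrite -expR0 ler_expR oppr_le0.
rewrite Poo mule1 add0e muA /phi; have [->|yn0] := eqVneq y 0%R.
  by rewrite oppr0 expR0 subrr !mul0e oppe0 expeR0.
have {yn0}y0 : (0 < y)%R by rewrite lt_def yn0.
rewrite !gt0_muley ?lte_fin//=.
by rewrite subr_gt0 -expR0 ltr_expR oppr_lt0.
Qed.

Let simple_level (f : {nnsfun U >-> R}) (i : nat) : set U :=
  if (i < size (fset_set (range f)))%N
  then f @^-1` [set (nth 0%R (fset_set (range f)) i)] else set0.

(** For a simple function the sum over the points is a combination of the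
    independent Poisson counts of the level sets. *)
Lemma ppp_laplace_simple (f : {nnsfun U >-> R}) :
  \int[P]_w expeR (- \sum_(k <oo) (f (Z k w))%:E) =
  expeR (- \int[mu]_u (1 - expeR (- (f u)%:E))).
Proof.
set r : seq R := fset_set (range f).
have rfin : finite_set (range f) by [].
have ur : uniq r by exact: fset_uniq.
have r0 y : y \in r -> (0 <= y)%R.
  by rewrite in_fset_set// => /set_mem[u _ <-].
pose A := simple_level f.
have mA i : measurable (A i).
  by rewrite /A /simple_level; case: ifP.
have f_sum (g : R -> R) (u : U) :
    (g (f u))%:E = \sum_(i <- iota 0 (size r)) (g (nth 0%R r i))%:E * (\1_(A i) u)%:E.
  have fur : f u \in r by rewrite in_fset_set//; apply/mem_set; exists u.
  have ilt : (index (f u) r < size r)%N by rewrite index_mem.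
  rewrite (bigD1_seq (index (f u) r))/= ?iota_uniq ?mem_iota//.
  rewrite nth_index// {1}/A /simple_level ilt nth_index// indicE mem_set// mule1.
  rewrite big_seq_cond big1 ?adde0// => i /andP[]; rewrite mem_iota/= => ir ifu.
  rewrite /A /simple_level -/r ir indicE memNset ?mule0// => /= fui.
  by move: ifu; rewrite fui index_uniq// eqxx.
have nonneg_r i : i \in iota 0 (size r) -> (0 <= nth 0%R r i)%R.
  by rewrite mem_iota => ir; apply: r0; apply: mem_nth.
(* absolute values make the coefficients nonnegative whatever the index is *)
transitivity (\int[P]_w \prod_(i <- iota 0 (size r))
    expeR (- (`|nth 0%R r i|%:E * point_count Z (A i) w))).
  apply: eq_integral => w _; rewrite -expeRN_sum; last first.
    by move=> i _; rewrite mule_ge0//; apply: nneseries_ge0.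
  congr (expeR (- _)).
  under eq_eseriesr => k _.
    rewrite (f_sum id) big_seq_cond.
    under eq_bigr => i /andP[/nonneg_r/ger0_norm <- _] do over.
    rewrite -big_seq_cond; over.
  rewrite nneseries_sum; last by move=> i k _; rewrite mule_ge0// lee_fin.
  by apply: eq_bigr => i _; rewrite nneseriesZl.
have tA : trivIset setT A.
  apply/trivIsetP => i j _ _ ij; rewrite /A /simple_level -/r.
  case: ifP => ir; last by rewrite set0I.
  case: ifP => jr; last by rewrite setI0.
  apply/eqP/negP => /negP/set0P[u [/= fi fj]].
  by move: ij; rewrite -(nth_uniq 0%R ir jr ur) -fi -fj eqxx.
have mN i := measurable_point_count mZ (mA i).
rewrite (mutual_independence_prod (ppp_independent pppZ mA tA)) ?iota_uniq//; last 3 first.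
- by move=> i _ [B mB <-]; apply: mN.
- move=> i _ C mC; exists ((fun v => expeR (- (`|nth 0%R r i|%:E * v))) @^-1` C).
    rewrite -[X in measurable X]setTI; apply: measurable_expeRN => //.
    by apply: emeasurable_funM; [exact: measurable_cst | exact: measurable_id].
  by rewrite setTI.
- by move=> i w; exact: expeR_ge0.
under eq_bigr => i _ do rewrite (ppp_count_laplace (mA i) (normr_ge0 _)).
have e0 (y : R) : (0 <= 1 - expR (- `|y|))%R.
  by rewrite subr_ge0 -expR0 ler_expR oppr_le0.
rewrite -expeRN_sum; last by move=> i _; rewrite mule_ge0// lee_fin.
congr (expeR (- _)).
under [RHS]eq_integral => u _.
  rewrite -[X in expeR X]/((- f u)%:E) -EFinB -(ger0_norm (_ : 0 <= f u)%R)//.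
  rewrite (f_sum (fun y => 1 - expR (- `|y|))%R); over.
rewrite ge0_integral_sum//; last first.
  by move=> i; apply/measurable_EFinP; apply: measurable_funM.
apply: eq_bigr => i _; rewrite ge0_integralZl_EFin//; last exact/measurable_EFinP.
by rewrite integral_indic// setIT.
Qed.

(** Simple functions increase to f, along which both sides are continuous. *)
Lemma ppp_laplace (f : U -> \bar R) : measurable_fun setT f -> (forall u, 0 <= f u) ->
  \int[P]_w expeR (- \sum_(k <oo) f (Z k w)) =
  expeR (- \int[mu]_u (1 - expeR (- f u))).
Proof.
move=> mf f0; pose g := nnsfun_approx measurableT mf.
have gf u : (g n u)%:E @[n --> \oo] --> f u.
  exact: (cvg_nnsfun_approx measurableT mf (fun u _ => f0 u)).
have ndg u : nondecreasing_seq (fun n => (g n u)%:E).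
  by move=> m n mn; rewrite lee_fin; exact/lefP/nd_nnsfun_approx.
have g0 n u : 0 <= (g n u)%:E by rewrite lee_fin.
have mg n : measurable_fun setT (fun u => (g n u)%:E) by exact/measurable_EFinP.
have cvl : \int[P]_w expeR (- \sum_(k <oo) (g n (Z k w))%:E) @[n --> \oo] -->
    \int[P]_w expeR (- \sum_(k <oo) f (Z k w)).
  apply: cvg_integral_expeRN.
  - by move=> n; apply: measurable_nneseries => // k; exact: (measurableT_comp (mg n)).
  - by apply: measurable_nneseries => // k; exact: (measurableT_comp mf).
  - by move=> n w; apply: nneseries_ge0.
  - move=> w m n mn; apply: lee_nneseries => // k _; exact: ndg.
  - move=> w; rewrite -ge0_integral_count//.
    under eq_fun do rewrite -ge0_integral_count//.
    by apply: cvg_ge0_integral => // n; exact: ndg.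
have cvr : expeR (- \int[mu]_u (1 - expeR (- (g n u)%:E))) @[n --> \oo] -->
    expeR (- \int[mu]_u (1 - expeR (- f u))).
  have e1 x : 0 <= x -> 0 <= 1 - expeR (- x) by move=> x0; rewrite -(@subee _ 1)// leeB// expeRN_le1.
  have nd1 u : nondecreasing_seq (fun n => 1 - expeR (- (g n u)%:E)).
    by move=> m n mn; rewrite leeB// lee_expeR leeN2; exact: ndg.
  apply: cvg_expeRN_lim.
    move=> m n mn; apply: ge0_le_integral => //.
    - by move=> u _; exact: e1.
    - by apply: emeasurable_funB => //; exact: measurable_expeRN.
    - by apply: emeasurable_funB => //; exact: measurable_expeRN.
    - by move=> u _; exact: nd1.
  apply: cvg_ge0_integral => //.
  - by move=> n; apply: emeasurable_funB => //; exact: measurable_expeRN.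
  - by move=> n u; exact: e1.
  - move=> u; apply: cvgeB => //; first exact: cvg_cst.
    exact: cvg_expeRN_lim.
apply: (cvg_unique _ cvl) => //.
rewrite (_ : (fun n => _) = (fun n => expeR (- \int[mu]_u (1 - expeR (- (g n u)%:E))))).
  exact: cvr.
by apply/funext => n; exact: ppp_laplace_simple.
Qed.

End poisson_laplace.

End counts.

(** * The Laplace functional of the data *)

Lemma measurable_fun_nat d (U : measurableType d) (f : nat -> U) : measurable_fun setT f.
Proof. by []. Qed.

Section pmf_kernel.
Context {R : realType} {dt} {Th : measurableType dt}.
Local Open Scope ereal_scope.

Record pmf_kernel (h : Th -> nat -> R) : Prop := PmfKernel {
  pmf_kernel_ge0 : forall t v, (0 <= h t v)%R ;
  measurable_pmf_kernel : forall v, measurable_fun setT (h ^~ v) ;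
  pmf_kernel_sum1 : forall t, \sum_(v <oo) (h t v)%:E = 1
}.

Definition pmf_laplace (h : Th -> nat -> R) (t : Th) (s : R) : \bar R :=
  \sum_(v <oo) (h t v)%:E * (expR (- (s * v%:R)))%:E.

Variable h : Th -> nat -> R.
Hypothesis hpmf : pmf_kernel h.

Lemma pmf_laplace_ge0 t s : 0 <= pmf_laplace h t s.
Proof.
apply: nneseries_ge0 => v _ _.
by rewrite mule_ge0// lee_fin ?expR_ge0// (pmf_kernel_ge0 hpmf).
Qed.

Lemma pmf_laplace_le1 t s : (0 <= s)%R -> pmf_laplace h t s <= 1.
Proof.
move=> s0; rewrite -(pmf_kernel_sum1 hpmf t); apply: lee_nneseries => [v _ _|v _].
  by rewrite mule_ge0// lee_fin ?expR_ge0// (pmf_kernel_ge0 hpmf).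
rewrite -EFinM lee_fin ler_piMr// ?(pmf_kernel_ge0 hpmf)//.
by rewrite -expR0 ler_expR oppr_le0 mulr_ge0.
Qed.

Lemma prode_ge0_le1 (I : Type) (r : seq I) (Q : pred I) (u : I -> \bar R) :
  (forall i, Q i -> 0 <= u i <= 1) -> 0 <= \prod_(i <- r | Q i) u i <= 1.
Proof.
move=> u01; elim/big_ind : _ => // [|a b /andP[a0 a1] /andP[b0 b1]].
  by rewrite lexx lee01.
by rewrite mule_ge0//= -[leRHS]mule1 lee_pmul.
Qed.

Context {dp} {Psi : measurableType dp}.

Lemma measurable_pmf_laplace (s : Psi -> R) : measurable_fun setT s ->
  measurable_fun [set: Th * Psi] (fun z => pmf_laplace h z.1 (s z.2)).
Proof.
move=> ms; apply: measurable_nneseries => [v z|v].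
  by rewrite mule_ge0// lee_fin ?expR_ge0// (pmf_kernel_ge0 hpmf).
apply: emeasurable_funM.
  apply/measurable_EFinP.
  exact: (measurableT_comp (measurable_pmf_kernel hpmf v) measurable_fst).
apply/measurable_EFinP; apply: measurableT_comp => //; apply: measurable_funN.
apply: measurable_funM => //.
exact: (measurableT_comp ms measurable_snd).
Qed.

End pmf_kernel.

Section data.
Context {R : realType} {dt} {Th : measurableType dt} {dp} {Psi : measurableType dp}.
Context {d} {T : measurableType d} (P : probability T R).
Local Open Scope ereal_scope.

Lemma sigma_of_measurable_fun {I : choiceType} (D : set I) d'
    (U : measurableType d') (V : I -> T -> U) i : D i ->
  measurable_fun [set: g_sigma_algebraType
    (\bigcup_(j in D) preimage_set_system setT (V j) measurable)] (V i).
Proof.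
move=> Di _ B mB; apply: sub_sigma_algebra; exists i => //; exists B => //.
Qed.

(** Given the points, the integer weights are averaged out one at a time, which
    replaces exp(-x s) by its mean given the point. *)
Lemma laplace_data (h : Th -> nat -> R) (N : nat) (Z : nat -> T -> Th * Psi)
    (mu : {measure set (Th * Psi) -> \bar R}) (x : 'I_N -> nat -> {RV P >-> nat})
    (tau : 'I_N -> Psi -> R) :
  pmf_kernel h -> (forall k, measurable_fun setT (Z k)) ->
  poisson_point_process P Z mu ->
  cond_indep_pmf P (sigma_of setT Z) (fun=> setT)
    (fun nk : 'I_N * nat => x nk.1 nk.2) (fun nk w v => (h (Z nk.2 w).1 v)%:E) ->
  (forall n, measurable_fun setT (tau n)) -> (forall n p, 0 <= tau n p)%R ->
  \int[P]_w expeR (- \sum_(k <oo)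
      (\sum_(n < N) (x n k w)%:R * tau n (Z k w).2)%R%:E) =
  expeR (- \int[mu]_z (1 - \prod_(n < N) pmf_laplace h z.1 (tau n z.2))).
Proof.
move=> hpmf mZ pppZ xZ mtau tau0.
(* F z is the cost whose discount exp(-F z) is the mean discount of a point z *)
pose F z := - lne (\prod_(n < N) pmf_laplace h z.1 (tau n z.2)).
have prod01 z : 0 <= \prod_(n < N) pmf_laplace h z.1 (tau n z.2) <= 1.
  by apply: prode_ge0_le1 => n _; rewrite pmf_laplace_ge0// pmf_laplace_le1.
have F0 z : 0 <= F z by rewrite oppe_ge0 lne_le0; have /andP[] := prod01 z.
have expF z : expeR (- F z) = \prod_(n < N) pmf_laplace h z.1 (tau n z.2).
  by rewrite expeRN_lneN//; have /andP[] := prod01 z.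
have mF : measurable_fun setT F.
  apply: measurableT_comp => //; apply: (measurableT_comp measurable_lne).
  by apply: measurable_prode => n _; exact: measurable_pmf_laplace.
transitivity (\int[P]_w expeR (- \sum_(k <oo) F (Z k w))); last first.
  rewrite (ppp_laplace mZ pppZ mF F0); congr (expeR (- _)).
  by apply: eq_integral => z _; rewrite expF.
pose y k w := (\sum_(n < N) (x n k w)%:R * tau n (Z k w).2)%R%:E.
have y0 k w : 0 <= y k w by rewrite lee_fin sumr_ge0// => n _; rewrite mulr_ge0.
have mZ2 n k : measurable_fun setT (fun w => tau n (Z k w).2).
  by apply: (measurableT_comp (mtau n)); exact: (measurableT_comp measurable_snd).
have my k : measurable_fun setT (y k).
  apply/measurable_EFinP; apply: measurable_sum => n; apply: measurable_funM => //.
  exact: (measurableT_comp (measurable_fun_nat (fun n => n%:R : R))).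
have cvg_series (u : nat -> T -> \bar R) : (forall k, measurable_fun setT (u k)) ->
    (forall k w, 0 <= u k w) ->
    \int[P]_w expeR (- (\sum_(0 <= k < K) u k w)) @[K --> \oo] -->
    \int[P]_w expeR (- \sum_(k <oo) u k w).
  move=> mu' u0; apply: cvg_integral_expeRN.
  - by move=> K; apply: emeasurable_sum.
  - exact: measurable_nneseries.
  - by move=> K w; exact: sume_ge0.
  - move=> w; exact: (@ereal_nondecreasing_series _ (u ^~ w) xpredT 0).
  - by move=> w; exact: (@is_cvg_nneseries _ (u ^~ w) xpredT 0).
have cvy := cvg_series _ my y0.
have cvF := cvg_series _ (fun k => measurableT_comp mF (mZ k)) (fun k w => F0 (Z k w)).
apply: (cvg_unique _ cvy) => //.
rewrite (_ : (fun K => _) = (fun K => \int[P]_w expeR (- (\sum_(0 <= k < K) F (Z k w))))).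
  exact: cvF.
(* finitely many weights are averaged out at a time *)
apply/funext => K.
pose a (nk : 'I_N * nat) w (v : nat) := (expR (- (tau nk.1 (Z nk.2 w).2 * v%:R)))%:E : \bar R.
pose s : seq ('I_N * nat) := [seq (n, k) | k <- iota 0 K, n <- enum 'I_N].
have prod_s (g : 'I_N * nat -> \bar R) :
    \prod_(nk <- s) g nk = \prod_(0 <= k < K) \prod_(n < N) g (n, k).
  by rewrite big_allpairs_dep /index_iota subn0; apply: eq_bigr => k _; rewrite big_enum.
transitivity (\int[P]_w \prod_(nk <- s) a nk w (x nk.1 nk.2 w)).
  apply: eq_integral => w _; rewrite expeRN_sum// prod_s//; apply: eq_bigr => k _.
  rewrite /y -sumEFin expeRN_sum; last by move=> n _; rewrite lee_fin mulr_ge0.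
  by apply: eq_bigr => n _; rewrite /a /= mulrC.
pose C := \bigcup_(j in [set: nat]) preimage_set_system [set: T] (Z j) measurable.
have Cmeas : C `<=` measurable.
  by move=> _ [k _ [B mB <-]]; exact: mZ.
have us : uniq s.
  rewrite allpairs_uniq ?iota_uniq ?enum_uniq// => -[n k] [n' k'] _ _ /=.
  by case=> -> ->.
have mhZ nk v : measurable_fun setT (fun w => (h (Z nk w).1 v)%:E).
  apply/measurable_EFinP; apply: (measurableT_comp (measurable_pmf_kernel hpmf v)).
  exact: (measurableT_comp measurable_fst).
rewrite (cond_indep_prod (C := C) (p := fun nk w v => (h (Z nk.2 w).1 v)%:E))//; last 5 first.
- move=> v A CA; rewrite -(set_fset_seq s) xZ//.
  by apply: eq_integral => w _; apply: perm_big; exact: perm_fset_seq.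
- by move=> nk v; rewrite -[X in measurable X]setTI; exact: measurable_funP.
- by move=> nk w v; rewrite lee_fin (pmf_kernel_ge0 hpmf).
- move=> nk v _; apply/measurable_EFinP; apply: measurableT_comp => //.
  apply: measurable_funN; apply: measurable_funM; last exact: measurable_cst.
  apply: (measurableT_comp (mtau _)); apply: (measurableT_comp measurable_snd).
  exact: sigma_of_measurable_fun.
- by move=> nk w v; rewrite lee_fin expR_ge0.
apply: eq_integral => w _; rewrite expeRN_sum// prod_s//; apply: eq_bigr => k _.
rewrite expF; apply: eq_bigr => n _; apply: eq_eseriesr => v _.
by rewrite muleC.
Qed.

End data.

(** * Predictive discounts of an atom *)

Section predictive.
Context {R : realType} {dt} {Th : measurableType dt} {dp} {Psi : measurableType dp}.
Variables (h : Th -> nat -> R) (nu : {sigma_finite_measure set Th -> \bar R}).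
Variables (N : nat) (tau : nat -> Psi -> R).
Hypothesis hpmf : pmf_kernel h.
Hypothesis mtau : forall m, measurable_fun setT (tau m).
Hypothesis tau0 : forall m p, 0 <= tau m p.
Local Open Scope ereal_scope.

Definition path_prob (u : seq nat) (t : Th) : R := (\prod_(a <- u) h t a)%R.

(** The rate at which the points of the prior produce the weights u. *)
Definition path_mass (u : seq nat) : \bar R := \int[nu]_t (path_prob u t)%:E.

Definition path_cost (u : seq nat) (p : Psi) : R :=
  (\sum_(0 <= m < size u) tau m p * (nth 0%N u m)%:R)%R.

(** The mean discount, at the parameter t, of the weights still to be drawn. *)
Definition future (n : nat) (t : Th) (p : Psi) : \bar R :=
  \prod_(n <= m < N) pmf_laplace h t (tau m p).

Definition path_laplace (u : seq nat) (p : Psi) : \bar R :=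
  \int[nu]_t ((path_prob u t)%:E * future (size u) t p).

(** The conditional expectation, given the weights u seen so far at the location
    p, of the total exponential discount at the end: the posterior mean of the
    future discounts, times the discount accumulated so far. *)
Definition predictive (u : seq nat) (p : Psi) : R :=
  (expR (- path_cost u p) * (fine (path_laplace u p) / fine (path_mass u)))%R.

Lemma path_prob_rcons u v t : path_prob (rcons u v) t = (path_prob u t * h t v)%R.
Proof. by rewrite /path_prob -cats1 big_cat big_seq1. Qed.

Lemma pmf_kernel_le1 t v : (h t v <= 1)%R.
Proof.
rewrite -lee_fin -(pmf_kernel_sum1 hpmf t).
rewrite (@nneseriesD1 _ _ v)//; last by move=> k _; rewrite lee_fin (pmf_kernel_ge0 hpmf).
by rewrite leeDl// nneseries_ge0// => k _ _; rewrite lee_fin (pmf_kernel_ge0 hpmf).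
Qed.

Lemma path_prob_ge0 u t : (0 <= path_prob u t)%R.
Proof. by rewrite prodr_ge0// => a _; exact: pmf_kernel_ge0 hpmf _ _. Qed.

Lemma path_prob_le u a t : a \in u -> (path_prob u t <= h t a)%R.
Proof.
move=> au; rewrite /path_prob (big_rem a)//= ler_piMr ?(pmf_kernel_ge0 hpmf)//.
by apply: prodr_ile1 => b _; rewrite (pmf_kernel_ge0 hpmf) pmf_kernel_le1.
Qed.

Lemma measurable_path_prob u : measurable_fun setT (path_prob u).
Proof.
by apply: measurable_prod => a _; exact: measurable_pmf_kernel hpmf a.
Qed.

Lemma path_mass_ge0 u : 0 <= path_mass u.
Proof. by apply: integral_ge0 => t _; rewrite lee_fin path_prob_ge0. Qed.

Lemma future01 n t p : 0 <= future n t p <= 1.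
Proof.
apply: prode_ge0_le1 => m _; apply/andP; split; first exact: pmf_laplace_ge0.
exact: pmf_laplace_le1.
Qed.

Lemma measurable_future n : measurable_fun [set: Th * Psi] (fun z => future n z.1 z.2).
Proof.
by apply: measurable_prode => m _; exact: measurable_pmf_laplace.
Qed.

Lemma measurable_path_laplace_integrand u :
  measurable_fun [set: Th * Psi] (fun z => (path_prob u z.1)%:E * future (size u) z.1 z.2).
Proof.
apply: emeasurable_funM; last exact: measurable_future.
apply/measurable_EFinP; exact: (measurableT_comp (measurable_path_prob u) measurable_fst).
Qed.

Lemma measurable_future1 n p : measurable_fun setT (fun t => future n t p).
Proof.
exact: (measurableT_comp (measurable_future n) (pair2_measurable p)).
Qed.

Lemma path_laplace_ge0 u p : 0 <= path_laplace u p.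
Proof.
apply: integral_ge0 => t _; rewrite mule_ge0// ?lee_fin ?path_prob_ge0//.
by have /andP[] := future01 (size u) t p.
Qed.

Lemma path_laplace_le u p : path_laplace u p <= path_mass u.
Proof.
have mp : measurable_fun setT (fun t => (path_prob u t)%:E).
  by apply/measurable_EFinP; exact: measurable_path_prob.
apply: ge0_le_integral => //.
- move=> t _; rewrite mule_ge0// ?lee_fin ?path_prob_ge0//.
  by have /andP[] := future01 (size u) t p.
- by apply: emeasurable_funM => //; exact: measurable_future1.
- move=> t _; rewrite -[leRHS]mule1 lee_wpmul2l// ?lee_fin ?path_prob_ge0//.
  by have /andP[] := future01 (size u) t p.
Qed.

Lemma measurable_path_laplace u : measurable_fun setT (path_laplace u).
Proof.
apply: (@measurable_fun_fubini_tonelli_G _ _ _ _ _ nu _ (measurable_path_laplace_integrand u)).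
move=> z; rewrite mule_ge0// ?lee_fin ?path_prob_ge0//.
by have /andP[] := future01 (size u) z.1 z.2.
Qed.

Lemma path_laplace_rec u p : (size u < N)%N ->
  path_laplace u p =
  \sum_(v <oo) (expR (- (tau (size u) p * v%:R)))%:E * path_laplace (rcons u v) p.
Proof.
move=> uN.
have e0 v : 0 <= (expR (- (tau (size u) p * v%:R)))%:E :> \bar R.
  by rewrite lee_fin expR_ge0.
have mint v : measurable_fun setT
    (fun t => (path_prob (rcons u v) t)%:E * future (size u).+1 t p).
  apply: emeasurable_funM; last exact: measurable_future1.
  by apply/measurable_EFinP; exact: measurable_path_prob.
have int0 v t : 0 <= (path_prob (rcons u v) t)%:E * future (size u).+1 t p.
  rewrite mule_ge0// ?lee_fin ?path_prob_ge0//.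
  by have /andP[] := future01 (size u).+1 t p.
under eq_eseriesr => v _.
  rewrite /path_laplace size_rcons -ge0_integralZl_EFin ?expR_ge0//.
  over.
rewrite -integral_nneseries//; last 2 first.
- by move=> v; apply: emeasurable_funM => //; exact: measurable_cst.
- by move=> v t _; rewrite mule_ge0.
apply: eq_integral => t _.
have futureS : future (size u) t p =
    pmf_laplace h t (tau (size u) p) * future (size u).+1 t p by rewrite /future big_ltn.
rewrite futureS /pmf_laplace muleA -nneseriesZle; last 2 first.
- by move=> v; rewrite mule_ge0// lee_fin ?expR_ge0// (pmf_kernel_ge0 hpmf).
- by rewrite lee_fin path_prob_ge0.
have F0 : 0 <= future (size u).+1 t p by have /andP[] := future01 (size u).+1 t p.
rewrite muleC -nneseriesZle//; last first.
  by move=> v; rewrite !mule_ge0 ?lee_fin ?path_prob_ge0 ?expR_ge0 ?(pmf_kernel_ge0 hpmf).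
apply: eq_eseriesr => v _; rewrite path_prob_rcons EFinM muleC [RHS]muleA; congr (_ * _).
by rewrite muleA muleC.
Qed.

Section finite_masses.
Hypothesis mass1_fin : forall v, \int[nu]_t (h t v.+1)%:E < +oo.

Lemma path_mass_fin u : has (leq 1) u -> path_mass u < +oo.
Proof.
move=> /hasP[[|v] vu]// _; apply: le_lt_trans (mass1_fin v).
apply: ge0_le_integral => //.
- by move=> t _; rewrite lee_fin path_prob_ge0.
- by apply/measurable_EFinP; exact: measurable_path_prob.
- by apply/measurable_EFinP; exact: measurable_pmf_kernel hpmf _.
- by move=> t _; rewrite lee_fin path_prob_le.
Qed.

Lemma path_mass_fin_num u : has (leq 1) u -> path_mass u \is a fin_num.
Proof. by move=> u1; rewrite ge0_fin_numE ?path_mass_ge0// path_mass_fin. Qed.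

Lemma path_laplace_fin_num u p : has (leq 1) u -> path_laplace u p \is a fin_num.
Proof.
move=> u1; rewrite ge0_fin_numE ?path_laplace_ge0//.
exact: le_lt_trans (path_laplace_le u p) (path_mass_fin u1).
Qed.

Lemma path_cost_ge0 u p : (0 <= path_cost u p)%R.
Proof. by apply: sumr_ge0 => m _; rewrite mulr_ge0. Qed.

Lemma path_cost_rcons u v p :
  path_cost (rcons u v) p = (path_cost u p + tau (size u) p * v%:R)%R.
Proof.
rewrite /path_cost size_rcons big_nat_recr//= nth_rcons ltnn eqxx; congr (_ + _)%R.
by apply: eq_big_nat => m /andP[_ mu]; rewrite nth_rcons mu.
Qed.

Lemma predictive_ge0 u p : (0 <= predictive u p)%R.
Proof.
rewrite mulr_ge0 ?expR_ge0// divr_ge0// fine_ge0//; first exact: path_laplace_ge0.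
exact: path_mass_ge0.
Qed.

Lemma predictive_le1 u p : has (leq 1) u -> (predictive u p <= 1)%R.
Proof.
move=> u1; rewrite -[leRHS]mulr1 ler_pM ?expR_ge0//.
- by rewrite divr_ge0// fine_ge0//; [exact: path_laplace_ge0|exact: path_mass_ge0].
- by rewrite -expR0 ler_expR oppr_le0 path_cost_ge0.
have [->|m0] := eqVneq (fine (path_mass u)) 0%R; first by rewrite invr0 mulr0.
have mp : (0 < fine (path_mass u))%R by rewrite lt_def m0 fine_ge0// path_mass_ge0.
rewrite ler_pdivrMr// mul1r fine_le ?path_laplace_le//; first exact: path_laplace_fin_num.
exact: path_mass_fin_num.
Qed.

Lemma measurable_predictive u : measurable_fun setT (predictive u).
Proof.
apply: measurable_funM.
  apply: measurableT_comp => //; apply: measurable_funN; apply: measurable_sum => m.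
  by apply: measurable_funM => //; exact: mtau.
apply: measurable_funM => //; apply: measurableT_comp => //.
exact: measurable_path_laplace.
Qed.

(** Nothing is left to average; on a history of mass 0 the quotient in
    [predictive] degenerates to 0. *)
Lemma predictive_full u p : size u = N -> has (leq 1) u ->
  predictive u p = (expR (- path_cost u p) * (path_mass u != 0)%:R)%R.
Proof.
move=> uN u1; congr (_ * _)%R.
have -> : path_laplace u p = path_mass u.
  by apply: eq_integral => t _; rewrite /future uN big_geq// mule1.
have [->|m0] := eqVneq (path_mass u) 0; first by rewrite mul0r.
by rewrite divff// fine_eq0// path_mass_fin_num.
Qed.

Lemma path_mass_rcons0 u v : path_mass u = 0 -> path_mass (rcons u v) = 0.
Proof.
move=> m0; apply/eqP; rewrite eq_le path_mass_ge0 andbT -[leRHS]m0.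
apply: ge0_le_integral => //.
- by move=> t _; rewrite lee_fin path_prob_ge0.
- by apply/measurable_EFinP; exact: measurable_path_prob.
- by apply/measurable_EFinP; exact: measurable_path_prob.
- move=> t _; rewrite lee_fin path_prob_rcons ler_piMr ?path_prob_ge0//.
  exact: pmf_kernel_le1.
Qed.

(** The weights, up to stage n, of an atom that is born there with weight v.+1. *)
Definition newborn (n v : nat) : seq nat := rcons (nseq n 0%N) v.+1.

Lemma size_newborn n v : size (newborn n v) = n.+1.
Proof. by rewrite size_rcons size_nseq. Qed.

Lemma has_newborn n v : has (leq 1) (newborn n v).
Proof. by rewrite has_rcons. Qed.

Lemma path_cost_newborn n v p : path_cost (newborn n v) p = (tau n p * v.+1%:R)%R.
Proof.
rewrite path_cost_rcons size_nseq [X in (X + _)%R](_ : _ = 0%R) ?add0r//.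
by rewrite /path_cost big1// => m _; rewrite nth_nseq if_same mulr0.
Qed.

Lemma path_prob_newborn n v t : path_prob (newborn n v) t = (h t 0 ^+ n * h t v.+1)%R.
Proof. by rewrite path_prob_rcons /path_prob big_nseq iter_mulr_1. Qed.

(** What an atom born at stage n with weight v.+1 takes off the total discount. *)
Let born_loss n v t p : \bar R :=
  (path_prob (newborn n v) t)%:E *
  (1 - (expR (- path_cost (newborn n v) p))%:E * future n.+1 t p).

Let discount01 n v t p :
  0 <= (expR (- path_cost (newborn n v) p))%:E * future n.+1 t p <= 1.
Proof.
have /andP[f0 f1] := future01 n.+1 t p.
rewrite mule_ge0 ?lee_fin ?expR_ge0//= -[leRHS]mule1 lee_pmul ?lee_fin ?expR_ge0//.
by rewrite -expR0 ler_expR oppr_le0 path_cost_ge0.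
Qed.

Let born_loss_ge0 n v t p : 0 <= born_loss n v t p.
Proof.
rewrite mule_ge0 ?lee_fin ?path_prob_ge0//.
by have /andP[_ ?] := discount01 n v t p; rewrite -(@subee _ 1)// leeB.
Qed.

Let measurable_born_loss n v :
  measurable_fun [set: Th * Psi] (fun z => born_loss n v z.1 z.2).
Proof.
apply: emeasurable_funM.
  apply/measurable_EFinP; exact: (measurableT_comp (measurable_path_prob _) measurable_fst).
apply: emeasurable_funB; first exact: measurable_cst.
apply: emeasurable_funM; last exact: measurable_future.
apply/measurable_EFinP; apply: measurableT_comp => //; apply: measurable_funN.
have mcost : measurable_fun setT (path_cost (newborn n v)).
  by apply: measurable_sum => m; apply: measurable_funM => //; exact: mtau.
exact: (measurableT_comp mcost measurable_snd).
Qed.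

Let pmf_tail t : \sum_(v <oo) (h t v.+1)%:E = (1 - h t 0)%:E.
Proof.
have h0 v : 0 <= (h t v)%:E by rewrite lee_fin (pmf_kernel_ge0 hpmf).
have := pmf_kernel_sum1 hpmf t; rewrite nneseriesS// => e.
by rewrite EFinB -[X in _ = X - _]e addeAC subee// add0e.
Qed.

Let pmf_laplace_tail t s :
  pmf_laplace h t s =
  (h t 0)%:E + \sum_(v <oo) (h t v.+1)%:E * (expR (- (s * v.+1%:R)))%:E.
Proof.
rewrite /pmf_laplace nneseriesS//; first by rewrite mulr0 oppr0 expR0 mule1.
by move=> v; rewrite mule_ge0// lee_fin ?expR_ge0// (pmf_kernel_ge0 hpmf).
Qed.

(** The location p contributes unless all the weights there are 0; splitting
    according to the first nonzero weight gives a telescoping sum. *)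
Let sum_born_loss t p :
  \sum_(v <oo) \sum_(0 <= n < N) born_loss n v t p = 1 - future 0 t p.
Proof.
rewrite nneseries_sum_nat; last by move=> n v; exact: born_loss_ge0.
have fut_fin n : future n t p \is a fin_num.
  have /andP[f0 f1] := future01 n t p; rewrite ge0_fin_numE//.
  by rewrite (le_lt_trans f1) ?ltry.
pose F n := fine (future n t p).
have FE n : future n t p = (F n)%:E by rewrite fineK.
have F0 n : (0 <= F n)%R by rewrite -lee_fin -FE; have /andP[] := future01 n t p.
pose g n := (h t 0 ^+ n * (1 - F n))%R.
have h0 v : (0 <= h t v)%R by exact: pmf_kernel_ge0 hpmf t v.
have step n : (n < N)%N -> \sum_(v <oo) born_loss n v t p = (g n - g n.+1)%:E.
  move=> nN.
  pose c v := (h t v.+1)%:E * (expR (- (tau n p * v.+1%:R)))%:E.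
  have c0 v : 0 <= c v by rewrite mule_ge0// lee_fin ?expR_ge0.
  have lossE v : born_loss n v t p + (h t 0 ^+ n * F n.+1)%:E * c v =
      (h t 0 ^+ n)%:E * (h t v.+1)%:E.
    rewrite /born_loss path_prob_newborn path_cost_newborn FE /c.
    set e := expR _; transitivity (h t 0 ^+ n * h t v.+1 * (1 - e * F n.+1) +
      h t 0 ^+ n * F n.+1 * (h t v.+1 * e))%R%:E; first by [].
    by rewrite -EFinM; congr (_%:E); ring.
  have sumE : (\sum_(v <oo) born_loss n v t p) +
      (h t 0 ^+ n * F n.+1)%:E * (\sum_(v <oo) c v) = (h t 0 ^+ n)%:E * (1 - h t 0)%:E.
    rewrite -pmf_tail -!nneseriesZl//.
    rewrite -nneseriesD//; last first.
      by move=> v _ _; rewrite mule_ge0// lee_fin mulr_ge0// ?exprn_ge0// F0.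
      by apply: eq_eseriesr => v _; rewrite lossE.
    by move=> v _; rewrite lee_fin.
  have csum : \sum_(v <oo) c v \is a fin_num.
    rewrite ge0_fin_numE; last by apply: nneseries_ge0.
    apply: (@le_lt_trans _ _ (\sum_(v <oo) (h t v.+1)%:E)); last by rewrite pmf_tail ltry.
    apply: lee_nneseries => // v _; rewrite /c -EFinM lee_fin ler_piMr//.
    by rewrite -expR0 ler_expR oppr_le0 mulr_ge0.
  have Frec : F n = ((h t 0 + fine (\sum_(v <oo) c v)) * F n.+1)%R.
    apply/EFin_inj; rewrite -FE EFinM EFinD fineK// -FE -pmf_laplace_tail.
    by rewrite /future big_ltn.
  move/(congr1 (fun z => z - (h t 0 ^+ n * F n.+1)%:E * (\sum_(v <oo) c v))): sumE.
  rewrite -(fineK csum) addeK// => ->.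
  by rewrite -EFinM -!EFinB/= /g Frec; congr (_%:E); rewrite exprS; ring.
rewrite (eq_big_nat _ _ (F2 := fun n => (g n - g n.+1)%:E)); last first.
  by move=> n /andP[_ nN]; exact: step.
rewrite sumEFin (telescope_sumr_eq (fun n => - g n)%R) => [|//|n _]; last by rewrite opprK addrC.
rewrite /g (_ : F N = 1%R) ?subrr ?mulr0 ?expr0 ?mul1r; last by rewrite /F /future big_geq.
by rewrite oppr0 sub0r opprK EFinB FE.
Qed.

Let mean_born_loss (n v : nat) (G : probability Psi R) : (n < N)%N ->
  path_mass (newborn n v) * (1 - \int[G]_p (predictive (newborn n v) p)%:E) =
  \int[G]_p \int[nu]_t born_loss n v t p.
Proof.
move=> nN; set u := newborn n v.
have u1 : has (leq 1) u by exact: has_newborn.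
have mfin := path_mass_fin_num u1.
have pred01 p : 0 <= 1 - (predictive u p)%:E.
  by rewrite -EFinB lee_fin subr_ge0 predictive_le1.
have mpred : measurable_fun setT (fun p => (predictive u p)%:E).
  by apply/measurable_EFinP; exact: measurable_predictive.
have loss p : \int[nu]_t born_loss n v t p = path_mass u * (1 - (predictive u p)%:E).
  have lfin := path_laplace_fin_num p u1.
  have mpp : measurable_fun setT (fun t => (path_prob u t)%:E).
    by apply/measurable_EFinP; exact: measurable_path_prob.
  have split_mass : \int[nu]_t born_loss n v t p +
      (expR (- path_cost u p))%:E * path_laplace u p = path_mass u.
    rewrite /path_laplace -ge0_integralZl_EFin ?expR_ge0//; last 2 first.
    - move=> t _; rewrite mule_ge0 ?lee_fin ?path_prob_ge0//.
      by have /andP[] := future01 (size u) t p.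
    - by apply: emeasurable_funM => //; exact: measurable_future1.
    rewrite -ge0_integralD//; last 3 first.
    - exact: (measurable_fun_pair1 p (measurable_born_loss n v)).
    - move=> t _; rewrite !mule_ge0 ?lee_fin ?path_prob_ge0 ?expR_ge0//.
      by have /andP[] := future01 (size u) t p.
    - apply: emeasurable_funM => //; apply: emeasurable_funM => //.
      exact: measurable_future1.
    apply: eq_integral => t _; rewrite /born_loss -/u size_newborn.
    have /andP[f0 f1] := future01 n.+1 t p.
    have ffin : future n.+1 t p \is a fin_num.
      by rewrite ge0_fin_numE// (le_lt_trans f1) ?ltry.
    rewrite -(fineK ffin); set e := expR _; set F := fine _; set q := path_prob u t.
    transitivity (q * (1 - e * F) + e * (q * F))%R%:E; first by [].
    by congr (_%:E); ring.
  have -> : \int[nu]_t born_loss n v t p =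
      path_mass u - (expR (- path_cost u p))%:E * path_laplace u p.
    by rewrite -{1}split_mass addeK// fin_numM.
  rewrite -(fineK mfin) -(fineK lfin) /predictive.
  set e := expR _; set m := fine (path_mass u); set l := fine _.
  transitivity (m - e * l)%R%:E; first by [].
  transitivity (m * (1 - e * (l / m)))%R%:E; last by rewrite EFinM EFinB.
  congr (_%:E); have [m0|m0] := eqVneq m 0%R; last by field.
  rewrite m0 mul0r sub0r; suff -> : l = 0%R by rewrite mulr0 oppr0.
  apply/eqP; rewrite eq_le fine_ge0 ?path_laplace_ge0// andbT -m0.
  by rewrite fine_le// path_laplace_le.
under [RHS]eq_integral do rewrite loss.
rewrite ge0_integralZl//; last 2 first.
- by apply: emeasurable_funB => //; exact: measurable_cst.
- exact: path_mass_ge0.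
congr (_ * _).
have pred_le1 : \int[G]_p (predictive u p)%:E <= 1.
  by apply: integral_prob_le => // p; rewrite lee_fin ?predictive_ge0 ?predictive_le1.
have pred_fin : \int[G]_p (predictive u p)%:E \is a fin_num.
  rewrite ge0_fin_numE ?(le_lt_trans pred_le1) ?ltry//.
  by apply: integral_ge0 => p _; rewrite lee_fin predictive_ge0.
rewrite -[X in X - _](integral_prob_cst G).
rewrite (_ : \int[G]_p 1 = \int[G]_p ((1 - (predictive u p)%:E) + (predictive u p)%:E)).
  rewrite ge0_integralD ?addeK//.
  - by apply: emeasurable_funB => //; exact: measurable_cst.
  - by move=> p _; rewrite lee_fin predictive_ge0.
by apply: eq_integral => p _; rewrite subeK.
Qed.

(** A point of the prior contributes to the exponent only if it is born at some
    stage, so that the losses of all the births add up to the exponent of the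
    Laplace functional of the data. *)
Lemma total_rate (G : probability Psi R) :
  \sum_(v <oo) \sum_(0 <= n < N)
    path_mass (newborn n v) * (1 - \int[G]_p (predictive (newborn n v) p)%:E) =
  \int[nu \x G]_z (1 - \prod_(m < N) pmf_laplace h z.1 (tau m z.2)).
Proof.
have fut0 z : \prod_(m < N) pmf_laplace h z.1 (tau m z.2) = future 0 z.1 z.2.
  by rewrite /future big_mkord.
under [RHS]eq_integral do rewrite fut0.
rewrite fubini_tonelli2; last 2 first.
- by apply: emeasurable_funB; [exact: measurable_cst|exact: measurable_future].
- move=> z; have /andP[_ f1] := future01 0 z.1 z.2.
  by rewrite -(@subee _ 1)// leeB.
have mloss n v p : measurable_fun setT (fun t => born_loss n v t p).
  exact: (measurable_fun_pair1 p (measurable_born_loss n v)).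
have mG n v : measurable_fun setT (fun p => \int[nu]_t born_loss n v t p).
  apply: (@measurable_fun_fubini_tonelli_G _ _ _ _ _ nu _ (measurable_born_loss n v)).
  by move=> z; exact: born_loss_ge0.
have G0 n v p : 0 <= \int[nu]_t born_loss n v t p.
  by apply: integral_ge0 => t _; exact: born_loss_ge0.
under eq_eseriesr => v _.
  rewrite (eq_big_nat _ _ (F2 := fun n => \int[G]_p \int[nu]_t born_loss n v t p)); last first.
    by move=> n /andP[_ nN]; exact: mean_born_loss.
  rewrite -ge0_integral_sum//; over.
rewrite -integral_nneseries//; last 2 first.
- by move=> v; apply: emeasurable_sum.
- by move=> v p _; apply: sume_ge0.
apply: eq_integral => p _; rewrite /fubini_G /=.
under eq_eseriesr => v _.
  rewrite -ge0_integral_sum//.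
  over.
rewrite -integral_nneseries//; last 2 first.
- by move=> v; apply: emeasurable_sum.
- by move=> v t _; apply: sume_ge0 => n _; exact: born_loss_ge0.
by apply: eq_integral => t _; exact: sum_born_loss.
Qed.

Variable hc : seq nat -> nat -> \bar R.
Hypothesis hc_mass : forall u v, 0 < path_mass u < +oo ->
  hc u v * path_mass u = path_mass (rcons u v).

(** One step of the predictive rule hc averages [predictive]. If u has mass 0
    then so have its extensions, and both sides vanish, whatever hc is there. *)
Lemma predictive_rec u p : (size u < N)%N -> has (leq 1) u ->
  \sum_(v <oo) (predictive (rcons u v) p)%:E * hc u v = (predictive u p)%:E.
Proof.
move=> uN u1.
have [m0|m0] := eqVneq (path_mass u) 0.
  rewrite {2}/predictive m0 invr0 !mulr0 eseries0// => v _ _.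
  by rewrite /predictive path_mass_rcons0// invr0 !mulr0 mul0e.
have mp : 0 < path_mass u < +oo by rewrite lt_def m0 path_mass_ge0 path_mass_fin.
have mfin := path_mass_fin_num u1.
have fm0 : fine (path_mass u) != 0%R by rewrite fine_eq0.
have u1v v : has (leq 1) (rcons u v) by rewrite has_rcons u1 orbT.
have hcE v : hc u v = (fine (path_mass (rcons u v)) / fine (path_mass u))%R%:E.
  rewrite EFinM fineK ?path_mass_fin_num// -(hc_mass v mp) -{1}(fineK mfin).
  by rewrite -muleA -EFinM divff// mule1.
have term v : (predictive (rcons u v) p)%:E * hc u v =
    (expR (- path_cost u p) / fine (path_mass u))%R%:E *
    ((expR (- (tau (size u) p * v%:R)))%:E * path_laplace (rcons u v) p).
  rewrite hcE -(fineK (path_laplace_fin_num p (u1v v))) -!EFinM; congr (_%:E).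
  rewrite /predictive path_cost_rcons opprD expRD.
  have [mv0|mv0] := eqVneq (fine (path_mass (rcons u v))) 0%R.
    suff -> : path_laplace (rcons u v) p = 0 by rewrite mv0 invr0 !(mul0r, mulr0).
    apply/eqP; rewrite eq_le path_laplace_ge0 andbT.
    rewrite (le_trans (path_laplace_le _ _))//.
    by rewrite -(fineK (path_mass_fin_num (u1v v))) mv0.
  by rewrite -!mulrA; congr (_ * _)%R; rewrite (mulKf mv0) [LHS]mulrA [RHS]mulrC.
under eq_eseriesr do rewrite term.
rewrite nneseriesZl; last first.
  by move=> v _; rewrite mule_ge0 ?path_laplace_ge0// lee_fin expR_ge0.
rewrite -path_laplace_rec// -(fineK (path_laplace_fin_num p u1)) -EFinM /predictive.
by congr (_%:E); rewrite mulrAC mulrA.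
Qed.

End finite_masses.
End predictive.

(** * Weights observed at discrete times *)

Section countable_composition.
Context {R : realType} {d} {T : measurableType d}.

Lemma measurable_countable_comp {I : countType} d' (U : measurableType d')
    (K : T -> I) (F : I -> T -> U) :
  (forall k, measurable (K @^-1` [set k])) -> (forall k, measurable_fun setT (F k)) ->
  measurable_fun setT (fun w => F (K w) w).
Proof.
move=> mK mF _ B mB; rewrite setTI.
rewrite (_ : _ @^-1` B = \bigcup_(k in [set: I]) (K @^-1` [set k] `&` F k @^-1` B)).
  apply: countable_bigcupT_measurable => [|k]; first exact: countableP.
  apply: measurableI => //.
  by rewrite -[X in measurable X]setTI; exact: mF.
apply/seteqP; split => [w Bw|w [k _ [/= <-]]//].
by exists (K w).
Qed.

Lemma measurable_seq_fiber (J : Type) (y : J -> T -> nat) (l : seq J) (u : seq nat) :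
  (forall j, List.In j l -> forall v, measurable (y j @^-1` [set v])) ->
  measurable ((fun w => [seq y j w | j <- l]) @^-1` [set u]).
Proof.
elim: l u => [|j l IHl] [|v u] my /=.
- by rewrite (_ : _ @^-1` _ = setT)//; apply/seteqP; split.
- by rewrite (_ : _ @^-1` _ = set0)//; apply/seteqP; split.
- by rewrite (_ : _ @^-1` _ = set0)//; apply/seteqP; split.
rewrite (_ : _ @^-1` _ = y j @^-1` [set v] `&` (fun w => [seq y j w | j <- l]) @^-1` [set u]).
  apply: measurableI; first by apply: my; left.
  by apply: IHl => i il; apply: my; right.
by apply/seteqP; split => w /= => [[-> ->]|[-> ->]].
Qed.

End countable_composition.

Section absent.
Context {d} {T : measurableType d} {R : realType} (P : probability T R).
Local Open Scope ereal_scope.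

(** Variables that vanish off the known events D i are conditionally
    independent everywhere, with the point mass at 0 as law off D i. *)
Lemma cond_indep_absent (C : set (set T)) (I : choiceType) (s : seq I)
    (D : I -> set T) (x : I -> T -> nat) (p : I -> T -> nat -> \bar R) :
  C `<=` measurable -> uniq s ->
  cond_indep_pmf P <<s C>> D x p ->
  (forall i, i \in s -> <<s C>> (D i)) ->
  (forall i w, i \in s -> ~ D i w -> x i w = 0%N) ->
  (forall i v, measurable (x i @^-1` [set v])) ->
  (forall i v, i \in s -> measurable_fun setT (fun w => p i w v)) ->
  (forall i w v, 0 <= p i w v) ->
  forall (v : I -> nat) A, <<s C>> A ->
    P (A `&` \bigcap_(i in [set` s]) (x i @^-1` [set v i])) =
    \int[P]_(w in A) \prod_(i <- s)
      (if w \in D i then p i w (v i) else (v i == 0%N)%:R%:E).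
Proof.
move=> Cmeas us indep FD x0 mx mp p0 v.
have Fmeas : <<s C>> `<=` measurable.
  by apply: smallest_sub => //; exact: sigma_algebra_measurable.
have mD i : i \in s -> measurable (D i) by move=> /FD/Fmeas.
pose p' i w := if w \in D i then p i w (v i) else (v i == 0%N)%:R%:E.
have p'0 i w : 0 <= p' i w by rewrite /p'; case: ifP => // _; rewrite lee_fin.
have mp' i : i \in s -> measurable_fun setT (p' i).
  move=> si; apply: measurable_fun_ifT => //.
  - apply: (measurable_fun_bool true); rewrite setTI (_ : _ @^-1` _ = D i); first exact: mD.
    by apply/seteqP; split => w /=; [move/set_mem|move/mem_set].
  - exact: mp.
suff gen s1 s2 A : uniq (s1 ++ s2) -> {subset s1 ++ s2 <= s} -> <<s C>> A ->
    A `<=` \bigcap_(i in [set` s2]) D i ->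
    P (A `&` \bigcap_(i in [set` s1 ++ s2]) (x i @^-1` [set v i])) =
    \int[P]_(w in A) \prod_(i <- s1 ++ s2) p' i w.
  move=> A CA; have := gen s [::] A; rewrite cats0; apply => //.
(* A is split along D i, one index i at a time *)
elim: s1 s2 A => [|i s1 IHs] s2 A us12 s12 CA AD.
  rewrite cat0s -(set_fset_seq s2) indep//; last by rewrite set_fset_seq.
  apply: eq_integral => w /set_mem Aw; rewrite (perm_big s2) ?perm_fset_seq//.
  by apply: eq_big_seq => j js2; rewrite /p' mem_set//; exact: AD.
have si : i \in s by apply: s12; rewrite mem_head.
have mA : measurable A by exact: Fmeas.
have FAD : <<s C>> (A `&` D i).
  exact: (@measurableI _ (g_sigma_algebraType C) _ _ CA (FD i si)).
have FAD' : <<s C>> (A `\` D i).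
  exact: (@measurableD _ (g_sigma_algebraType C) _ _ CA (FD i si)).
have pm : perm_eq (s1 ++ i :: s2) ((i :: s1) ++ s2).
  by rewrite -(cat1s i s2) perm_catCA.
have IH1 := IHs (i :: s2) (A `&` D i).
have IH2 := IHs s2 (A `\` D i).
set B := \bigcap_(j in _) _.
have mB : measurable B by apply: fin_bigcap_measurable => // j _; exact: mx.
have mprod : measurable_fun setT (fun w => \prod_(j <- (i :: s1) ++ s2) p' j w).
  by apply: measurable_prode => j /s12; exact: mp'.
rewrite -[in RHS](setUIDK A (D i)) ge0_integral_setU//; last 5 first.
- exact: Fmeas.
- exact: Fmeas.
- exact: measurable_funTS.
- by move=> w _; rewrite prode_ge0.
- by apply/disj_setPS => w [[_ ?] [_]].
rewrite (measureDI P (measurableI _ _ mA mB) (mD i si)) addeC; congr (_ + _); last first.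
- have -> : A `&` B `&` D i = A `&` D i `&` \bigcap_(j in [set` s1 ++ i :: s2]) (x j @^-1` [set v j]).
    rewrite setIAC; congr (_ `&` _); apply: eq_bigcapl.
    by split => j; rewrite /= (perm_mem pm).
  rewrite [LHS]IH1//.
  + by apply: eq_integral => w _; apply: perm_big.
  + by rewrite (perm_uniq pm).
  + by move=> j; rewrite (perm_mem pm); exact: s12.
  + move=> w [Aw Dw] j /=; rewrite inE => /predU1P[->//|js2]; exact: AD.
- have us12' : uniq (s1 ++ s2) by move: us12 => /= /andP[].
  have s12' : {subset s1 ++ s2 <= s} by move=> j js; apply: s12; rewrite inE js orbT.
  have [vi0|vi0] := eqVneq (v i) 0%N.
    have -> : (A `&` B) `\` D i = (A `\` D i) `&` \bigcap_(j in [set` s1 ++ s2]) (x j @^-1` [set v j]).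
      apply/seteqP; split => w.
        move=> [[Aw Bw] Dw]; split => // j js; apply: Bw.
        by rewrite /= inE; apply/orP; right.
      move=> [[Aw Dw] Bw]; split => //; split => // j /=.
      rewrite inE => /predU1P[->/=|js]; last exact: Bw.
      by rewrite vi0 x0.
    rewrite [LHS]IH2//; last by move=> w [Aw _]; exact: AD.
    apply: eq_integral => w /set_mem[_ Dw].
    by rewrite big_cons {2}/p' memNset// vi0 eqxx mul1e.
  rewrite (_ : (A `&` B) `\` D i = set0); last first.
    apply/seteqP; split => // w [[Aw Bw] Dw]; move: vi0.
    have := Bw i; rewrite /= mem_head => /(_ isT) <-.
    by rewrite x0.
  rewrite measure0 integral0_eq// => w [_ Dw].
  by rewrite big_cons /p' memNset// (negPf vi0) mul0e.
Qed.

End absent.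

(** * The Laplace functional of the construction *)

Section histories.
Context {d} {T : measurableType d} {N : nat} (y : 'I_N -> label N -> T -> nat).

Definition weights_before (n : nat) (e : label N) (w : T) : seq nat :=
  [seq y m e w | m : 'I_N <- enum 'I_N & (m < n)%N].

Lemma enum_ord_lt (n : nat) : (n <= N)%N ->
  map val [seq m : 'I_N <- enum 'I_N | (m < n)%N] = iota 0 n.
Proof.
move=> nN; rewrite -(filter_map val (fun k => (k < n)%N)) val_enum_ord.
exact: (filter_iota_ltn 0 nN).
Qed.

Lemma size_weights_before n e w : (n <= N)%N -> size (weights_before n e w) = n.
Proof.
by move=> nN; rewrite size_map -(size_map val) enum_ord_lt// size_iota.
Qed.

Lemma enum_ord_ltS (n : 'I_N) :
  [seq m : 'I_N <- enum 'I_N | (m < n.+1)%N] =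
  rcons [seq m : 'I_N <- enum 'I_N | (m < n)%N] n.
Proof.
apply: (inj_map val_inj); rewrite enum_ord_lt// map_rcons enum_ord_lt; last exact: ltnW.
by rewrite -cats1 -addn1 iotaD.
Qed.

Lemma weights_beforeS (n : 'I_N) e w :
  weights_before n.+1 e w = rcons (weights_before n e w) (y n e w).
Proof. by rewrite /weights_before enum_ord_ltS map_rcons. Qed.

Lemma nth_weights_before n e w (m : 'I_N) : (m < n)%N -> (n <= N)%N ->
  nth 0%N (weights_before n e w) m = y m e w.
Proof.
move=> mn nN; rewrite (nth_map m); last first.
  by rewrite -(size_map val) enum_ord_lt// size_iota.
congr (y _ e w); apply: val_inj.
by rewrite -(nth_map m 0%N val) ?enum_ord_lt ?nth_iota// -(size_map val) enum_ord_lt// size_iota.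
Qed.

End histories.

Section construction_laplace.
Context {R : realType} {dt} {Th : measurableType dt} {dp} {Psi : measurableType dp}.
Variables (h : Th -> nat -> R) (nu : {sigma_finite_measure set Th -> \bar R}).
Variables (N : nat) (G : probability Psi R).
Hypothesis hpmf : pmf_kernel h.
Hypothesis mass1_fin : forall v, (\int[nu]_t (h t v.+1)%:E < +oo)%E.
Variables (hc : seq nat -> nat -> \bar R) (M : nat -> nat -> \bar R).
Hypothesis hc0 : forall u v, (0 <= hc u v)%E.
Hypothesis hc_mass : forall u v, (0 < path_mass h nu u < +oo)%E ->
  (hc u v * path_mass h nu u = path_mass h nu (rcons u v))%E.
Hypothesis M_mass : forall n i, M n.+1 i.+1 = path_mass h nu (newborn n i).
Context {d} {T : measurableType d} (Q : probability T R).
Variables (rho : 'I_N -> nat -> {RV Q >-> nat}) (loc : label N -> {RV Q >-> Psi}).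
Variables (y : 'I_N -> label N -> {RV Q >-> nat}).
Variable Y : 'I_N -> T -> {measure set Psi -> \bar R}.
Hypothesis con : construction rho loc y G hc M Y.
Local Open Scope ereal_scope.

Definition presentb (e : label N) (w : T) : bool := (e.2 < rho (birth e) e.1.2 w)%N.
Local Notation hist := (weights_before (fun m e => y m e : T -> nat)).

Let hist_newborn e w : presentb e w -> hist (birth e).+1 e w = newborn (birth e) e.1.2.
Proof.
move=> ew; rewrite weights_beforeS (weight_birth con)// /newborn; congr rcons.
have bN : (birth e <= N)%N by exact: ltnW (ltn_ord _).
apply: (@eq_from_nth _ 0%N); first by rewrite size_weights_before// size_nseq.
rewrite size_weights_before// => m mn; have mN : (m < N)%N by exact: leq_trans mn bN.
rewrite nth_nseq mn (nth_weights_before _ _ _ (m := Ordinal mN))//.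
by apply: (weight_absent con); right.
Qed.

Let hist_has n e w : presentb e w -> (birth e < n)%N -> (n <= N)%N -> has (leq 1) (hist n e w).
Proof.
move=> ew en nN; apply/(has_nthP 0%N); exists (birth e).
  by rewrite size_weights_before.
by rewrite nth_weights_before// (weight_birth con).
Qed.

Let past_gen (n : 'I_N) : set (set T) :=
  sigma_of [set me : 'I_N * label N | (me.1 < n)%N] (fun me => y me.1 me.2 : T -> nat) `|`
  sigma_of [set mi : 'I_N * nat | (mi.1 < n)%N] (fun mi => rho mi.1 mi.2 : T -> nat) `|`
  sigma_of [set e : label N | (birth e < n)%N] (fun e => loc e : T -> Psi).

Let step1_gen (n : 'I_N) : set (set T) :=
  past rho loc y n `|` sigma_of [set e : label N | (birth e < n)%N] (fun e => y n e : T -> nat).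

Let sigma_of_sub {I : Type} d' (U : measurableType d') (D : set I) (V : I -> T -> U) :
  (forall i, D i -> measurable_fun setT (V i)) -> sigma_of D V `<=` measurable.
Proof.
move=> mV; apply: smallest_sub; first exact: sigma_algebra_measurable.
by move=> _ [i Di [B mB <-]]; exact: mV.
Qed.

Let past_gen_meas n : past_gen n `<=` measurable.
Proof. by move=> A [[]|]; apply: sigma_of_sub => ? _; exact: measurable_funP. Qed.

Let past_meas n : past rho loc y n `<=` measurable.
Proof.
by apply: smallest_sub; [exact: sigma_algebra_measurable|exact: past_gen_meas].
Qed.

Let step1_gen_meas n : step1_gen n `<=` measurable.
Proof.
move=> A [|]; first exact: past_meas.
by apply: sigma_of_sub => ? _; exact: measurable_funP.
Qed.

Let sigma_of_preimage {I : Type} d' (U : measurableType d') (D : set I) (V : I -> T -> U) i B :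
  D i -> measurable B -> sigma_of D V (V i @^-1` B).
Proof.
move=> Di mB; apply: sub_sigma_algebra; exists i => //.
by exists B => //; rewrite setTI.
Qed.

Let past_y (n m : 'I_N) e B : (m < n)%N -> past rho loc y n (y m e @^-1` B).
Proof.
move=> mn; apply: sub_sigma_algebra; left; left.
exact: (@sigma_of_preimage _ _ _ _ (fun me : 'I_N * label N => y me.1 me.2 : T -> nat) (m, e)).
Qed.

Let past_pres (n : 'I_N) e : (birth e < n)%N -> past rho loc y n [set w | presentb e w].
Proof.
move=> en; apply: sub_sigma_algebra; left; right.
exact: (@sigma_of_preimage _ _ _ _ (fun mi : 'I_N * nat => rho mi.1 mi.2 : T -> nat)
  (birth e, e.1.2) [set k | (e.2 < k)%N]).
Qed.

Let past_loc (n : 'I_N) e B : (birth e < n)%N -> measurable B ->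
  past rho loc y n (loc e @^-1` B).
Proof.
move=> en mB; apply: sub_sigma_algebra; right.
exact: (@sigma_of_preimage _ _ _ _ (fun e : label N => loc e : T -> Psi) e).
Qed.

Let past_hist (n : 'I_N) e u : past rho loc y n (hist n e @^-1` [set u]).
Proof.
apply: (@measurable_seq_fiber _ (g_sigma_algebraType (past_gen n)) _ (fun m => y m e)).
move=> m /List.filter_In[_ mn] v; exact: past_y.
Qed.

Section discounts.
Variable tau : nat -> Psi -> R.
Hypothesis mtau : forall m, measurable_fun setT (tau m).
Hypothesis tau0 : forall m p, (0 <= tau m p)%R.
Local Notation pred := (predictive h nu N tau).

Definition discount (n : nat) (e : label N) (w : T) : R :=
  if presentb e w && (birth e < n)%N then pred (hist n e w) (loc e w) else 1%R.

Let disc_ge0 n e w : (0 <= discount n e w)%R.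
Proof. by rewrite /discount; case: ifP => // _; exact: predictive_ge0. Qed.

Let mpred u : measurable_fun setT (pred u).
Proof. exact: measurable_predictive. Qed.

(** The discount after step 1 of stage n, as a function of the outcome v. *)
Let disc_next (n : 'I_N) (e : label N) (w : T) (v : nat) : R :=
  if presentb e w then pred (rcons (hist n e w) v) (loc e w) else 1%R.

Let past_disc_next (n : 'I_N) e v : (birth e < n)%N ->
  measurable_fun [set: g_sigma_algebraType (past_gen n)] (fun w => disc_next n e w v).
Proof.
move=> en; apply: (@measurable_fun_ifT _ _ (g_sigma_algebraType (past_gen n))) => //.
- apply: (measurable_fun_bool true); rewrite setTI.
  rewrite (_ : _ @^-1` _ = [set w | presentb e w]); first exact: past_pres.
  by apply/seteqP; split.
- apply: (@measurable_countable_comp _ (g_sigma_algebraType (past_gen n)) _ _ _ (hist n e)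
    (fun u w => pred (rcons u v) (loc e w))).
  + by move=> u; exact: past_hist.
  + move=> u; apply: (measurableT_comp (mpred _)) => _ B mB.
    by rewrite setTI; exact: past_loc.
Qed.

(** By [predictive_rec], the draws of step 1 leave the mean of the predictive
    discounts unchanged; absent labels have discount 1. *)
Let old_step (n : 'I_N) (s : seq (label N)) : uniq s ->
  (forall e, e \in s -> (birth e < n)%N) ->
  \int[Q]_w (\prod_(e <- s) discount n.+1 e w)%R%:E =
  \int[Q]_w (\prod_(e <- s) discount n e w)%R%:E.
Proof.
move=> us sn.
pose p e w v : \bar R := if presentb e w then hc (hist n e w) v else (v == 0%N)%:R%:E.
have p0 e w v : 0 <= p e w v by rewrite /p; case: ifP => // _; rewrite lee_fin.
have mpres e : measurable_fun setT (presentb e).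
  apply: (measurable_fun_bool true); rewrite setTI -[X in measurable X]setTI.
  rewrite (_ : _ @^-1` _ = rho (birth e) e.1.2 @^-1` [set k | (e.2 < k)%N]); last first.
    by apply/seteqP; split.
  exact: measurable_funP.
have mp e v : e \in s -> measurable_fun setT (fun w => p e w v).
  move=> es; apply: measurable_fun_ifT => //.
  apply: (@measurable_countable_comp _ T _ _ _ (hist n e) (fun u _ => hc u v)) => u.
    by apply: past_meas; exact: past_hist.
  exact: measurable_cst.
transitivity (\int[Q]_w \prod_(e <- s) (disc_next n e w (y n e w))%:E).
  apply: eq_integral => w _; rewrite prodEFin; congr (_%:E); apply: eq_big_seq => e es.
  rewrite /discount /disc_next ltnS ltnW ?sn// andbT; case: ifP => // _.
  by rewrite weights_beforeS.
rewrite (cond_indep_prod (C := past_gen n) (x := fun e => y n e) (p := p)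
  (a := fun e w v => (disc_next n e w v)%:E))//; last 4 first.
- pose D (e : label N) := [set w | (birth e < n)%N /\ present rho e w].
  have DE e : e \in s -> D e = [set w | presentb e w].
    by move=> es; apply/seteqP; split => w /=; [case|split => //; exact: sn].
  have draw : cond_indep_pmf Q <<s past_gen n>> D (fun e => y n e : T -> nat)
      (fun e w => hc (hist n e w)) := weight_draw con (n := n).
  move=> v A pA; rewrite (cond_indep_absent (@past_gen_meas n) us draw)//.
  + apply: eq_integral => w _; apply: eq_big_seq => e es; rewrite /p.
    rewrite DE//; suff -> : (w \in [set w | presentb e w]) = presentb e w by [].
    by apply/idP/idP => [/set_mem|/mem_set].
  + by move=> e es; rewrite DE//; apply: past_pres; exact: sn.
  + move=> e w es De; apply: (weight_absent con); left => ew.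
    by apply: De; split => //; exact: sn.
  + by move=> e v'; rewrite -[X in measurable X]setTI; exact: measurable_funP.
  + move=> e v' es.
    apply: (@measurable_countable_comp _ T _ _ _ (hist n e) (fun u _ => hc u v')) => u.
      by apply: past_meas; exact: past_hist.
    exact: measurable_cst.
- by move=> e v; rewrite -[X in measurable X]setTI; exact: measurable_funP.
- by move=> e v es; apply/measurable_EFinP; apply: past_disc_next; exact: sn.
- by move=> e w v; rewrite lee_fin /disc_next; case: ifP => // _; exact: predictive_ge0.
apply: eq_integral => w _; rewrite -prodEFin; apply: eq_big_seq => e es.
rewrite /discount sn// andbT /disc_next /p.
case: ifPn => ew; last by rewrite (nneseries_indic_eq (u := cst 1)).
rewrite predictive_rec//.
- by rewrite size_weights_before// ltnW.
- by apply: hist_has => //; [exact: sn|exact: ltnW].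
Qed.

Lemma measurable_discount n e : measurable_fun setT (discount n e).
Proof.
apply: measurable_fun_ifT => //.
- apply: (measurable_fun_bool true); rewrite setTI.
  rewrite (_ : _ @^-1` _ =
    rho (birth e) e.1.2 @^-1` [set k | (e.2 < k)%N /\ (birth e < n)%N]); last first.
    by apply/seteqP; split => w /=; [move/andP|move=> ?; apply/andP].
  by rewrite -[X in measurable X]setTI; exact: measurable_funP.
- apply: (@measurable_countable_comp _ T _ _ _ (hist n e) (fun u w => pred u (loc e w))).
  + move=> u; apply: measurable_seq_fiber => m _ v.
    by rewrite -[X in measurable X]setTI; exact: measurable_funP.
  + by move=> u; exact: measurableT_comp.
Qed.

Definition mean_discount (n i : nat) : R := fine (\int[G]_p (pred (newborn n i) p)%:E).

Let pred01 n i p : 0 <= (pred (newborn n i) p)%:E <= 1.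
Proof. by rewrite !lee_fin predictive_ge0//= predictive_le1// has_newborn. Qed.

Let mpredE u : measurable_fun setT (fun p => (pred u p)%:E).
Proof. by apply/measurable_EFinP; exact: mpred. Qed.

Let mean_discountE n i : (mean_discount n i)%:E = \int[G]_p (pred (newborn n i) p)%:E.
Proof.
rewrite fineK// ge0_fin_numE; last by apply: integral_ge0 => p _; have /andP[] := pred01 n i p.
apply: (@le_lt_trans _ _ 1); last exact: ltry.
by apply: integral_prob_le => // p; have /andP[] := pred01 n i p.
Qed.

Let mean_discount_ge0 n i : (0 <= mean_discount n i)%R.
Proof. by rewrite -lee_fin mean_discountE; apply: integral_ge0 => p _; have /andP[] := pred01 n i p. Qed.

Let mean_discount_le1 n i : (mean_discount n i <= 1)%R.
Proof.
by rewrite -lee_fin mean_discountE; apply: integral_prob_le => // p; have /andP[] := pred01 n i p.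
Qed.

Let stage_meas n k : stage_events rho loc y n k `<=` measurable.
Proof.
case: k => [[i|ij]|]; last first.
- by apply: smallest_sub; [exact: sigma_algebra_measurable|exact: step1_gen_meas].
- by move=> _ [B mB <-]; exact: measurable_funP.
- by move=> _ [B mB <-]; exact: measurable_funP.
Qed.

Let integral_loc e (g : Psi -> \bar R) : measurable_fun setT g -> (forall p, 0 <= g p) ->
  \int[Q]_w g (loc e w) = \int[G]_p g p.
Proof.
move=> mg g0.
transitivity (\int[Q]_w (cst 1 w * g (loc e w))).
  by apply: eq_integral => w _; rewrite mul1e.
transitivity (\int[G]_p (cst 1 p * g (id p))); last first.
  by apply: eq_integral => w _; rewrite mul1e.
apply: ge0_integral_transfer => // C mC.
transitivity (Q (loc e @^-1` C)).
  under eq_integral do rewrite mul1e.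
  rewrite [LHS](_ : _ = \int[Q]_w (\1_(loc e @^-1` C) w)%:E)//.
  rewrite integral_indic ?setIT//.
  by rewrite -[X in measurable X]setTI; exact: measurable_funP.
under eq_integral do rewrite mul1e.
by rewrite integral_indic// setIT; exact: (location_law con).
Qed.

Let new_disc (n : 'I_N) (ij : nat * nat) (w : T) : R :=
  pred (newborn n ij.1) (loc (n, ij.1, ij.2) w).

Let rho_indep (n : 'I_N) (K : seq nat) (b : nat -> nat -> R) : uniq K ->
  (forall i k, (0 <= b i k)%R) ->
  \int[Q]_w (\prod_(i <- K) b i (rho n i w))%:E =
  \prod_(i <- K) \int[Q]_w (b i (rho n i w))%:E.
Proof.
move=> uK b0.
pose phi (k : option (nat + nat * nat)) w : \bar R :=
  if k is Some (inl i) then (b i (rho n i w))%:E else 1.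
have phi0 k w : 0 <= phi k w by case: k => [[i|ij]|] //=; rewrite lee_fin.
pose lK := [seq Some (inl i : nat + nat * nat) | i <- K].
have ulK : uniq lK by rewrite map_inj_uniq// => i j [].
have := mutual_independence_prod (stage_independent con (n := n)) (@stage_meas n) _ phi0 ulK.
rewrite [X in (_ -> _ = X) -> _]big_map /= => <-.
  by apply: eq_integral => w _; rewrite big_map -prodEFin.
move=> _ /mapP[i _ ->] C mC; exists ((fun k => (b i k)%:E) @^-1` C) => //.
by rewrite setTI.
Qed.

Let new_base (n : 'I_N) (A : T -> \bar R) (K : seq nat) (s : seq (nat * nat))
    (b : nat -> nat -> R) :
  (forall w, 0 <= A w) ->
  (forall C, measurable C -> past_and_step1 rho loc y n (A @^-1` C)) ->
  uniq K -> uniq s -> (forall i k, (0 <= b i k)%R) ->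
  \int[Q]_w (A w * (\prod_(i <- K) b i (rho n i w) * \prod_(ij <- s) new_disc n ij w)%:E) =
  \int[Q]_w A w * (\prod_(ij <- s) mean_discount n ij.1)%:E *
    \int[Q]_w (\prod_(i <- K) b i (rho n i w))%:E.
Proof.
move=> A0 mA uK us b0.
pose phi (k : option (nat + nat * nat)) w : \bar R :=
  match k with
  | None => A w
  | Some (inl i) => (b i (rho n i w))%:E
  | Some (inr ij) => (new_disc n ij w)%:E
  end.
have phi0 k w : 0 <= phi k w.
  by case: k => [[i|ij]|] //=; rewrite lee_fin// predictive_ge0.
have stage_phi k C : measurable C -> stage_events rho loc y n k (phi k @^-1` C).
  move=> mC; case: k => [[i|ij]|] /=; last exact: mA.
  - exists ((fun k => (b i k)%:E) @^-1` C) => //.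
    by rewrite setTI.
  - exists ((fun p => (pred (newborn n ij.1) p)%:E) @^-1` C); last by rewrite setTI.
    by rewrite -[X in measurable X]setTI; exact: mpredE.
have indep := stage_independent con (n := n).
pose lK := [seq Some (inl i : nat + nat * nat) | i <- K].
pose ls := [seq Some (inr ij : nat + nat * nat) | ij <- s].
have ulK : uniq lK by rewrite map_inj_uniq// => i j [].
have uls : uniq ls by rewrite map_inj_uniq// => i j [].
have uall : uniq (None :: lK ++ ls).
  rewrite /= mem_cat negb_or cat_uniq ulK uls andbT.
  apply/andP; split; first by apply/andP; split; apply/mapP => -[].
  by apply/hasPn => _ /mapP[ij _ ->]; apply/mapP => -[].
have stage_phi' (l : seq (option (nat + nat * nat))) k : k \in l -> forall C, measurable C ->
  stage_events rho loc y n k (phi k @^-1` C) by move=> _; exact: stage_phi.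
have := mutual_independence_prod indep (@stage_meas n) (stage_phi' (None :: lK ++ ls)) phi0 uall.
rewrite big_cons big_cat/= !big_map/=.
have := mutual_independence_prod indep (@stage_meas n) (stage_phi' lK) phi0 ulK.
rewrite [X in _ = X -> _]big_map/= => <-.
have -> : \prod_(j <- s) \int[Q]_w (new_disc n j w)%:E = (\prod_(ij <- s) mean_discount n ij.1)%:E.
  rewrite -prodEFin; apply: eq_bigr => ij _; rewrite mean_discountE.
  apply: (integral_loc (n, ij.1, ij.2) (g := fun p => (pred (newborn n ij.1) p)%:E)) => // p.
  by have /andP[] := pred01 n ij.1 p.
have lKE w : \prod_(k <- lK) phi k w = (\prod_(i <- K) b i (rho n i w))%:E.
  by rewrite big_map -prodEFin.
have allE w : \prod_(k <- None :: lK ++ ls) phi k w =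
    A w * (\prod_(i <- K) b i (rho n i w) * \prod_(ij <- s) new_disc n ij w)%:E.
  by rewrite big_cons big_cat/= !big_map EFinM -!prodEFin.
under eq_integral do rewrite allE.
rewrite (eq_integral _ _ (fun w _ => lKE w)).
by move=> ->; rewrite -muleA; congr (_ * _); rewrite muleC.
Qed.

(** The locations of the atoms born at stage n are independent of all the rest,
    so that their discounts may be replaced by the mean discount q, one atom at
    a time, splitting on whether this atom is present. *)
Let new_step (n : 'I_N) (A : T -> \bar R) (K : seq nat) (s s' : seq (nat * nat))
    (b : nat -> nat -> R) :
  (forall w, 0 <= A w) ->
  (forall C, measurable C -> past_and_step1 rho loc y n (A @^-1` C)) ->
  uniq K -> uniq (s ++ s') -> (forall i k, (0 <= b i k)%R) ->
  (forall ij, ij \in s -> ij.1 \in K) ->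
  \int[Q]_w (A w * (\prod_(i <- K) b i (rho n i w) * \prod_(ij <- s') new_disc n ij w *
    \prod_(ij <- s) (if (ij.2 < rho n ij.1 w)%N then new_disc n ij w else 1))%R%:E) =
  \int[Q]_w A w * (\prod_(ij <- s') mean_discount n ij.1)%:E *
    \int[Q]_w (\prod_(i <- K) b i (rho n i w) *
      \prod_(ij <- s) (if (ij.2 < rho n ij.1 w)%N then mean_discount n ij.1 else 1))%R%:E.
Proof.
move=> A0 mA uK; elim: s s' b => [|ij s IHs] s' b us b0 sK.
  under eq_integral do rewrite big_nil mulr1.
  under [in X in _ = _ * X]eq_integral do rewrite big_nil mulr1.
  exact: new_base.
have mA' : measurable_fun setT A.
  by move=> _ C mC; rewrite setTI; apply: (@stage_meas n None); exact: mA.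
have ijK : ij.1 \in K by apply: sK; rewrite mem_head.
have usij : uniq (s ++ ij :: s') by rewrite -cat1s uniq_catCA.
have us' : uniq (s ++ s') by move: us => /andP[].
have sK' kl : kl \in s -> kl.1 \in K by move=> ks; apply: sK; rewrite inE ks orbT.
pose bin i k : R := (b i k * (if i == ij.1 then (ij.2 < k)%N%:R else 1))%R.
pose bout i k : R := (b i k * (if i == ij.1 then (~~ (ij.2 < k)%N)%:R else 1))%R.
have bin0 i k : (0 <= bin i k)%R by rewrite mulr_ge0//; case: ifP.
have bout0 i k : (0 <= bout i k)%R by rewrite mulr_ge0//; case: ifP.
have prod_one (c : nat -> R) :
    (\prod_(i <- K) (if i == ij.1 then c i else 1) = c ij.1)%R.
  rewrite (bigD1_seq _ ijK uK)/= eqxx big1 ?mulr1// => i /negPf ->//.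
have prod_in (r : nat -> nat) : (\prod_(i <- K) bin i (r i) =
    \prod_(i <- K) b i (r i) * (ij.2 < r ij.1)%N%:R)%R.
  by rewrite big_split/= (prod_one (fun i => (ij.2 < r i)%N%:R)).
have prod_out (r : nat -> nat) : (\prod_(i <- K) bout i (r i) =
    \prod_(i <- K) b i (r i) * (~~ (ij.2 < r ij.1)%N)%:R)%R.
  by rewrite big_split/= (prod_one (fun i => (~~ (ij.2 < r i)%N)%:R)).
have IHin := IHs (ij :: s') bin usij bin0 sK'.
have IHout := IHs s' bout us' bout0 sK'.
have mnew kl : measurable_fun setT (new_disc n kl).
  exact: (measurableT_comp (mpred _) (measurable_funP _)).
have mif kl (g1 g2 : T -> R) : measurable_fun setT g1 -> measurable_fun setT g2 ->
    measurable_fun setT (fun w => if (kl.2 < rho n kl.1 w)%N then g1 w else g2 w).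
  move=> mg1 mg2; apply: measurable_fun_ifT => //.
  exact: (measurableT_comp (measurable_fun_nat (fun k => (kl.2 < k)%N)) (measurable_funP _)).
have mrho i (g : nat -> R) : measurable_fun setT (fun w => g (rho n i w)).
  exact: (measurableT_comp (measurable_fun_nat g) (measurable_funP _)).
have new0 kl w : (0 <= new_disc n kl w)%R by exact: predictive_ge0.
pose X (b : nat -> nat -> R) s' w := (A w * (\prod_(i <- K) b i (rho n i w) *
    \prod_(ij <- s') new_disc n ij w *
    \prod_(ij <- s) (if (ij.2 < rho n ij.1 w)%N then new_disc n ij w else 1))%R%:E).
have X0 b' s1 w : (forall i k, (0 <= b' i k)%R) -> 0 <= X b' s1 w.
  move=> b'0; rewrite mule_ge0// lee_fin mulr_ge0 ?mulr_ge0 ?prodr_ge0//.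
  by move=> kl _; case: ifP.
have mX b' s1 : measurable_fun setT (X b' s1).
  apply: emeasurable_funM => //; apply/measurable_EFinP.
  apply: measurable_funM; last by apply: measurable_prod => kl _; apply: mif.
  by apply: measurable_funM; apply: measurable_prod => kl _ //; exact: mrho.
transitivity (\int[Q]_w (X bin (ij :: s') w + X bout s' w)).
  apply: eq_integral => w _; rewrite /X prod_in prod_out !big_cons.
  case: ifPn => _ /=; rewrite !(mulr0, mul0r, mule0, adde0, add0e).
    by congr (_ * _%:E); ring.
  by congr (_ * _%:E); ring.
rewrite ge0_integralD//; last 2 first.
- by move=> w _; exact: X0.
- by move=> w _; exact: X0.
pose S w := (\prod_(ij <- s) (if (ij.2 < rho n ij.1 w)%N then mean_discount n ij.1 else 1))%R.
have S0 w : (0 <= S w)%R by apply: prodr_ge0 => kl _; case: ifP.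
have mS : measurable_fun setT S by apply: measurable_prod => kl _; apply: mif.
pose I b' := \int[Q]_w (\prod_(i <- K) b' i (rho n i w) * S w)%R%:E.
have mI b' : measurable_fun setT (fun w => (\prod_(i <- K) b' i (rho n i w) * S w)%R%:E).
  apply/measurable_EFinP; apply: measurable_funM => //.
  by apply: measurable_prod => i _; exact: mrho.
have I0 b' w : (forall i k, (0 <= b' i k)%R) ->
    0 <= (\prod_(i <- K) b' i (rho n i w) * S w)%R%:E.
  by move=> b'0; rewrite lee_fin mulr_ge0// prodr_ge0.
have intA0 : 0 <= \int[Q]_w A w * (\prod_(ij <- s') mean_discount n ij.1)%:E.
  by rewrite mule_ge0 ?integral_ge0// lee_fin prodr_ge0.
rewrite [X in X + _]IHin [X in _ + X]IHout -/(I bin) -/(I bout).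
transitivity (\int[Q]_w A w * (\prod_(ij <- s') mean_discount n ij.1)%:E *
    ((mean_discount n ij.1)%:E * I bin + I bout)).
  have Iin0 : 0 <= I bin by apply: integral_ge0 => w _; exact: I0.
  have Iout0 : 0 <= I bout by apply: integral_ge0 => w _; exact: I0.
  have qI0 : 0 <= (mean_discount n ij.1)%:E * I bin by rewrite mule_ge0 ?lee_fin.
  rewrite [RHS](ge0_muleDr _ qI0 Iout0).
  by congr (_ + _); rewrite big_cons EFinM -!muleA; congr (_ * _); rewrite muleCA.
congr (_ * _); rewrite -ge0_integralZl_EFin//; last by move=> w _; exact: I0.
rewrite -ge0_integralD//; last 3 first.
- by move=> w _; rewrite mule_ge0 ?lee_fin//; exact: I0.
- by apply: emeasurable_funM => //; exact: measurable_cst.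
- by move=> w _; exact: I0.
apply: eq_integral => w _; rewrite -EFinM -EFinD; congr (_%:E).
rewrite big_cons prod_in prod_out -/(S w).
by case: ifP => _ /=; ring.
Qed.

Let step1_discount (n : 'I_N) e : (birth e < n)%N ->
  measurable_fun [set: g_sigma_algebraType (step1_gen n)] (fun w => discount n.+1 e w).
Proof.
move=> en; have sub : past rho loc y n `<=` past_and_step1 rho loc y n.
  by move=> A pA; apply: sub_sigma_algebra; left.
under eq_fun do rewrite /discount ltnS (ltnW en) andbT.
apply: (@measurable_fun_ifT _ _ (g_sigma_algebraType (step1_gen n))) => //.
- apply: (measurable_fun_bool true); rewrite setTI.
  rewrite (_ : _ @^-1` _ = [set w | presentb e w]); first by apply: sub; exact: past_pres.
  by apply/seteqP; split.
- apply: (@measurable_countable_comp _ (g_sigma_algebraType (step1_gen n)) _ _ _ (hist n.+1 e)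
    (fun u w => pred u (loc e w))).
  + move=> u; apply: (@measurable_seq_fiber _ (g_sigma_algebraType (step1_gen n)) _ (fun m => y m e)).
    move=> m /List.filter_In[_ mn] v.
    move: mn; rewrite ltnS leq_eqVlt => /predU1P[/val_inj -> |mn]; last by apply: sub; exact: past_y.
    apply: sub_sigma_algebra; right.
    exact: (@sigma_of_preimage _ _ _ _ (fun e : label N => y n e : T -> nat) e).
  + move=> u; apply: (measurableT_comp (mpred _)) => _ B mB.
    by rewrite setTI; apply: sub; exact: past_loc.
Qed.

Definition label_pairs (L1 L2 : nat) : seq (nat * nat) :=
  [seq (i, j) | i <- iota 0 L1, j <- iota 0 L2].

(** Truncating the labels makes the product of the discounts finite. *)
Definition label_box (L1 L2 : nat) : seq (label N) :=
  [seq (m, ij.1, ij.2) | m <- enum 'I_N, ij <- label_pairs L1 L2].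

(** The power min(k, L) of the mean discount: among k new atoms, those with a
    label below L. *)
Definition thinned_count (L n i k : nat) : R :=
  (\prod_(j <- iota 0 L) (if (j < k)%N then mean_discount n i else 1))%R.

Let uniq_pairs L1 L2 : uniq (label_pairs L1 L2).
Proof. by rewrite allpairs_uniq ?iota_uniq// => -[i j] [i' j'] _ _. Qed.

Let uniq_box L1 L2 : uniq (label_box L1 L2).
Proof.
rewrite allpairs_uniq ?enum_uniq ?uniq_pairs//.
by move=> [m [i j]] [m' [i' j']] _ _ /= [-> -> ->].
Qed.

Let big_box L1 L2 (F : label N -> R) :
  (\prod_(e <- label_box L1 L2) F e =
   \prod_(m < N) \prod_(ij <- label_pairs L1 L2) F (m, ij.1, ij.2))%R.
Proof. by rewrite big_allpairs_dep big_enum. Qed.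

Let box_step (n : 'I_N) L1 L2 :
  \int[Q]_w (\prod_(e <- label_box L1 L2) discount n.+1 e w)%R%:E =
  \int[Q]_w (\prod_(e <- label_box L1 L2) discount n e w)%R%:E *
    \prod_(i <- iota 0 L1) \int[Q]_w (thinned_count L2 n i (rho n i w))%:E.
Proof.
set s := label_pairs L1 L2.
pose old := [seq e <- label_box L1 L2 | (birth e < n)%N].
have uold : uniq old by rewrite filter_uniq// uniq_box.
have oldP e : e \in old -> (birth e < n)%N by rewrite mem_filter => /andP[].
have big_old (F : label N -> R) : (\prod_(e <- old) F e =
    \prod_(m < N) \prod_(ij <- s) (if (m < n)%N then F (m, ij.1, ij.2) else 1))%R.
  by rewrite big_filter big_mkcond big_box.
have old_n w : (\prod_(e <- label_box L1 L2) discount n e w =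
    \prod_(e <- old) discount n e w)%R.
  rewrite big_box big_old; apply: eq_bigr => m _; apply: eq_bigr => ij _.
  by rewrite /discount /birth/=; case: (m < n)%N; rewrite ?andbF.
have old_n1 w : (\prod_(e <- label_box L1 L2) discount n.+1 e w =
    \prod_(e <- old) discount n.+1 e w *
    \prod_(ij <- s) (if (ij.2 < rho n ij.1 w)%N then new_disc n ij w else 1))%R.
  rewrite big_box big_old (bigD1 n)//= [in RHS](bigD1 n)//= ltnn.
  rewrite [X in _ = (X * _ * _)%R]big1// mul1r mulrC; congr (_ * _)%R.
    apply: eq_bigr => m mn; apply: eq_bigr => ij _.
    case: ifPn => // nm; rewrite /discount /birth/= ltnS leq_eqVlt.
    by rewrite (negPf nm) (inj_eq val_inj) (negPf mn) andbF.
  apply: eq_bigr => ij _; rewrite /discount ltnSn andbT /presentb /=.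
  case: ifPn => // pe; have := @hist_newborn (n, ij.1, ij.2) w pe.
  by rewrite /birth/= => ->.
under eq_integral do rewrite old_n1.
under [in RHS]eq_integral do rewrite old_n.
rewrite -old_step//.
pose A w : \bar R := (\prod_(e <- old) discount n.+1 e w)%R%:E.
have A0 w : 0 <= A w by rewrite lee_fin prodr_ge0.
have mA C : measurable C -> past_and_step1 rho loc y n (A @^-1` C).
  move=> mC; have mA' : measurable_fun [set: g_sigma_algebraType (step1_gen n)] A.
    apply/measurable_EFinP; apply: (@measurable_prod _ (g_sigma_algebraType (step1_gen n))).
    by move=> e /oldP en; exact: step1_discount.
  by have := mA' measurableT _ mC; rewrite setTI.
have sK ij : ij \in s -> ij.1 \in iota 0 L1 by move=> /allpairsP[[i j] [iK _ ->]].
have us : uniq (s ++ [::]) by rewrite cats0 uniq_pairs.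
have := new_step A0 mA (iota_uniq 0 L1) us (b := fun _ _ => 1%R) (fun _ _ => ler01) sK.
have prod1 : (\prod_(i <- iota 0 L1) 1 = 1 :> R)%R by rewrite big1.
move=> new_eq; rewrite -[X in _ = X * _]mule1 -[X in _ = _ * X * _]/(1%R%:E).
transitivity (\int[Q]_w (A w * (\prod_(i <- iota 0 L1) 1 * \prod_(ij <- [::]) new_disc n ij w *
    \prod_(ij <- s) (if (ij.2 < rho n ij.1 w)%N then new_disc n ij w else 1))%R%:E)).
  by apply: eq_integral => w _; rewrite big_nil prod1 !mul1r -EFinM.
rewrite new_eq big_nil; congr (_ * _).
rewrite -(rho_indep n (iota_uniq 0 L1) (b := thinned_count L2 n)); last first.
  by move=> i k; apply: prodr_ge0 => j _; case: ifP => // _; exact: mean_discount_ge0.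
apply: eq_integral => w _; congr (_%:E); rewrite prod1 mul1r.
by rewrite big_allpairs_dep.
Qed.

Lemma mean_discount_bounds n i : (0 <= mean_discount n i <= 1)%R.
Proof. by rewrite mean_discount_ge0 mean_discount_le1. Qed.

Lemma EFin_mean_discount n i :
  (mean_discount n i)%:E = \int[G]_p (pred (newborn n i) p)%:E.
Proof. exact: mean_discountE. Qed.

(** Undoing the stages one at a time: step 1 preserves the mean, and step 2
    contributes the factor of its new atoms. *)
Lemma box_discount L1 L2 :
  \int[Q]_w (\prod_(e <- label_box L1 L2) discount N e w)%R%:E =
  \prod_(n < N) \prod_(i <- iota 0 L1) \int[Q]_w (thinned_count L2 n i (rho n i w))%:E.
Proof.
pose C (n : 'I_N) := \prod_(i <- iota 0 L1) \int[Q]_w (thinned_count L2 n i (rho n i w))%:E.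
have gen k : (k <= N)%N ->
    \int[Q]_w (\prod_(e <- label_box L1 L2) discount k e w)%R%:E =
    \prod_(n <- [seq m : 'I_N <- enum 'I_N | (m < k)%N]) C n.
  elim: k => [_|k IHk kN].
    rewrite (_ : [seq _ <- _ | _] = [::]) ?big_nil; last first.
      by apply/eqP; rewrite -size_eq0 -(size_map val) enum_ord_lt.
    rewrite -[RHS](integral_prob_cst Q); apply: eq_integral => w _.
    by rewrite big1// => e _; rewrite /discount andbF.
  have -> : [seq m : 'I_N <- enum 'I_N | (m < k.+1)%N] =
      rcons [seq m : 'I_N <- enum 'I_N | (m < k)%N] (Ordinal kN).
    exact: (enum_ord_ltS (Ordinal kN)).
  rewrite -cats1 big_cat big_seq1 -(IHk (ltnW kN)).
  exact: (box_step (Ordinal kN)).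
rewrite gen// (_ : [seq _ <- _ | _] = enum 'I_N) ?big_enum//.
by apply/all_filterP/allP => m _; exact: ltn_ord.
Qed.

End discounts.

Let integral_number (n : 'I_N) i (g : nat -> R) : (forall k, (0 <= g k)%R) ->
  \int[Q]_w (g (rho n i w))%:E =
  \sum_(k <oo) (g k)%:E * poisson_prob (fine (path_mass h nu (newborn n i))) 0 [set k].
Proof.
move=> g0.
have mI k : measurable (rho n i @^-1` [set k]).
  by rewrite -[X in measurable X]setTI; exact: measurable_funP.
have mIf k : measurable_fun setT (fun w => (k == rho n i w)%:R%:E : \bar R).
  rewrite (_ : (fun _ => _) = (fun w => (\1_(rho n i @^-1` [set k]) w)%:E)).
    exact: measurable_indice.
  by apply/funext => w; rewrite indic_fiber.
transitivity (\int[Q]_w \sum_(k <oo) (g k)%:E * (k == rho n i w)%:R%:E).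
  by apply: eq_integral => w _; rewrite (nneseries_indic_eq (u := fun k => (g k)%:E)).
rewrite integral_nneseries//; last 2 first.
- by move=> k; apply: emeasurable_funM => //; exact: measurable_cst.
- by move=> k w _; rewrite mule_ge0// lee_fin.
apply: eq_eseriesr => k _; rewrite ge0_integralZl_EFin//; congr (_ * _).
transitivity (Q (rho n i @^-1` [set k])).
  rewrite -[in RHS](setIT (rho n i @^-1` [set k])) -integral_indic//.
  by apply: eq_integral => w _; rewrite indic_fiber.
by rewrite -M_mass; exact: (number_law con).
Qed.

(** With zero costs every truncated product of discounts has mean 1, whereas by
    [predictive_full] it vanishes as soon as one of its atoms has a history of
    mass 0. *)
Let mass_ae : {ae Q, forall w, forall e : label N,
  presentb e w -> path_mass h nu (hist N e w) != 0}.
Proof.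
pose tau : nat -> Psi -> R := fun _ _ => 0%R.
have mtau m : measurable_fun setT (tau m) by exact: measurable_cst.
have tau0 m p : (0 <= tau m p)%R by [].
have cost0 u p : path_cost tau u p = 0%R.
  by rewrite /path_cost big1// => m _; rewrite mul0r.
have discountE e w : discount tau N e w =
    (if presentb e w then (path_mass h nu (hist N e w) != 0)%:R else 1)%R.
  rewrite /discount ltn_ord andbT; case: ifP => // ew.
  rewrite predictive_full ?size_weights_before//; last exact: hist_has.
  by rewrite cost0 oppr0 expR0 mul1r.
have laplace1 t : pmf_laplace h t 0 = 1.
  rewrite -(pmf_kernel_sum1 hpmf t); apply: eq_eseriesr => v _.
  by rewrite mul0r oppr0 expR0 mule1.
have mean1 n i : path_mass h nu (newborn n i) != 0 -> mean_discount tau n i = 1%R.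
  move=> m0; rewrite /mean_discount.
  suff -> : \int[G]_p (predictive h nu N tau (newborn n i) p)%:E = 1 by [].
  rewrite -[RHS](integral_prob_cst G).
  apply: eq_integral => p _; rewrite /predictive cost0 oppr0 expR0 mul1r.
  have -> : path_laplace h nu N tau (newborn n i) p = path_mass h nu (newborn n i).
    apply: eq_integral => t _; rewrite /future big1 ?mule1// => m _.
  by rewrite divff// fine_eq0// path_mass_fin_num// has_newborn.
have thinned1 L (n : 'I_N) i : \int[Q]_w (thinned_count tau L n i (rho n i w))%:E = 1.
  have [m0|m0] := eqVneq (path_mass h nu (newborn n i)) 0; last first.
    rewrite -[RHS](integral_prob_cst Q); apply: eq_integral => w _.
    by rewrite /thinned_count big1// => j _; rewrite mean1// if_same.
  have thin0 k : (0 <= thinned_count tau L n i k)%R.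
    apply: prodr_ge0 => j _; case: ifP => // _.
    by rewrite /mean_discount fine_ge0// integral_ge0// => p _; rewrite lee_fin predictive_ge0.
  rewrite (integral_number n i thin0) m0 /=.
  rewrite (eq_eseriesr (g := fun k => (thinned_count tau L n i k)%:E * (k == 0%N)%:R%:E)); last first.
    move=> k _; congr (_ * _); rewrite /poisson_prob ltxx diracE; congr (_%:E).
    by congr (_%:R); congr nat_of_bool; apply/idP/eqP => [/set_mem//|->]; exact/mem_set.
  rewrite (nneseries_indic_eq (u := fun k => (thinned_count tau L n i k)%:E))//.
  by rewrite /thinned_count big1.
have one L1 L2 : \int[Q]_w (\prod_(e <- label_box L1 L2) discount tau N e w)%R%:E = 1.
  rewrite box_discount// big1// => n _; rewrite big1// => i _.
pose bad (e : label N) := [set w | presentb e w && (path_mass h nu (hist N e w) == 0)].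
have mbad e : measurable (bad e).
  have mpres : measurable [set w | presentb e w].
    rewrite -[X in measurable X]setTI.
    exact: (measurable_funP (rho (birth e) e.1.2) measurableT [set k | (e.2 < k)%N]).
  have mhist : measurable_fun setT (fun w => path_mass h nu (hist N e w) == 0).
    apply: (@measurable_countable_comp _ T _ _ bool (hist N e) (fun u _ => path_mass h nu u == 0)).
    - move=> u; apply: measurable_seq_fiber => m _ v.
      by rewrite -[X in measurable X]setTI; exact: measurable_funP.
    - move=> u; exact: measurable_cst.
  rewrite (_ : bad e = [set w | presentb e w] `&`
    (fun w => path_mass h nu (hist N e w) == 0) @^-1` [set true]).
    by apply: measurableI => //; rewrite -[X in measurable X]setTI; exact: mhist.
  by apply/seteqP; split => w; rewrite /bad/=; [move/andP|move=> [-> ->]].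
have bad0 e : Q.-negligible (bad e).
  exists (bad e); split => //.
  case: e => [[m i] j]; set e := (m, i, j).
  have ebox : e \in label_box i.+1 j.+1.
    apply/allpairsP; exists (m, (i, j)); split => //=; first exact: mem_enum.
    by apply/allpairsP; exists (i, j); split; rewrite // mem_iota/= add0n ltnSn.
  have : 1 <= \int[Q]_w (\1_(~` bad e) w)%:E.
    rewrite -(one i.+1 j.+1); apply: ge0_le_integral => //.
    - move=> w _; rewrite lee_fin prodr_ge0// => e' _; rewrite discountE.
      by case: ifP.
    - apply/measurable_EFinP; apply: measurable_prod => e' _.
      exact: measurable_discount.
    - by apply: measurable_indice; exact: measurableC.
    move=> w _; rewrite lee_fin (big_rem e)//= discountE indicE in_setC.
    set b := (_ \in _); have -> : b = (presentb e w && (path_mass h nu (hist N e w) == 0)).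
      by apply/idP/idP => [/set_mem//|bw]; exact/mem_set.
    have P1 : (\prod_(e' <- rem e (label_box i.+1 j.+1)) discount tau N e' w <= 1)%R.
      by apply: prodr_ile1 => e' _; rewrite discountE; case: ifP => _; rewrite ?ler01 ?lexx// ler0n lern1 leq_b1.
    case: ifP => /= _; last by rewrite mul1r.
    by case: (path_mass h nu _ == 0); rewrite ?mul0r ?mul1r.
  rewrite integral_indic ?setIT//; last exact: measurableC.
  rewrite [X in _ <= X -> _]probability_setC//.
  have qf : Q (bad e) \is a fin_num by exact: fin_num_measure.
  rewrite -(fineK qf) -EFinB lee_fin lerBrDl -lerBrDr subrr => le0.
  by congr (_%:E); apply/eqP; rewrite eq_le le0/= fine_ge0.
have : {ae Q, forall w, forall k,
    if (choice.unpickle k : option ('I_N * nat * nat)%type) is Some e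
    then ~ bad e w else True}.
  apply: ae_foralln => k; case: (choice.unpickle k) => [e|]; last exact: aeW.
  have [B [mB B0 badB]] := bad0 e; exists B; split => // w /= nb.
  by apply: badB; apply: contrapT => nbw; exact: nb.
apply: filterS => w good e ew; apply/negP => m0; have := good (choice.pickle (e : 'I_N * nat * nat)%type).
by rewrite choice.pickleK; apply; rewrite /bad/= ew.
Qed.

Lemma cvg_prode (I : Type) (r : seq I) (u : I -> nat -> \bar R) (l : I -> R) :
  (forall i, u i n @[n --> \oo] --> (l i)%:E) ->
  \prod_(i <- r) u i n @[n --> \oo] --> \prod_(i <- r) (l i)%:E.
Proof.
move=> ul; elim: r => [|i r IHr].
  by under eq_fun do rewrite big_nil; rewrite big_nil; exact: cvg_cst.
under eq_fun do rewrite big_cons.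
rewrite big_cons; apply: cvgeM => //.
by rewrite prodEFin; exact: mule_def_fin.
Qed.

Section limits.
Variable tau : nat -> Psi -> R.
Hypothesis mtau : forall m, measurable_fun setT (tau m).
Hypothesis tau0 : forall m p, (0 <= tau m p)%R.

Definition atom_cost (e : label N) (w : T) : R :=
  (\sum_(n < N) (y n e w)%:R * tau n (loc e w))%R.

Let atom_cost_ge0 e w : (0 <= atom_cost e w)%R.
Proof. by apply: sumr_ge0 => n _; rewrite mulr_ge0. Qed.

Let measurable_atom_cost e : measurable_fun setT (atom_cost e).
Proof.
apply: measurable_sum => n; apply: measurable_funM; last exact: measurableT_comp.
by apply: (@measurableT_comp _ _ _ _ _ _ (fun k : nat => k%:R : R)).
Qed.

Let atom_costE e w : path_cost tau (hist N e w) (loc e w) = atom_cost e w.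
Proof.
rewrite /path_cost size_weights_before// big_mkord; apply: eq_bigr => n _.
by rewrite nth_weights_before// mulrC.
Qed.

(** An absent atom has weights 0, hence cost 0. *)
Let discount_ae : {ae Q, forall w, forall e,
  discount tau N e w = expR (- atom_cost e w)}.
Proof.
apply: filterS mass_ae => w mass_neq0 e; rewrite /discount ltn_ord andbT -atom_costE.
case: ifPn => ew.
  rewrite predictive_full ?size_weights_before//; last exact: hist_has.
  by rewrite mass_neq0// mulr1.
rewrite atom_costE /atom_cost big1 ?oppr0 ?expR0// => n _.
by rewrite (weight_absent con) ?mul0r//; left; apply/negP.
Qed.

Let box_cost L1 L2 :
  \int[Q]_w (\prod_(e <- label_box L1 L2) discount tau N e w)%R%:E =
  \int[Q]_w expeR (- \sum_(e <- label_box L1 L2) (atom_cost e w)%:E).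
Proof.
apply: ge0_ae_eq_integral => //.
- by apply/measurable_EFinP; apply: measurable_prod => e _; exact: measurable_discount.
- by apply: measurable_expeRN; apply: emeasurable_sum => e; apply/measurable_EFinP.
- move=> w _; rewrite lee_fin prodr_ge0// => e _; rewrite /discount.
  by case: ifP => // _; exact: predictive_ge0.
- by move=> w _; exact: expeR_ge0.
apply: filterS discount_ae => w discE _.
rewrite expeRN_sum; last by move=> e _; rewrite lee_fin.
by rewrite -prodEFin; apply: eq_bigr => e _; rewrite discE.
Qed.

Let big_box_sum L1 L2 (F : label N -> \bar R) :
  \sum_(e <- label_box L1 L2) F e =
  \sum_(0 <= i < L1) \sum_(0 <= j < L2) \sum_(m < N) F (m, i, j).
Proof.
rewrite /label_box big_allpairs_dep big_enum /=.
rewrite (eq_bigr (fun m => \sum_(0 <= i < L1) \sum_(0 <= j < L2) F (m, i, j))); last first.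
  by move=> m _; rewrite big_allpairs_dep /index_iota !subn0.
rewrite exchange_big /=; apply: eq_bigr => i _.
by rewrite exchange_big.
Qed.

Let row_cost (i j : nat) w : \bar R := \sum_(m < N) (atom_cost (m, i, j) w)%:E.

Let row_cost_ge0 i j w : 0 <= row_cost i j w.
Proof. by apply: sume_ge0 => m _; rewrite lee_fin. Qed.

Let measurable_row_cost i j : measurable_fun setT (row_cost i j).
Proof. by apply: emeasurable_sum => m; apply/measurable_EFinP. Qed.

Let cvg_box_cost L1 :
  \int[Q]_w expeR (- \sum_(e <- label_box L1 L2) (atom_cost e w)%:E) @[L2 --> \oo] -->
  \int[Q]_w expeR (- \sum_(0 <= i < L1) \sum_(j <oo) row_cost i j w).
Proof.
under eq_fun do under eq_integral do rewrite big_box_sum.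
apply: (cvg_integral_expeRN
  (a := fun L2 w => \sum_(0 <= i < L1) \sum_(0 <= j < L2) row_cost i j w)).
- by move=> L2; apply: emeasurable_sum => i; exact: emeasurable_sum.
- by apply: emeasurable_sum => i; exact: measurable_nneseries.
- by move=> L2 w; apply: sume_ge0 => i _; exact: sume_ge0.
- move=> w L L' LL'; apply: lee_sum => i _.
  exact: (ereal_nondecreasing_series (u_ := fun j => row_cost i j w) (P := xpredT)).
- move=> w; apply: cvg_nnesum => i _; last exact: is_cvg_nneseries.
  by apply: nearW => L; exact: sume_ge0.
Qed.

Let cvg_cost :
  \int[Q]_w expeR (- \sum_(0 <= i < L1) \sum_(j <oo) row_cost i j w) @[L1 --> \oo] -->
  \int[Q]_w expeR (- \sum_(i <oo) \sum_(j <oo) row_cost i j w).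
Proof.
apply: (cvg_integral_expeRN
  (a := fun L1 w => \sum_(0 <= i < L1) \sum_(j <oo) row_cost i j w)).
- by move=> L; apply: emeasurable_sum => i; exact: measurable_nneseries.
- apply: measurable_nneseries => i; last exact: measurable_nneseries.
  by move=> w; exact: nneseries_ge0.
- by move=> L w; apply: sume_ge0 => i _; exact: nneseries_ge0.
- move=> w; apply: (ereal_nondecreasing_series (u_ := fun i => \sum_(j <oo) row_cost i j w)
    (P := xpredT)) => i _ _.
  exact: nneseries_ge0.
- by move=> w; apply: is_cvg_nneseries => i _ _; exact: nneseries_ge0.
Qed.

Local Notation mean := (mean_discount tau).

(** Without truncation the thinned count becomes the probability generating
    function of the Poisson number of new atoms. *)
Let cvg_thinned (n : 'I_N) i :
  \int[Q]_w (thinned_count tau L n i (rho n i w))%:E @[L --> \oo] -->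
  (expR (- (fine (path_mass h nu (newborn n i)) * (1 - mean n i))))%:E.
Proof.
have /andP[q0 q1] := mean_discount_bounds mtau tau0 n i.
rewrite -poisson_pgf//; last by rewrite fine_ge0// path_mass_ge0.
rewrite -(integral_number n i (g := fun k => mean n i ^+ k)%R); last by move=> k; exact: exprn_ge0.
apply: (@dominated_cvg _ _ _ Q setT measurableT _ _ (cst 1)) => //.
- by move=> L; apply/measurable_EFinP; exact: measurableT_comp.
- move=> w _; apply: cvg_near_cst; exists (rho n i w) => // L /= kL; congr (_%:E).
  rewrite /thinned_count -big_mkcond /= -[LHS]big_filter.
  rewrite (filter_iota_ltn 0 kL) big_const_seq count_predT size_iota.
  by rewrite -Monoid.iteropE.
- exact: finite_measure_integrable_cst.
- move=> L w _; rewrite gee0_abs ?lee_fin.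
  + by apply: prodr_ile1 => j _; case: ifP => _; rewrite ?q0 ?q1 ?ler01 ?lexx.
  + by apply: prodr_ge0 => j _; case: ifP => _.
Qed.

(** The truncation of the labels is removed first in the rank j, which turns the
    factors into exponentials, then in the weight i. *)
Lemma laplace_construction :
  \int[Q]_w expeR (- \sum_(i <oo) \sum_(j <oo) \sum_(m < N) (atom_cost (m, i, j) w)%:E) =
  expeR (- \int[nu \x G]_z (1 - \prod_(m < N) pmf_laplace h z.1 (tau m z.2))).
Proof.
pose rate i := \sum_(0 <= n < N)
  path_mass h nu (newborn n i) * (1 - \int[G]_p (predictive h nu N tau (newborn n i) p)%:E).
have rateE i : rate i =
    (\sum_(n < N) fine (path_mass h nu (newborn n i)) * (1 - mean n i))%R%:E.
  rewrite /rate big_mkord -sumEFin; apply: eq_bigr => n _.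
  by rewrite EFinM EFinB EFin_mean_discount// fineK// path_mass_fin_num// has_newborn.
have rate0 i : 0 <= rate i.
  rewrite rateE lee_fin sumr_ge0// => n _; rewrite mulr_ge0 ?fine_ge0 ?path_mass_ge0//.
  by rewrite subr_ge0; have /andP[] := mean_discount_bounds mtau tau0 n i.
have eqL L1 : \int[Q]_w expeR (- \sum_(0 <= i < L1) \sum_(j <oo) row_cost i j w) =
    expeR (- \sum_(0 <= i < L1) rate i).
  have boxE L2 : \int[Q]_w expeR (- \sum_(e <- label_box L1 L2) (atom_cost e w)%:E) =
      \prod_(n < N) \prod_(i <- iota 0 L1) \int[Q]_w (thinned_count tau L2 n i (rho n i w))%:E.
    by rewrite -box_cost box_discount.
  rewrite -(cvg_lim (@ereal_hausdorff R) (@cvg_box_cost L1)); apply/cvg_lim => //.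
  under eq_fun do rewrite boxE.
  rewrite (_ : expeR _ = \prod_(n < N) (\prod_(i <- iota 0 L1)
    expR (- (fine (path_mass h nu (newborn n i)) * (1 - mean n i))))%R%:E).
    by apply: cvg_prode => n; rewrite -prodEFin; apply: cvg_prode => i; exact: cvg_thinned.
  rewrite expeRN_sum// /index_iota subn0 prodEFin exchange_big/= -prodEFin.
  apply: eq_bigr => i _; rewrite rateE /= -expR_sum -sumrN.
  by congr (_%:E).
rewrite -(cvg_lim (@ereal_hausdorff R) (@cvg_cost)); apply/cvg_lim => //.
under eq_fun do rewrite eqL.
rewrite -(total_rate (h := h))//.
exact: cvg_expeRN_series.
Qed.

End limits.

End construction_laplace.

(** * Laplace functionals determine the laws of tuples of random measures *)

Lemma probability_setD_sub {R : realType} d (T : measurableType d) (A B : set T) :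
  measurable A -> measurable B -> B `<=` A ->
  forall P : probability T R, P (A `\` B) = (P A - P B)%E.
Proof.
move=> mA mB BA P; rewrite measureD ?setIidr//.
by apply: (@le_lt_trans _ _ 1%E); [exact: probability_le1|exact: ltry].
Qed.

Section same_law_from_laplace.
Context {R : realType} {dp} {Psi : measurableType dp} {N : nat}.
Local Open Scope ereal_scope.

Definition msubset {d} (U : measurableType d) := {A : set U | measurable A}.

Definition test_sum {U : Type} (Z : 'I_N -> U -> {measure set Psi -> \bar R})
    (s : seq ('I_N * msubset Psi * {nonneg R})) (w : U) : \bar R :=
  \sum_(l <- s) l.2%:num%:E * Z l.1.1 w (sval l.1.2).

Definition cylinder (c : seq ('I_N * msubset Psi * msubset (\bar R))) :
    set ('I_N -> {measure set Psi -> \bar R}) :=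
  \big[setI/setT]_(l <- c) [set mu | sval l.2 (mu l.1.1 (sval l.1.2))].

Lemma test_sum_ge0 U (Z : 'I_N -> U -> {measure set Psi -> \bar R}) s w : 0 <= test_sum Z s w.
Proof. by apply: sume_ge0 => l _; rewrite mule_ge0// lee_fin. Qed.

Section weights.
Context {d} {T : measurableType d} (Z : 'I_N -> T -> {measure set Psi -> \bar R}).
Hypothesis mZ : forall n A, measurable A -> measurable_fun setT (fun w => Z n w A).

Lemma measurable_test_sum s : measurable_fun setT (test_sum Z s).
Proof.
apply: emeasurable_sum => l; apply: emeasurable_funM; first exact: measurable_cst.
by apply: mZ; exact: (svalP l.1.2).
Qed.

Lemma measurable_cylinder c : measurable [set w | cylinder c (Z ^~ w)].
Proof.
rewrite /cylinder; elim: c => [|l c IHc].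
  by rewrite big_nil; exact: measurableT.
rewrite big_cons; apply: measurableI => //.
rewrite -[X in measurable X]setTI; apply: (mZ l.1.1 (svalP l.1.2)) => //.
exact: (svalP l.2).
Qed.

End weights.

Variables (d : measure_display) (T : measurableType d) (P : probability T R).
Variables (d' : measure_display) (T' : measurableType d') (Q : probability T' R).
Variables (X : 'I_N -> T -> {measure set Psi -> \bar R}).
Variables (Y : 'I_N -> T' -> {measure set Psi -> \bar R}).
Hypothesis mX : forall n A, measurable A -> measurable_fun setT (fun w => X n w A).
Hypothesis mY : forall n A, measurable A -> measurable_fun setT (fun w => Y n w A).
Hypothesis cX : forall n A, measurable A -> count_valued (fun w => X n w A).
Hypothesis cY : forall n A, measurable A -> count_valued (fun w => Y n w A).
Hypothesis laplace_eq : forall s,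
  \int[P]_w expeR (- test_sum X s w) = \int[Q]_w expeR (- test_sum Y s w).

(** The constraints are added one at a time: as s is arbitrary, the transform of
    the next count, weighted by the other constraints, is known for every t, and
    [laplace_unique] applies. *)
Let cylinder_laplace c s :
  \int[P]_w (expeR (- test_sum X s w) * (\1_[set w | cylinder c (X ^~ w)] w)%:E) =
  \int[Q]_w (expeR (- test_sum Y s w) * (\1_[set w | cylinder c (Y ^~ w)] w)%:E).
Proof.
elim: c s => [|[[n [A mA]] [C mC]] c IHc] s.
  rewrite /cylinder big_nil; under eq_integral do rewrite indicT mule1.
  by under [RHS]eq_integral do rewrite indicT mule1.
have split_cyl U (Z : 'I_N -> U -> {measure set Psi -> \bar R}) w :
    expeR (- test_sum Z s w) *
    (\1_[set w | cylinder ((n, exist _ A mA, exist _ C mC) :: c) (Z ^~ w)] w)%:E =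
    (expeR (- test_sum Z s w) * (\1_[set w | cylinder c (Z ^~ w)] w)%:E) *
    (\1_C (Z n w A))%:E.
  rewrite -muleA -EFinM mulrC /cylinder big_cons; congr (_ * _%:E).
  rewrite (_ : [set w | _] = (fun w => Z n w A) @^-1` C `&` [set w | cylinder c (Z ^~ w)])//.
  by rewrite indicI.
under eq_integral do rewrite split_cyl.
under [RHS]eq_integral do rewrite split_cyl.
have W01 U (Z : 'I_N -> U -> {measure set Psi -> \bar R}) w :
    0 <= expeR (- test_sum Z s w) * (\1_[set w | cylinder c (Z ^~ w)] w)%:E <= 1.
  rewrite mule_ge0 ?expeR_ge0//= -[leRHS]mule1 lee_pmul ?expeR_ge0//.
    by rewrite expeRN_le1// test_sum_ge0.
  by rewrite lee_fin indicE; case: (_ \in _).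
have mW dU (U : measurableType dU) (Z : 'I_N -> U -> {measure set Psi -> \bar R}) :
    (forall n A, measurable A -> measurable_fun setT (fun w => Z n w A)) ->
    measurable_fun setT (fun w => expeR (- test_sum Z s w) * (\1_[set w | cylinder c (Z ^~ w)] w)%:E).
  move=> mZ; apply: emeasurable_funM.
    by apply: measurable_expeRN; exact: measurable_test_sum.
  by apply: measurable_indice; exact: measurable_cylinder.
have add_test U (Z : 'I_N -> U -> {measure set Psi -> \bar R}) (t : R) (t0 : (0 <= t)%R) w :
    expeR (- test_sum Z s w) * (\1_[set w | cylinder c (Z ^~ w)] w)%:E * expeR (- (t%:E * Z n w A)) =
    expeR (- test_sum Z ((n, exist _ A mA, NngNum t0) :: s) w) *
      (\1_[set w | cylinder c (Z ^~ w)] w)%:E.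
  rewrite [in RHS]/test_sum big_cons/= -/(test_sum Z s w) oppeD; last first.
    by apply: ge0_adde_def; rewrite inE ?test_sum_ge0// mule_ge0.
  by rewrite expeRD muleAC [X in X * _]muleC.
apply: laplace_unique.
- exact: mW.
- exact: mX.
- exact: mW.
- exact: mY.
- by move=> w; have /andP[] := W01 _ X w.
- by move=> w; have /andP[] := W01 _ X w.
- by move=> w; have /andP[] := W01 _ Y w.
- by move=> w; have /andP[] := W01 _ Y w.
- exact: cX.
- exact: cY.
move=> t t0; under eq_integral do rewrite (add_test _ _ _ t0).
by under [RHS]eq_integral do rewrite (add_test _ _ _ t0).
Qed.

Let cylinder_prob c :
  P [set w | cylinder c (X ^~ w)] = Q [set w | cylinder c (Y ^~ w)].
Proof.
have := cylinder_laplace c [::].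
under eq_integral do rewrite /test_sum big_nil oppe0 expeR0 mul1e.
under [X in _ = X]eq_integral do rewrite /test_sum big_nil oppe0 expeR0 mul1e.
rewrite !integral_indic// ?setIT//.
  exact: measurable_cylinder.
exact: measurable_cylinder.
Qed.

(** Cylinders form a pi-system that generates the events of the tuple. *)
Lemma same_law_laplace : same_law P X Q Y.
Proof.
pose H := [set E | [/\ measurable [set w | E (X ^~ w)], measurable [set w | E (Y ^~ w)] &
  P [set w | E (X ^~ w)] = Q [set w | E (Y ^~ w)]]].
suff sub : measure_tuple_events (R := R) (Psi := Psi) (N := N) `<=` H.
  by move=> E /sub[].
apply: (@subset_trans _ <<s range cylinder >>).
  apply: sub_smallest2r; first exact: smallest_sigma_algebra.
  move=> _ [[n A] mA [C mC <-]].
  exists [:: (n, exist _ A mA, exist _ C mC)] => //.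
  by rewrite /cylinder big_seq1 setTI.
apply: lambda_system_subset.
- move=> _ _ [c1 _ <-] [c2 _ <-]; exists (c1 ++ c2) => //.
  by rewrite /cylinder big_cat.
- split.
  + by [].
  + by split; rewrite ?[X in measurable X](_ : _ = setT)// !probability_setT.
  + move=> A B BA [mAX mAY eA] [mBX mBY eB]; split.
    * exact: (measurableD mAX mBX).
    * exact: (measurableD mAY mBY).
    * have := probability_setD_sub mAX mBX (fun w => BA (X ^~ w)) P.
      have := probability_setD_sub mAY mBY (fun w => BA (Y ^~ w)) Q.
      by rewrite eA eB => <-.
  + move=> F ndF HF.
    have mUX : measurable (\bigcup_k [set w | F k (X ^~ w)]).
      by apply: bigcupT_measurable => k; case: (HF k).
    have mUY : measurable (\bigcup_k [set w | F k (Y ^~ w)]).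
      by apply: bigcupT_measurable => k; case: (HF k).
    split => //.
    apply: (@cvg_unique _ (@ereal_hausdorff R)
      ((fun k => P [set w | F k (X ^~ w)]) @ \oo)).
      apply: (nondecreasing_cvg_mu (F := fun k => [set w | F k (X ^~ w)])) => //.
        by move=> k; case: (HF k).
      by move=> m n mn; apply/subsetPset => w; move/subsetPset: (ndF _ _ mn); exact.
    rewrite (_ : (fun k => _) = (fun k => Q [set w | F k (Y ^~ w)])).
      apply: (nondecreasing_cvg_mu (F := fun k => [set w | F k (Y ^~ w)])) => //.
        by move=> k; case: (HF k).
      by move=> m n mn; apply/subsetPset => w; move/subsetPset: (ndF _ _ mn); exact.
    by apply/funext => k; case: (HF k).
- by move=> _ [c _ <-]; split; [exact: measurable_cylinder|exact: measurable_cylinder|exact: cylinder_prob].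
- by [].
Qed.

End same_law_from_laplace.

(** * Equality in law of the data and of the construction *)

Section atom_sums.
Context {R : realType}.
Local Open Scope ereal_scope.

Lemma count_valued_nneseries (T : Type) (v : nat -> T -> \bar R) :
  (forall k, count_valued (v k)) -> count_valued (fun w => \sum_(k <oo) v k w).
Proof.
move=> vc w; have v0 k : 0 <= v k w by case: (vc k w) => [->|[n ->]]; rewrite ?leey// lee_fin.
have [[k vk]|fin] := pselect (exists k, v k w = +oo).
  left; apply/eqP; rewrite -leye_eq -vk.
  by rewrite (@nneseriesD1 _ _ k)// leeDl// nneseries_ge0.
have /choice[u uE] k : exists n : nat, v k w = n%:R%:E.
  by case: (vc k w) => // vk; case: fin; exists k.
have := count_valued_series (R := R) (fun k (_ : unit) => u k) tt.
by under eq_eseriesr do rewrite -uE.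
Qed.

Lemma esum_label (N : nat) (F : label N -> \bar R) : (forall e, 0 <= F e) ->
  \esum_(e in [set: label N]) F e = \sum_(i <oo) \sum_(j <oo) \sum_(m < N) F (m, i, j).
Proof.
move=> F0.
transitivity (\esum_(k in [set: 'I_N * nat] `*`` (fun _ => [set: nat])) F (k.1.1, k.1.2, k.2)).
  rewrite (_ : _ `*`` _ = [set: label N]); last by apply/seteqP; split.
  by apply: eq_esum => -[[m i] j].
rewrite -(esum_esum (a := fun mi j => F (mi.1, mi.2, j)))//.
transitivity (\esum_(k in [set: 'I_N] `*`` (fun _ => [set: nat]))
    \esum_(j in [set: nat]) F (k.1, k.2, j)).
  rewrite (_ : _ `*`` _ = [set: 'I_N * nat]); last by apply/seteqP; split.
  by [].
rewrite -(esum_esum (a := fun m i => \esum_(j in [set: nat]) F (m, i, j)))//; last first.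
  by move=> m i _ _; exact: esum_ge0.
rewrite esum_fset; last 2 first.
- exact: finite_finset.
- by move=> m _; apply: esum_ge0 => i _; exact: esum_ge0.
rewrite fsbig_finite; last exact: finite_finset.
transitivity (\sum_(m < N) \esum_(i in [set: nat]) \esum_(j in [set: nat]) F (m, i, j)).
  rewrite -[RHS]big_enum; apply: perm_big; rewrite uniq_perm ?enum_uniq//.
  move=> m; rewrite mem_enum in_fset_set; last exact: finite_finset.
  by rewrite in_setT.
rewrite -esum_sum; last by move=> i m _ _; exact: esum_ge0.
under eq_esum => i _.
  rewrite -esum_sum// -nneseries_esumT; last by move=> j; exact: sume_ge0.
  over.
by rewrite -nneseries_esumT// => i; apply: nneseries_ge0 => j _ _; exact: sume_ge0.
Qed.

Lemma ge0_esumZl (I : choiceType) (D : set I) (c : R) (u : I -> \bar R) :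
  (0 <= c)%R -> (forall i, 0 <= u i) ->
  \esum_(i in D) (c%:E * u i) = c%:E * \esum_(i in D) u i.
Proof.
move=> c0 u0; rewrite /esum -ereal_supZl//.
  congr ereal_sup; rewrite [RHS]image_comp; apply: eq_imagel => A _ /=.
  by rewrite ge0_mule_fsumr.
by apply/set0P; exists (\sum_(i \in set0) u i); exists set0 => //; exact: fsets_set0.
Qed.

Section test_functions.
Context {dp} {Psi : measurableType dp} {N : nat}.
Variable s : seq ('I_N * msubset Psi * {nonneg R}).

Definition test_fun (n : nat) (p : Psi) : R :=
  (\sum_(l <- s | l.1.1 == n :> nat) l.2%:num * \1_(sval l.1.2) p)%R.

Lemma measurable_test_fun n : measurable_fun setT (test_fun n).
Proof.
rewrite (_ : test_fun n = fun p =>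
  (\sum_(l <- s) if l.1.1 == n :> nat then l.2%:num * \1_(sval l.1.2) p else 0)%R).
  2: by apply/funext => p; rewrite /test_fun big_mkcond.
apply: measurable_sum => l; case: (_ == _ :> nat); last exact: measurable_cst.
apply: measurable_funM; first exact: measurable_cst.
exact: (measurable_indic (svalP l.1.2)).
Qed.

Lemma test_fun_ge0 n p : (0 <= test_fun n p)%R.
Proof. by apply: sumr_ge0 => l _; rewrite mulr_ge0. Qed.

(** Testing a tuple of purely atomic measures amounts to summing over the atoms
    a cost that is linear in the weights. *)
Lemma test_sum_atoms (U : Type) (Z : 'I_N -> U -> {measure set Psi -> \bar R})
    (I : choiceType) (y : 'I_N -> I -> nat) (p : I -> Psi) (w : U) :
  (forall n A, measurable A ->
    Z n w A = \esum_(e in [set: I]) ((y n e)%:R%:E * \d_(p e) A)) ->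
  test_sum Z s w =
  \esum_(e in [set: I]) (\sum_(n < N) (y n e)%:R * test_fun n (p e))%R%:E.
Proof.
move=> ZE; have term0 n e A : 0 <= (y n e)%:R%:E * \d_(p e) A :> \bar R.
  by rewrite mule_ge0// lee_fin.
rewrite /test_sum.
under eq_bigr => l _ do rewrite (ZE _ _ (svalP l.1.2)) -ge0_esumZl//.
rewrite big_tnth -esum_sum; last by move=> e l _ _; rewrite mule_ge0// lee_fin.
apply: eq_esum => e _; rewrite /test_fun -(big_tnth _ _ _ xpredT
  (fun l => l.2%:num%:E * ((y l.1.1 e)%:R%:E * \d_(p e) (sval l.1.2)))).
under [in RHS]eq_bigr do rewrite big_mkcond mulr_sumr.
rewrite exchange_big -sumEFin; apply: eq_bigr => l _.
rewrite (bigD1 l.1.1)//= eqxx big1 ?addr0; last first.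
  by move=> n nl; rewrite eq_sym (inj_eq val_inj) (negPf nl) mulr0.
by rewrite diracE indicE -!EFinM mulrCA.
Qed.

End test_functions.

End atom_sums.

Section random_measures.
Context {R : realType} {dt} {Th : measurableType dt} {dp} {Psi : measurableType dp}.
Variables (h : Th -> nat -> R) (nu : {sigma_finite_measure set Th -> \bar R}).
Variables (N : nat) (G : probability Psi R).
Hypothesis hpmf : pmf_kernel h.
Hypothesis mass1_fin : forall v, (\int[nu]_t (h t v.+1)%:E < +oo)%E.
Variables (hc : seq nat -> nat -> \bar R) (M : nat -> nat -> \bar R).
Hypothesis hc0 : forall u v, (0 <= hc u v)%E.
Hypothesis hc_mass : forall u v, (0 < path_mass h nu u < +oo)%E ->
  (hc u v * path_mass h nu u = path_mass h nu (rcons u v))%E.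
Hypothesis M_mass : forall n i, M n.+1 i.+1 = path_mass h nu (newborn n i).
Local Open Scope ereal_scope.

(** Both Laplace functionals have been computed, and their exponents agree. *)
Lemma same_law_construction
    d (T : measurableType d) (P : probability T R) (Z : nat -> T -> Th * Psi)
    (x : 'I_N -> nat -> {RV P >-> nat}) (X : 'I_N -> T -> {measure set Psi -> \bar R})
    d' (T' : measurableType d') (Q : probability T' R)
    (rho : 'I_N -> nat -> {RV Q >-> nat}) (loc : label N -> {RV Q >-> Psi})
    (y : 'I_N -> label N -> {RV Q >-> nat}) (Y : 'I_N -> T' -> {measure set Psi -> \bar R}) :
  (forall k, measurable_fun setT (Z k)) ->
  poisson_point_process P Z (nu \x G) ->
  cond_indep_pmf P (sigma_of setT Z) (fun=> setT)
    (fun nk : 'I_N * nat => x nk.1 nk.2) (fun nk w v => (h (Z nk.2 w).1 v)%:E) ->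
  (forall n w A, measurable A ->
    X n w A = \sum_(k <oo) (x n k w)%:R%:E * \d_((Z k w).2) A) ->
  construction rho loc y G hc M Y ->
  same_law P X Q Y.
Proof.
move=> mZ pppZ xZ XE con.
have mZ2 k : measurable_fun setT (fun w => (Z k w).2) by exact: measurableT_comp.
have mcount d0 (U : measurableType d0) (k : U -> nat) : measurable_fun setT k ->
    measurable_fun setT (fun w => (k w)%:R%:E : \bar R).
  move=> mk; apply/measurable_EFinP.
  by apply: (@measurableT_comp _ _ _ _ _ _ (fun k : nat => k%:R : R)).
have count_term (U : Type) (k : U -> nat) (p : U -> Psi) A :
    count_valued (fun w => (k w)%:R%:E * \d_(p w) A : \bar R).
  by move=> w; right; exists (k w * (p w \in A))%N; rewrite diracE -EFinM natrM.
have YE n w A : measurable A -> Y n w A =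
    \sum_(i <oo) \sum_(j <oo) \sum_(m < N) (y n (m, i, j) w)%:R%:E * \d_(loc (m, i, j) w) A.
  move=> mA; rewrite (construction_atoms con)// esum_label// => e.
  by rewrite mule_ge0// lee_fin.
have X0 k n w A : 0 <= (x n k w)%:R%:E * \d_((Z k w).2) A :> \bar R.
  by rewrite mule_ge0// lee_fin.
have Y0 n i j w A :
    0 <= \sum_(m < N) (y n (m, i, j) w)%:R%:E * \d_(loc (m, i, j) w) A :> \bar R.
  by apply: sume_ge0 => m _; rewrite mule_ge0// lee_fin.
apply: same_law_laplace.
- move=> n A mA; under eq_fun do rewrite XE//.
  apply: measurable_nneseries => // k; apply: emeasurable_funM; first exact: mcount.
  exact: (measurableT_comp (measurable_fun_dirac mA)).
- move=> n A mA; under eq_fun do rewrite YE//.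
  apply: measurable_nneseries => [i w|i]; first exact: nneseries_ge0.
  apply: measurable_nneseries => // j; apply: emeasurable_sum => m.
  apply: emeasurable_funM; first exact: mcount.
  exact: (measurableT_comp (measurable_fun_dirac mA)).
- move=> n A mA; under eq_fun do rewrite XE//.
  by apply: count_valued_nneseries => k; exact: count_term.
- move=> n A mA; under eq_fun do rewrite YE//.
  apply: count_valued_nneseries => i; apply: count_valued_nneseries => j.
  move=> w; right; exists (\sum_(m < N) y n (m, i, j) w * (loc (m, i, j) w \in A))%N.
  rewrite natr_sum -sumEFin; apply: eq_bigr => m _.
  by rewrite diracE natrM.
move=> s.
have mtau n := measurable_test_fun s n.
have tau0 n p := test_fun_ge0 s n p.
transitivity (expeR (- \int[nu \x G]_z (1 - \prod_(m < N) pmf_laplace h z.1 (test_fun s m z.2)))).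
  rewrite -(laplace_data hpmf mZ pppZ xZ (tau := test_fun s))//.
  apply: eq_integral => w _; congr (expeR (- _)).
  rewrite (@test_sum_atoms _ _ _ _ s _ X _ (fun n k => x n k w) (fun k => (Z k w).2)).
    rewrite nneseries_esumT// => k; rewrite lee_fin sumr_ge0// => n _.
    by rewrite mulr_ge0.
  by move=> n A mA; rewrite XE// nneseries_esumT.
rewrite -(laplace_construction (h := h) _ _ _ _ _ con (tau := test_fun s))//.
apply: eq_integral => w _; congr (expeR (- _)).
rewrite (@test_sum_atoms _ _ _ _ s _ Y _ (fun n e => y n e w) (fun e => loc e w)).
  rewrite esum_label// => e; rewrite lee_fin sumr_ge0// => n _.
  by rewrite mulr_ge0.
by move=> n A mA; rewrite (construction_atoms con).
Qed.

End random_measures.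

(** * Conjugate masses of an exponential family *)

Section sigma_finite_copy.
Context {R : realType} d (T : measurableType d) (mu : {measure set T -> \bar R}).
Hypothesis sfin : sigma_finite setT mu.

Definition sigma_finite_copy : set T -> \bar R := let _ := sfin in mu.

HB.instance Definition _ := Measure.copy sigma_finite_copy mu.
HB.instance Definition _ := Measure_isSigmaFinite.Build d T R sigma_finite_copy sfin.

Lemma sigma_finite_measure_ex :
  exists mu' : {sigma_finite_measure set T -> \bar R}, mu' = mu :> (set T -> \bar R).
Proof. by exists sigma_finite_copy. Qed.

End sigma_finite_copy.

Section inner_products.
Context {R : realType} {D : nat}.
Implicit Types u v w : 'rV[R]_D.

Lemma dotvC u v : dotv u v = dotv v u.
Proof. by apply: eq_bigr => i _; rewrite mulrC. Qed.

Lemma dotvDl u v w : dotv (u + v) w = dotv u w + dotv v w.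
Proof. by rewrite /dotv -big_split; apply: eq_bigr => i _; rewrite mxE mulrDl. Qed.

Lemma dotv_suml (I : Type) (r : seq I) (u : I -> 'rV[R]_D) w :
  dotv (\sum_(i <- r) u i) w = \sum_(i <- r) dotv (u i) w.
Proof.
elim: r => [|i r IHr]; last by rewrite !big_cons dotvDl IHr.
by rewrite !big_nil /dotv big1// => i _; rewrite mxE mul0r.
Qed.

End inner_products.

Section exponential_family_masses.
Context {R : realType} {D : nat}.
Variables (S : set R) (f : expFamily R D).
Hypotheses (mS : measurable S) (f_exp : is_expFamily S f).
Variables (gamma : R) (xi : 'rV[R]_D) (lambda : R).
Hypothesis gamma_gt0 : 0 < gamma.
Local Notation kappa := (base_density f).
Local Notation eta := (natural_param f).
Local Notation phi := (sufficient_stat f).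
Local Notation A := (log_partition f).
Local Notation leb := (@lebesgue_measure R).
Local Notation rate := (conjugate_rate f gamma xi lambda).

(** As S carries all the points, any kernel will do outside of S. *)
Definition weight_kernel (t : R) (v : nat) : R :=
  if t \in S then likelihood f t v else (v == 0%N)%:R.

Let measurable_dotv (u : 'rV[R]_D) : measurable_fun S (fun t => dotv u (eta t)).
Proof.
apply: measurable_sum => i; apply: measurable_funM; first exact: measurable_cst.
exact: (measurable_natural_param f_exp).
Qed.

Let measurable_exponent (u : 'rV[R]_D) (c : R) :
  measurable_fun S (fun t => dotv u (eta t) - c * A t).
Proof.
apply: measurable_funB => //; apply: measurable_funM; first exact: measurable_cst.
exact: (measurable_log_partition f_exp).
Qed.

Let measurable_expR_exponent (u : 'rV[R]_D) (c : R) :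
  measurable_fun S (fun t => expR (dotv u (eta t) - c * A t)).
Proof. exact: measurableT_comp. Qed.

Let measurable_if (g1 g2 : R -> R) : measurable_fun S g1 -> measurable_fun setT g2 ->
  measurable_fun setT (fun t => if t \in S then g1 t else g2 t).
Proof.
move=> mg1 mg2; apply: measurable_fun_if => //.
- apply: (measurable_fun_bool true); rewrite setTI.
  by rewrite (_ : _ @^-1` _ = S)//; apply/seteqP; split => t /=; [move/set_mem|move/mem_set].
- rewrite setTI (_ : _ @^-1` _ = S)//.
  by apply/seteqP; split => t /=; [move/set_mem|move/mem_set].
- exact: measurable_funTS.
Qed.

Lemma weight_kernel_pmf : pmf_kernel weight_kernel.
Proof.
split=> [t v|v|t].
- rewrite /weight_kernel; case: ifP => _; last exact: ler0n.
  by rewrite mulr_ge0 ?expR_ge0// (base_density_ge0 f_exp).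
- apply: measurable_if; last exact: measurable_cst.
  apply: measurable_funM; first exact: measurable_cst.
  rewrite (_ : (fun _ => _) = fun t => expR (dotv (phi v) (eta t) - 1 * A t)).
    exact: measurable_expR_exponent.
  by apply/funext => t; rewrite dotvC mul1r.
- rewrite /weight_kernel; have [tS|_] := boolP (t \in S).
    by apply: (likelihood_sum1 f_exp); exact: set_mem.
  have := @nneseries_indic_eq R (cst 1%E) 0%N (fun=> lee01).
  by under eq_eseriesr do rewrite mul1e.
Qed.

Let rate_ge0 t : 0 <= rate t.
Proof. by rewrite mulr_ge0 ?expR_ge0// ltW. Qed.

Let measurable_rate : measurable_fun S rate.
Proof.
apply: measurable_funM; first exact: measurable_cst.
rewrite (_ : (fun _ => _) = fun t => expR (dotv xi (eta t) - lambda * A t)).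
  exact: measurable_expR_exponent.
by apply/funext => t; rewrite mulrN.
Qed.

Section rate_measure.
Variable nu : {measure set R -> \bar R}.
Hypothesis nu_rate : forall C : set R, measurable C ->
  nu C = (\int[leb]_(t in C `&` S) (rate t)%:E)%E.
Local Open Scope ereal_scope.

(** The rate is a finite function, whose sublevel sets have finite mass on bounded
    intervals; the complement of S has no mass. *)
Lemma sigma_finite_rate : sigma_finite setT nu.
Proof.
pose F k : set R := (S `&` [set t | (rate t <= k%:R)%R] `&` `[(- k%:R)%R, k%:R%R]%classic) `|` ~` S.
have mF k : measurable (F k).
  apply: measurableU; last exact: measurableC.
  apply: measurableI => //.
  have := measurable_rate mS (@measurable_itv _ `]-oo, k%:R]).
  by congr measurable; apply/seteqP; split => t /=; rewrite in_itv.
exists F.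
  apply/seteqP; split => // t _; have [tS|tS] := pselect (S t); last by exists 0%N => //; right.
  pose M := Num.max (rate t) `|t|%R.
  have MK : (M <= (Num.truncn M).+1%:R)%R by rewrite ltW// truncnS_gt.
  exists (Num.truncn M).+1 => //; left; split; first split => //=.
    by rewrite (le_trans _ MK)// /M le_max lexx.
  by rewrite /= in_itv/= -ler_norml (le_trans _ MK)// /M le_max lexx orbT.
move=> k; split => //; rewrite nu_rate//.
have mI : measurable (F k `&` S) by exact: measurableI.
apply: (@le_lt_trans _ _ (\int[leb]_(t in F k `&` S) (k%:R)%:E)).
  apply: ge0_le_integral => //.
  - by move=> t _; rewrite lee_fin.
  - by apply/measurable_EFinP; apply: measurable_funS measurable_rate => // t [].
  - by move=> t [[[[_ /=]]|]]; rewrite ?lee_fin.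
rewrite integral_cst// muleC; apply: (@le_lt_trans _ _ (leb `[(- k%:R)%R, k%:R%R]%classic * k%:R%:E)).
  rewrite lee_wpmul2r ?lee_fin//; apply: le_measure; rewrite ?inE//.
  by move=> t [[[]|]].
rewrite lebesgue_measure_itv/=; case: ifP => _; last by rewrite mul0e.
by rewrite -EFinB -EFinM ltry.
Qed.

Lemma integral_rate (g : R -> \bar R) : measurable_fun setT g -> (forall t, 0 <= g t) ->
  \int[nu]_t g t = \int[leb]_(t in S) ((rate t)%:E * g t).
Proof.
move=> mg g0.
pose W t : R := (if t \in S then rate t else 0)%R.
have W0 t : (0 <= W t)%R by rewrite /W; case: ifP.
have mW : measurable_fun setT W by apply: measurable_if => //; exact: measurable_cst.
have patchW (k : R -> \bar R) :
    \int[leb]_(t in S) ((rate t)%:E * k t) = \int[leb]_t ((W t)%:E * k t).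
  rewrite integral_mkcond; apply: eq_integral => t _; rewrite patchE /W.
  by case: ifP => // _; rewrite mul0e.
rewrite patchW; transitivity (\int[nu]_t (cst 1 t * g (id t))).
  by apply: eq_integral => t _; rewrite mul1e.
apply: ge0_integral_transfer => //; first by apply/measurable_EFinP.
move=> C mC; transitivity (nu C).
  by under eq_integral do rewrite mul1e; rewrite integral_indic// setIT.
rewrite -(patchW (fun t => (\1_C t)%:E)) nu_rate//.
rewrite setIC integral_mkcondr; apply: eq_integral => t _.
by rewrite patchE indicE; case: ifP => _; rewrite ?mule1 ?mule0.
Qed.

End rate_measure.

Section masses.
Variable nu : {sigma_finite_measure set R -> \bar R}.
Hypothesis nu_rate : forall C : set R, measurable C ->
  nu C = (\int[leb]_(t in C `&` S) (rate t)%:E)%E.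
Hypothesis nu_infinite : nu `[0, +oo[%classic = +oo%E.
Hypothesis nu_finite_atoms :
  (\sum_(1 <= x <oo) \int[nu]_(t in S) (likelihood f t x)%:E < +oo)%E.
Local Open Scope ereal_scope.
Local Notation mass := (path_mass weight_kernel nu).

Definition path_coef (u : seq nat) : R := (gamma * \prod_(a <- u) kappa a)%R.

Definition log_normalizer (u : seq nat) : \bar R :=
  B S f (xi + \sum_(a <- u) phi a) (lambda + (size u)%:R).

Let normalizer (u : seq nat) : \bar R :=
  \int[leb]_(t in S) (expR (dotv (xi + \sum_(a <- u) phi a) (eta t) -
    (lambda + (size u)%:R) * A t))%:E.

Let normalizer_ge0 u : 0 <= normalizer u.
Proof. by apply: integral_ge0 => t _; rewrite lee_fin expR_ge0. Qed.

Let expeR_log_normalizer u : expeR (log_normalizer u) = normalizer u.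
Proof. by rewrite /log_normalizer /B lneK// in_itv/= leey andbT normalizer_ge0. Qed.

Let path_coef_ge0 u : (0 <= path_coef u)%R.
Proof.
rewrite mulr_ge0//; first exact: ltW.
by rewrite prodr_ge0// => a _; exact: base_density_ge0 f_exp a.
Qed.

(** The conjugacy of the prior: multiplying its density by likelihoods shifts the
    natural parameters. *)
Lemma path_mass_rate u : mass u = (path_coef u)%:E * expeR (log_normalizer u).
Proof.
rewrite expeR_log_normalizer /path_mass integral_rate//; last 2 first.
- by apply/measurable_EFinP; exact: measurable_path_prob weight_kernel_pmf u.
- by move=> t; rewrite lee_fin path_prob_ge0//; exact: weight_kernel_pmf.
rewrite -ge0_integralZl_EFin//; last first.
  by apply/measurable_EFinP; exact: measurable_expR_exponent.
apply: eq_integral => t tS; rewrite -!EFinM; congr (_%:E).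
have -> : path_prob weight_kernel u t =
    (\prod_(a <- u) kappa a * expR (\sum_(a <- u) dotv (phi a) (eta t) - (size u)%:R * A t))%R.
  rewrite /path_prob /weight_kernel tS; elim: u => [|a u IHu].
    by rewrite !big_nil mul0r subr0 expR0 mulr1.
  rewrite !big_cons IHu /likelihood dotvC mulrACA -expRD; congr (_ * expR _)%R.
  by rewrite /= -natr1; ring.
rewrite /conjugate_rate /path_coef dotvDl dotv_suml mulrACA -expRD.
by congr (_ * expR _)%R; ring.
Qed.

Lemma first_mass_fin v : \int[nu]_t (weight_kernel t v.+1)%:E < +oo.
Proof.
have -> : \int[nu]_t (weight_kernel t v.+1)%:E = \int[nu]_(t in S) (likelihood f t v.+1)%:E.
  rewrite [RHS]integral_mkcond; apply: eq_integral => t _.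
  by rewrite patchE /weight_kernel; case: ifP.
apply: le_lt_trans nu_finite_atoms.
have l0 x : 0 <= \int[nu]_(t in S) (likelihood f t x)%:E.
  apply: integral_ge0 => t _; rewrite lee_fin.
  by rewrite mulr_ge0 ?expR_ge0// (base_density_ge0 f_exp).
rewrite -(nneseries_addn (f := fun x => \int[nu]_(t in S) (likelihood f t x)%:E) 1)//.
by rewrite (@nneseriesD1 _ _ v)// addn1 leeDl// nneseries_ge0.
Qed.

Lemma hcond_ge0 u v : 0 <= hcond S f xi lambda u v.
Proof. by rewrite mule_ge0 ?expeR_ge0// lee_fin (base_density_ge0 f_exp). Qed.

(** The normalizer of u is positive and finite, and exp(-B) is its inverse. *)
Lemma hcond_mass u v : 0 < mass u < +oo ->
  hcond S f xi lambda u v * mass u = mass (rcons u v).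
Proof.
have BS : B S f (xi + \sum_(a <- u) phi a + phi v) (lambda + (size u).+1%:R) =
    log_normalizer (rcons u v).
  rewrite /log_normalizer size_rcons -cats1 big_cat big_seq1 addrA//.
rewrite /hcond BS -/(log_normalizer u) => /andP[m0 moo].
have [c0 n0] : (0 < path_coef u)%R /\ 0 < normalizer u.
  move: m0; rewrite path_mass_rate expeR_log_normalizer => m0; split.
    rewrite lt_def path_coef_ge0 andbT; apply/eqP => c0.
    by move: m0; rewrite c0 mul0e ltxx.
  rewrite lt_def normalizer_ge0 andbT; apply/eqP => n0.
  by move: m0; rewrite n0 mule0 ltxx.
have nfin : normalizer u \is a fin_num.
  rewrite ge0_fin_numE// ltey; apply/eqP => noo; move: moo.
  by rewrite path_mass_rate expeR_log_normalizer noo gt0_muley ?lte_fin// ltxx.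
have cancel : expeR (- log_normalizer u) * normalizer u = 1.
  move: n0 nfin; rewrite -expeR_log_normalizer; case: (log_normalizer u) => [r| |]//=.
    by move=> _ _; rewrite -EFinM -expRD addNr expR0.
  by rewrite ltxx.
rewrite !path_mass_rate !expeR_log_normalizer expeRD expeR_log_normalizer.
have -> : path_coef (rcons u v) = (path_coef u * kappa v)%R.
  by rewrite /path_coef -cats1 big_cat big_seq1 mulrA.
rewrite EFinM -[RHS]mule1 -cancel.
set K := (kappa v)%:E; set E := expeR _; set C := (path_coef u)%:E.
set I := normalizer u; set J := normalizer _.
by rewrite (muleC E) (muleA K J E) muleACA (muleC (K * J) C) [C * (K * J)]muleA.
Qed.

Lemma new_rate_mass n v :
  new_rate S f gamma xi lambda n.+1 v.+1 = mass (newborn n v).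
Proof.
rewrite path_mass_rate /new_rate /path_coef /log_normalizer /newborn size_rcons size_nseq/=.
rewrite -cats1 !big_cat !big_seq1 /= !big_nseq !addrA mulrA.
by rewrite -!Monoid.iteropE.
Qed.

(** The densities are positive on S, which is not negligible as nu is infinite. *)
Lemma mass_gt0 u : all (fun a => kappa a != 0%R) u -> 0 < mass u.
Proof.
move=> ku; rewrite path_mass_rate expeR_log_normalizer mule_gt0//.
  rewrite lte_fin mulr_gt0// big_seq prodr_gt0// => a au.
  by rewrite lt_def (allP ku)// (base_density_ge0 f_exp).
rewrite lt_def normalizer_ge0 andbT; apply/eqP => n0.
have : ae_eq leb S (fun t => (expR (dotv (xi + \sum_(a <- u) phi a) (eta t) -
    (lambda + (size u)%:R) * A t))%:E) (cst 0).
  apply/ae_eq_integral_abs => //; first by apply/measurable_EFinP; exact: measurable_expR_exponent.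
  by rewrite -[RHS]n0; apply: eq_integral => t _; rewrite gee0_abs ?lee_fin ?expR_ge0.
move=> expR0; have mI : measurable (`[0%R, +oo[%classic `&` S) by exact: measurableI.
move: nu_infinite; rewrite nu_rate//.
rewrite (ae_eq_integral (cst 0))//; first by rewrite integral0.
- by apply/measurable_EFinP; apply: measurable_funS measurable_rate => // t [].
- apply: filterS expR0 => t expR0 [_ tS].
  by have := expR_gt0 (dotv (xi + \sum_(a <- u) phi a) (eta t) - (lambda + (size u)%:R) * A t);
    rewrite -lte_fin expR0// ltxx.
Qed.

(** The masses of the one-step extensions of u add up to the mass of u. *)
Lemma hcond_sum1 u : has (leq 1) u -> all (fun a => kappa a != 0%R) u ->
  \sum_(v <oo) hcond S f xi lambda u v = 1.
Proof.
move=> u1 ku; have m0 := mass_gt0 ku.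
have mfin : mass u \is a fin_num := path_mass_fin_num weight_kernel_pmf first_mass_fin u1.
have mbnd : 0 < mass u < +oo by rewrite m0 -ge0_fin_numE// ltW.
have sum_mass : \sum_(v <oo) mass (rcons u v) = mass u.
  rewrite -integral_nneseries//; last 2 first.
  - move=> v; apply/measurable_EFinP.
    exact: measurable_path_prob weight_kernel_pmf _.
  - by move=> v t _; rewrite lee_fin path_prob_ge0//; exact: weight_kernel_pmf.
  apply: eq_integral => t _; under eq_eseriesr do rewrite path_prob_rcons EFinM.
  rewrite nneseriesZle; last 2 first.
  - by move=> v; rewrite lee_fin (pmf_kernel_ge0 weight_kernel_pmf).
  - by rewrite lee_fin path_prob_ge0//; exact: weight_kernel_pmf.
  by rewrite (pmf_kernel_sum1 weight_kernel_pmf) mule1.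
have : mass u * \sum_(v <oo) hcond S f xi lambda u v = mass u * 1.
  rewrite -nneseriesZle; last 2 first.
  - by move=> v; exact: hcond_ge0.
  - exact: ltW.
  under eq_eseriesr do rewrite muleC hcond_mass//.
  by rewrite sum_mass mule1.
move: m0; rewrite -(fineK mfin) lte_fin => m0 /(congr1 (fun z => ((fine (mass u))^-1)%:E * z)).
by rewrite !muleA -EFinM mulVf ?gt_eqF// !mul1e.
Qed.

End masses.

End exponential_family_masses.

Theorem corollary6p2 (R : realType) (dp : measure_display)
    (Psi : measurableType dp)
    (singletons : forall p : Psi, measurable [set p])
    (G : probability Psi R) (G_diffuse : forall p : Psi, G [set p] = 0%E)
    (S : set R) (S_measurable : measurable S) (S_ge0 : S `<=` `[0, +oo[)
    (D : nat) (f : expFamily R D) (f_expFamily : is_expFamily S f)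
    (gamma : R) (gamma_gt0 : 0 < gamma) (xi : 'rV[R]_D) (lambda : R)
    (nu : {measure set R -> \bar R})
    (nu_rate : forall C : set R, measurable C ->
      nu C = (\int[@lebesgue_measure R]_(t in C `&` S)
                (conjugate_rate f gamma xi lambda t)%:E)%E)
    (nu_infinite : nu `[0, +oo[%classic = +oo%E)
    (nu_finite_atoms :
      (\sum_(1 <= x <oo) \int[nu]_(t in S) (likelihood f t x)%:E < +oo)%E)
    (N : nat)
    (* the prior Theta and the conditionally i.i.d. X_1, ..., X_N *)
    (d : measure_display) (T : measurableType d) (P : probability T R)
    (theta : nat -> {RV P >-> R}) (psi : nat -> {RV P >-> Psi})
    (Theta : T -> {measure set Psi -> \bar R})
    (prior : ordinary_CRM S nu G theta psi Theta)
    (x : 'I_N -> nat -> {RV P >-> nat})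
    (X : 'I_N -> T -> {measure set Psi -> \bar R})
    (data : fixed_CRMs
      (sigma_of setT (fun k w => (theta k w, psi k w))) psi
      (fun k w v => (likelihood f (theta k w) v)%:E) x X) :
  (* h_cond is a probability mass function and the Poisson means are finite *)
  [/\ (forall u : seq nat, has (leq 1) u ->
         all (fun a => base_density f a != 0) u ->
         (\sum_(v <oo) hcond S f xi lambda u v = 1)%E),
      (forall n v : nat, (new_rate S f gamma xi lambda n.+1 v.+1 < +oo)%E) &
  (* the construction has the law of X_1, ..., X_N *)
      (forall (d' : measure_display) (T' : measurableType d')
         (Q : probability T' R)
         (rho : 'I_N -> nat -> {RV Q >-> nat})
         (loc : label N -> {RV Q >-> Psi})
         (y : 'I_N -> label N -> {RV Q >-> nat})
         (Y : 'I_N -> T' -> {measure set Psi -> \bar R}),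
         construction rho loc y G (hcond S f xi lambda)
           (new_rate S f gamma xi lambda) Y ->
         same_law P X Q Y)].
Proof.
(* nu' is nu, bundled with its sigma-finiteness for the sake of product measures *)
have [nu' nuE] := sigma_finite_measure_ex
  (sigma_finite_rate S_measurable f_expFamily gamma_gt0 nu_rate).
have nu'_rate C : measurable C -> nu' C = (\int[@lebesgue_measure R]_(t in C `&` S)
    (conjugate_rate f gamma xi lambda t)%:E)%E.
  by rewrite nuE; exact: nu_rate.
have nu'_infinite : nu' `[0, +oo[%classic = +oo%E by rewrite nuE.
have nu'_finite_atoms :
    (\sum_(1 <= x <oo) \int[nu']_(t in S) (likelihood f t x)%:E < +oo)%E.
  rewrite (eq_eseriesr (g := fun x => (\int[nu]_(t in S) (likelihood f t x)%:E)%E))// => v _.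
  by apply: eq_measure_integral => C _ _; exact: (congr1 (fun m => m C) nuE).
have hpmf := weight_kernel_pmf S_measurable f_expFamily.
have mass1_fin := first_mass_fin f_expFamily nu'_finite_atoms.
have M_mass := new_rate_mass S_measurable f_expFamily gamma_gt0 nu'_rate.
split.
- move=> u u1 ku.
  exact: (hcond_sum1 S_measurable f_expFamily gamma_gt0 nu'_rate nu'_infinite nu'_finite_atoms).
- move=> n v; rewrite M_mass.
  by apply: path_mass_fin => //; exact: has_newborn.
move=> d' T' Q rho loc y Y con.
have mpoint k : measurable_fun setT (fun w => (theta k w, psi k w)).
  by apply/measurable_fun_pairP; split; exact: measurable_funP.
apply: (same_law_construction (h := weight_kernel S f) (nu := nu')
  (Z := fun k w => (theta k w, psi k w)) (x := x) hpmf mass1_fin _ _ _ _ _ _ _ con) => //.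
- by move=> u v; exact: hcond_ge0.
- move=> u v; exact: (hcond_mass S_measurable f_expFamily gamma_gt0 nu'_rate).
- by rewrite nuE; exact: ordinary_points prior.
- move=> J v A FA AD; rewrite (fixed_weights data v FA AD).
  apply: eq_integral => w _; apply: eq_bigr => nk _; congr (_%:E).
  by rewrite /weight_kernel mem_set//; exact: (ordinary_weights prior).
- by move=> n w A mA; rewrite (fixed_atoms data).
Qed.
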